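(* The critical intensities of the marked random connection model satisfy $$\lambda_T^{(\infty)}\le \lambda_O\le \lambda_T^{(1)}\le \lambda_c .$$ If moreover $$\operatorname*{ess\,sup}_{a,b\in\mathcal E}\int_{\mathbb R^d}\varphi(\overline x;a,b)\,\mathrm d\overline x<\infty ,$$ then $\lambda_T^{(p)}=\lambda_O$ for all $p\in[1,\infty]$.
   Context: Marked random connection model (RCM). Let $d\ge1$, let $(\mathcal E,\Sigma_{\mathcal E},\mathcal P)$ be a separable probability space (mark space), $\mathbb X=\mathbb R^d\times\mathcal E$, $\nu=\mathrm{Leb}\otimes\mathcal P$. Points are written $x=(\overline x,a)$. Let $\varphi:\mathbb X^2\to[0,1]$ be measurable, symmetric, and with $\varphi((\overline x,a),(\overline y,b))=\varphi(\overline x-\overline y;a,b)=\varphi(\overline y-\overline x;a,b)$. For $\lambda\ge0$ let $\eta$ be a Poisson point process on $\mathbb X$ with intensity measure $\lambda\nu$; given $\eta$, every pair of distinct points $x,y$ of $\eta$ is joined by an edge independently with probability $\varphi(x,y)$. The resulting random graph is $\xi$, with law $\mathbb P_\lambda$ and expectation $\mathbb E_\lambda$. For deterministic $x_1,\dots,x_m\in\mathbb X$, $\xi^{x_1,\dots,x_m}$ is the random graph constructed in the same way on the vertex set $\eta\cup\{x_1,\dots,x_m\}$. Two vertices are connected ($x\leftrightarrow y$) if they are equal or joined by a path. $\mathscr C(x)$ is the set of vertices connected to $x$ in $\xi^x$. Let $\tau_\lambda(x,y)=\mathbb P_\lambda(x\leftrightarrow y\text{ in }\xi^{x,y})=\tau_\lambda(\overline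 x-\overline y;a,b)$. Let $\theta_\lambda(a)=\mathbb P_\lambda(|\mathscr C(\overline 0,a)|=\infty)$ and $\chi_\lambda(a)=\mathbb E_\lambda[|\mathscr C(\overline 0,a)|]$ for $a\in\mathcal E$, and let $\|\cdot\|_p$ be the $L^p(\mathcal E,\mathcal P)$ norm. Define $$\lambda_c^{(p)}=\inf\{\lambda\ge0:\|\theta_\lambda\|_p>0\},\qquad \lambda_T^{(p)}=\inf\{\lambda\ge0:\|\chi_\lambda\|_p=\infty\}\qquad(p\in[1,\infty]).$$ The value $\lambda_c^{(p)}$ does not depend on $p$ and is denoted $\lambda_c$. With $\widehat\tau_\lambda(k;a,b)=\int e^{ik\cdot\overline x}\tau_\lambda(\overline x;a,b)\,\mathrm d\overline x$, let $\widehat{\mathcal T}_\lambda(k)$ be the integral operator on $L^2(\mathcal E)$ with kernel $\widehat\tau_\lambda(k;\cdot,\cdot)$, i.e. $[\widehat{\mathcal T}_\lambda(k)f](a)=\int\widehat\tau_\lambda(k;a,b)f(b)\mathcal P(\mathrm db)$. $\|\cdot\|_{\rm op}$ is the $L^2$ operator norm, set to $+\infty$ if the operator is not defined on all of $L^2(\mathcal E)$. Define $\lambda_O=\inf\{\lambda>0:\|\widehat{\mathcal T}_\lambda(0)\|_{\rm op}=\infty\}$. The infimum of the empty set is $+\infty$. *)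

(* Defs.v *)
From HB Require Import structures.
From mathcomp Require Import all_boot all_order all_algebra.
From mathcomp Require Import interval_inference.
From mathcomp Require Import all_classical all_reals all_analysis.
From mathcomp Require Import complex.
From Stdlib Require Relation_Operators.

Set Implicit Arguments.
Unset Strict Implicit.
Unset Printing Implicit Defensive.
Import Order.TTheory GRing.Theory Num.Theory.
Import numFieldNormedType.Exports.

Local Open Scope classical_set_scope.
Local Open Scope ring_scope.

(* R^d as a measurable space: 'rV[R]_d with the sigma-algebra generated by the
   coordinates, which is the Borel sigma-algebra. *)

Section rV_measurable.
Context {R : realType} (n : nat).

Definition rV_coord (i : 'I_n) (x : 'rV[R]_n) : R := x ord0 i.

Let rV_measurable0 : g_sigma_preimage rV_coord set0.
Proof. exact: sigma_algebra0. Qed.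

Let rV_measurableC A :
  g_sigma_preimage rV_coord A -> g_sigma_preimage rV_coord (~` A).
Proof. exact: sigma_algebraC. Qed.

Let rV_measurable_bigcup (F : _^nat) :
  (forall i, g_sigma_preimage rV_coord (F i)) ->
  g_sigma_preimage rV_coord (\bigcup_i F i).
Proof. exact: sigma_algebra_bigcup. Qed.

HB.instance Definition _ := @isMeasurable.Build default_measure_display
  'rV[R]_n (g_sigma_preimage rV_coord)
  rV_measurable0 rV_measurableC rV_measurable_bigcup.

End rV_measurable.

Lemma measurable_rV_coord {R : realType} n (i : 'I_n) :
  measurable_fun [set: 'rV[R]_n] (rV_coord i).
Proof.
move=> _ Y mY; rewrite setTI; apply: sub_sigma_algebra => /=.
rewrite -bigcup_seq/=; exists i => /=; first by rewrite mem_index_enum.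
by exists Y => //; rewrite setTI.
Qed.

Lemma measurable_fun_rVP {R : realType} d (T : measurableType d) n
    (f : T -> 'rV[R]_n) :
  measurable_fun [set: T] f <->
  forall i, measurable_fun [set: T] (rV_coord i \o f).
Proof.
split=> [mf i|mf]; first exact: measurableT_comp (measurable_rV_coord i) mf.
pose C : set (set 'rV[R]_n) := [set A | measurable (f @^-1` A)].
have sC : sigma_algebra setT C.
  split; rewrite /C/=.
  - by rewrite preimage_set0.
  - by move=> A mA; rewrite setTD preimage_setC; exact: measurableC.
  - by move=> F mF; rewrite preimage_bigcup; exact: bigcupT_measurable.
move=> _ Y mY; rewrite setTI; suff : C Y by [].
apply: mY; split => // A.
rewrite -bigcup_seq/= => -[i _ [B mB <-]]; rewrite /C/= setTI.
by rewrite -[X in measurable X]setTI; exact: mf.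
Qed.

(* Lebesgue measure on R^n, as an iterated product measure. *)

Section lebesgue_rV.
Context {R : realType}.

Definition rV_cons n (p : R * 'rV[R]_n) : 'rV[R]_n.+1 :=
  \row_j oapp (p.2 ord0) p.1 (unlift ord0 j).

Definition rV_uncons n (x : 'rV[R]_n.+1) : R * 'rV[R]_n :=
  (x ord0 ord0, \row_j x ord0 (lift ord0 j)).

Lemma rV_consK n : cancel (@rV_cons n) (@rV_uncons n).
Proof.
move=> [r x]; congr pair; first by rewrite mxE unlift_none.
by apply/rowP => j; rewrite !mxE liftK.
Qed.

Lemma measurable_rV_cons n : measurable_fun setT (@rV_cons n).
Proof.
apply/measurable_fun_rVP => i.
have [j ->|->] := unliftP ord0 i.
  rewrite (_ : _ \o _ = rV_coord j \o snd).
    exact: measurableT_comp (measurable_rV_coord j) measurable_snd.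
  by apply/funext => p /=; rewrite /rV_coord mxE liftK.
rewrite (_ : _ \o _ = fst); first exact: measurable_fst.
by apply/funext => p /=; rewrite /rV_coord mxE unlift_none.
Qed.

Lemma measurable_rV_uncons n : measurable_fun setT (@rV_uncons n).
Proof.
apply: measurable_fun_pair; first exact: measurable_rV_coord.
apply/measurable_fun_rVP => i.
rewrite (_ : _ \o _ = rV_coord (lift ord0 i)); first exact: measurable_rV_coord.
by apply/funext => x /=; rewrite /rV_coord mxE.
Qed.

Section succ.
Variables (n : nat) (m : {sigma_finite_measure set 'rV[R]_n -> \bar R}).

Definition lebesgue_rV_succ : set 'rV[R]_n.+1 -> \bar R :=
  pushforward (lebesgue_measure \x m)%E (@rV_cons n).

Let mcons := @measurable_rV_cons n.

HB.instance Definition _ := Measure.copy lebesgue_rV_succ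
  (measure_function_pushforward__canonical__measure_function_Measure
     (lebesgue_measure \x m)%E mcons).

Let lebesgue_rV_succ_sigma_finite : sigma_finite setT lebesgue_rV_succ.
Proof.
have /sigma_finiteP[F [TF ndF Foo]] := sigma_finiteT (@lebesgue_measure R).
have /sigma_finiteP[G [TG ndG Goo]] := sigma_finiteT m.
exists (fun k => @rV_uncons n @^-1` (F k `*` G k)).
  rewrite -preimage_bigcup -[LHS](preimage_setT (@rV_uncons n)).
  congr (_ @^-1` _); apply/esym/seteqP; split=> // -[x y] _.
  have [i _ Fx] : (\bigcup_i F i) x by rewrite -TF.
  have [j _ Gy] : (\bigcup_i G i) y by rewrite -TG.
  exists (maxn i j) => //; split.
  - by move: x Fx; exact/subsetPset/ndF/leq_maxl.
  - by move: y Gy; exact/subsetPset/ndG/leq_maxr.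
move=> k; have [mF Fk] := Foo k; have [mG Gk] := Goo k; split.
  rewrite -[X in measurable X]setTI; apply: measurable_rV_uncons => //.
  exact: measurableX.
rewrite /lebesgue_rV_succ /pushforward -comp_preimage.
rewrite (_ : _ \o _ = id) ?preimage_id; last first.
  by apply/funext => p; exact: rV_consK.
by rewrite product_measure1E// lte_mul_pinfty// ge0_fin_numE.
Qed.

HB.instance Definition _ := Measure_isSigmaFinite.Build _ _ _
  lebesgue_rV_succ lebesgue_rV_succ_sigma_finite.

End succ.

Fixpoint lebesgue_rV (n : nat) : {sigma_finite_measure set 'rV[R]_n -> \bar R} :=
  if n is k.+1 then lebesgue_rV_succ (lebesgue_rV k) else \d_(0 : 'rV[R]_0).

End lebesgue_rV.
Arguments lebesgue_rV : clear implicits.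

Lemma lebesgue_rV_box {R : realType} n (a b : 'I_n -> R) :
  (forall i, a i <= b i) ->
  lebesgue_rV R n [set x | forall i, x ord0 i \in `]a i, b i]] =
  (\prod_(i < n) (b i - a i))%:E.
Proof.
elim: n a b => [|n IH] a b ab /=.
  by rewrite big_ord0 diracE mem_set//= => -[].
pose S := [set x : 'rV[R]_n.+1 | forall i, x ord0 i \in `]a i, b i]].
transitivity ((lebesgue_measure \x lebesgue_rV R n)%E (@rV_cons R n @^-1` S)).
  by [].
set B := (_ @^-1` _).
have -> : B = `]a ord0, b ord0] `*`
   [set x : 'rV[R]_n | forall i, x ord0 i \in `]a (lift ord0 i), b (lift ord0 i)]].
  apply/seteqP; split => [[r x] /= H|[r x] /= [Hr H] i].
    split; first by have := H ord0; rewrite mxE unlift_none.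
    by move=> i; have := H (lift ord0 i); rewrite mxE liftK.
  by rewrite mxE; have [j ->|->] := unliftP ord0 i; rewrite ?liftK ?unlift_none//=.
rewrite product_measure1E//; last first.
  rewrite (_ : [set _ | _] = \bigcap_(i in [set: 'I_n]) (rV_coord i @^-1` `]a (lift ord0 i), b (lift ord0 i)])).
    apply: fin_bigcap_measurable => // i _.
    by rewrite -[X in measurable X]setTI; exact: measurable_rV_coord.
  by apply/seteqP; split => [x H i _|x H i]; [exact: H|exact: (H i I)].
rewrite IH; last by move=> i; exact: ab.
rewrite big_ord_recl EFinM; congr (_ * _)%E.
have /orP[/eqP abE|ltab] : (a ord0 == b ord0) || (a ord0 < b ord0) by rewrite -le_eqVlt.
  by rewrite abE subrr set_itvoc0 measure0.
transitivity (lebesgue_measure `]a ord0, b ord0]%classic : \bar R); first by [].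
by rewrite lebesgue_measure_itv/= lte_fin ltab.
Qed.

(* The mark space: (E, P) is separable when its measurable sets, with the
   pseudometric P (A symmetric-difference B), have a countable dense subset. *)
Definition separable_probability {R : realType} {de} {E : measurableType de}
    (P : probability E R) :=
  exists2 D : nat -> set E, (forall n, measurable (D n)) &
    forall (A : set E) (e : R), measurable A -> 0 < e ->
      exists n, (P ((A `\` D n) `|` (D n `\` A)) < e%:E)%E.

Section marked_space.
Context {R : realType} {d : nat} {de : measure_display} {E : measurableType de}.

Definition mspace : Type := ('rV[R]_d * E)%type.
HB.instance Definition _ := Measurable.on mspace.

Definition intensity (P : probability E R) : set mspace -> \bar R :=
  (lebesgue_rV R d \x P)%E.

(* phi(z; a, b) *)
Definition diff_form (phi : mspace -> mspace -> R) (z : 'rV[R]_d) (a b : E) :=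
  phi (z, a) (0, b).

Record connection_function (phi : mspace -> mspace -> R) : Prop := {
  connection_measurable :
    measurable_fun [set: mspace * mspace] (fun p => phi p.1 p.2) ;
  connection_itv : forall x y, 0 <= phi x y <= 1 ;
  connection_sym : forall x y, phi x y = phi y x ;
  connection_diff : forall (x y : 'rV[R]_d) (a b : E),
    phi (x, a) (y, b) = diff_form phi (x - y) a b /\
    phi (x, a) (y, b) = diff_form phi (y - x) a b }.

(* A random countable family of points: at the outcome w, the index n carries
   the point [pt n w] if [live n w] holds, and no point otherwise. *)
Record points (Om : Type) := Points {
  live : nat -> set Om ;
  pt : nat -> Om -> mspace }.

Section points.
Context {dO : measure_display} {Om : measurableType dO}.
Implicit Types (Q : probability Om R) (eta v : points Om).

Definition npoints eta (B : set mspace) (w : Om) : \bar R :=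
  counting [set n | live eta n w /\ B (pt eta n w)].

(* Poisson distribution of parameter m in [0, +oo]; the one of parameter +oo is
   concentrated at +oo.  ([poisson_pmf] is not a mass function for parameter 0.) *)
Definition poisson_mass (m : \bar R) (k : nat) : \bar R :=
  if m is r%:E then (r ^+ k / k`!%:R * expR (- r))%:E else 0%E.

(* [eta] enumerates without repetition the points of a Poisson point process
   with intensity measure [mu]. *)
Record poisson_process Q eta (mu : set mspace -> \bar R) : Prop := {
  live_measurable : forall n, measurable (live eta n) ;
  pt_measurable : forall n, measurable_fun [set: Om] (pt eta n) ;
  pt_inj : forall w i j, live eta i w -> live eta j w ->
    pt eta i w = pt eta j w -> i = j ;
  npoints_poisson : forall (B : set mspace) (k : nat), measurable B ->
    Q [set w | npoints eta B w = k%:R%:E] = poisson_mass (mu B) k ;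
  npoints_indep : forall (n : nat) (B : 'I_n -> set mspace) (k : 'I_n -> nat),
    (forall i, measurable (B i)) -> trivIset [set: 'I_n] B ->
    Q (\bigcap_i [set w | npoints eta (B i) w = (k i)%:R%:E]) =
    (\prod_(i < n) Q [set w | npoints eta (B i) w = (k i)%:R%:E])%E }.

(* The family of points of xs and eta; the former get the indices 0, 1, ... *)
Definition add_points (xs : seq mspace) eta : points Om := {|
  live := fun n => if (n < size xs)%N then setT else live eta (n - size xs) ;
  pt := fun n => if (n < size xs)%N then cst (nth point xs n)
                 else pt eta (n - size xs) |}.

Definition sigma_points v : set (set Om) :=
  <<s [set A | exists n, A = live v n \/
         exists2 B, measurable B & A = live v n `&` pt v n @^-1` B] >>.

(* A random graph is given by the events [e i j] that the points of indices i
   and j are joined by an edge.  [edge_law] says that, conditionally on the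
   points, the edges are independent and have probabilities phi (pt i) (pt j);
   it is enough to prescribe the conditional probability that all the pairs of
   a finite set F are edges. *)
Record random_connection (phi : mspace -> mspace -> R) Q v
    (e : nat -> nat -> set Om) : Prop := {
  edge_measurable : forall i j, measurable (e i j) ;
  edge_irr : forall i, e i i = set0 ;
  edge_sym : forall i j, e i j = e j i ;
  edge_live : forall i j, e i j `<=` live v i `&` live v j ;
  edge_law : forall (F : seq (nat * nat)) (A : set Om),
    uniq F -> (forall p, p \in F -> (p.1 < p.2)%N) -> sigma_points v A ->
    Q (A `&` \bigcap_(p in [set` F]) e p.1 p.2) =
    (\int[Q]_(w in A `&` \bigcap_(p in [set` F]) (live v p.1 `&` live v p.2))
        (\prod_(p <- F) phi (pt v p.1 w) (pt v p.2 w))%:E)%E }.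

Definition joined (e : nat -> nat -> set Om) (w : Om) : nat -> nat -> Prop :=
  Relation_Operators.clos_refl_trans nat (fun i j => e i j w).

End points.

(* A realization, at intensity lam, of the random graphs xi^{x_1, ..., x_m}
   for all deterministic x_1, ..., x_m. *)
Record rcm (P : probability E R) (phi : mspace -> mspace -> R)
    (lam : {nonneg R}) := Rcm {
  rcm_display : measure_display ;
  rcm_space : measurableType rcm_display ;
  rcm_law : probability rcm_space R ;
  rcm_points : points rcm_space ;
  rcm_edges : seq mspace -> nat -> nat -> set rcm_space ;
  rcm_poisson : poisson_process rcm_law rcm_points
    (fun B => lam%:num%:E * intensity P B)%E ;
  rcm_connection : forall xs : seq mspace,
    random_connection phi rcm_law (add_points xs rcm_points) (rcm_edges xs) }.

Arguments rcm_edges {P phi lam} r xs i j.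

Section observables.
Context {P : probability E R} {phi : mspace -> mspace -> R} {lam : {nonneg R}}.
Variable xi : rcm P phi lam.

(* The vertices of xi^x connected to x (whose index is 0).  Almost surely x is
   not a point of eta, so that indices and vertices are in bijection. *)
Definition cluster (x : mspace) (w : rcm_space xi) : set nat :=
  joined (rcm_edges xi [:: x]) w 0%N.

Definition theta (a : E) : \bar R :=
  rcm_law xi [set w | infinite_set (cluster (0, a) w)].

Definition chi (a : E) : \bar R :=
  (\int[rcm_law xi]_w counting (cluster (0%R, a) w))%E.

(* In xi^{x, y}, x has index 0 and y has index 1. *)
Definition tau (x y : mspace) : R :=
  fine (rcm_law xi [set w | x = y \/ joined (rcm_edges xi [:: x; y]) w 0%N 1%N]).

(* tau(z; a, b) *)
Definition tau_diff (z : 'rV[R]_d) (a b : E) : R := tau (z, a) (0, b).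

End observables.
End marked_space.
Arguments mspace R d {de} E.

(* Complex-valued functions: an integral is meaningful when the real and the
   imaginary parts are integrable, which is required separately. *)
Section complex_functions.
Context {R : realType} {dT : measure_display} {T : measurableType dT}.
Variable mu : {measure set T -> \bar R}.
Implicit Type f : T -> R[i].

Definition cintegrable f :=
  mu.-integrable setT (fun t => (complex.Re (f t))%:E) /\
  mu.-integrable setT (fun t => (complex.Im (f t))%:E).

Definition cintegral f : R[i] :=
  Complex (Rintegral mu setT (fun t => complex.Re (f t)))
          (Rintegral mu setT (fun t => complex.Im (f t))).

Definition cnorm2 f : \bar R := Lnorm mu 2%:E (fun t => (Normc.normc (f t))%:E).

Definition cL2 f :=
  [/\ measurable_fun setT (fun t => complex.Re (f t)),
      measurable_fun setT (fun t => complex.Im (f t)) & (cnorm2 f < +oo)%E].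

End complex_functions.

Section critical_intensities.
Context {R : realType} {d : nat} {de : measure_display} {E : measurableType de}.
Context {P : probability E R} {phi : mspace R d E -> mspace R d E -> R}.

Section operator.
Context {lam : {nonneg R}}.
Variables (xi : rcm P phi lam) (k : 'rV[R]_d).

Definition fourier_integrand (a b : E) (z : 'rV[R]_d) : R[i] :=
  let u := \sum_(i < d) k ord0 i * z ord0 i in
  Complex (cos u) (sin u) * Complex (tau_diff xi z a b) 0.

Definition tau_hat (a b : E) : R[i] :=
  cintegral (lebesgue_rV R d) (fourier_integrand a b).

Definition T_hat (f : E -> R[i]) (a : E) : R[i] :=
  cintegral P (fun b => tau_hat a b * f b).

(* For almost every a, the kernel is defined at (a, b) for almost every b, and
   the integral defining [T_hat f a] is absolutely convergent. *)
Definition T_hat_defined (f : E -> R[i]) :=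
  {ae P, forall a,
    {ae P, forall b, cintegrable (lebesgue_rV R d) (fourier_integrand a b)} /\
    cintegrable P (fun b => tau_hat a b * f b)}.

(* If some [T_hat f] is not square-integrable, the supremum is already +oo. *)
Definition T_hat_norm : \bar R :=
  if `[< forall f, cL2 P f -> T_hat_defined f >] then
    ereal_sup [set cnorm2 P (T_hat f) | f in
                 [set f | cL2 P f /\ (cnorm2 P f <= 1)%E]]
  else +oo%E.

End operator.

Variable xi : forall lam : {nonneg R}, rcm P phi lam.

Definition intensity_inf (S : set {nonneg R}) : \bar R :=
  ereal_inf [set lam%:num%:E | lam in S].

Definition lambda_c (p : \bar R) : \bar R :=
  intensity_inf [set lam | (0 < Lnorm P p (theta (xi lam)))%E].

Definition lambda_T (p : \bar R) : \bar R :=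
  intensity_inf [set lam | Lnorm P p (chi (xi lam)) = +oo%E].

Definition lambda_O : \bar R :=
  intensity_inf [set lam | 0 < lam%:num /\ T_hat_norm (xi lam) 0 = +oo%E].

End critical_intensities.

(* Main.v *)
Require Import Defs.
From HB Require Import structures.
From mathcomp Require Import all_boot all_order all_algebra.
From mathcomp Require Import interval_inference.
From mathcomp Require Import all_classical all_reals all_analysis ess_sup_inf.
From mathcomp Require Import measurable_realfun.
From mathcomp Require Import complex ring lra.
From Stdlib Require Relation_Operators Operators_Properties.

(** The expected cluster size and the two-point operator see the same object.
    Write k(a, b) for the integral over z of tau(z; a, b), which is the kernel
    of the operator T at k = 0.  Integrating the number of vertices connected
    to (0, a) against the Poisson process gives

      chi(a) = 1 + lam * \int k(a, b) P(db)                          (1)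

    so that chi is, up to an affine change, the function of the row integrals
    of a symmetric nonnegative kernel ([chi_kernel], [kernelC]).

    - If chi is essentially bounded, so are the row integrals of k, and the
      Schur test bounds T on L^2 ([schur_test], [T_hat_norm_lty]); hence
      lambda_T^(oo) <= lambda_O.
    - If T is bounded on L^2, then T applied to the constant function 1, which
      is the function of the row integrals, is in L^2 and therefore in L^1, and
      chi is integrable ([integral_chi_lty]); hence lambda_O <= lambda_T^(1).
    - If chi is integrable, it is finite almost everywhere, and the cluster of
      (0, a) is almost surely finite as soon as chi(a) is
      ([Lnorm1_chi_percolation]); hence lambda_T^(1) <= lambda_c.
    - A vertex connected to (0, a) is a neighbour of (0, a) or is connected to
      a neighbour of (0, a) without using (0, a).  Taking expectations,

        chi(a) <= 1 + lam * \int D(a, b) chi(b) P(db)                 (2)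

      where D(a, b) is the integral of phi(z; a, b) over z ([chi_le]).  If D is
      essentially bounded and chi is integrable, then chi is essentially bounded
      ([Lnormy_chi_lty]).  As chi >= 1 and P is a probability, the conditions
      that the L^p norm of chi is infinite become weaker as p grows; by (2) they
      all coincide, and lambda_O is squeezed between the extreme ones.

    What has to be built is the probabilistic part: (1), (2), the symmetry and
    the measurability of the two-point function.  Only the laws of the point
    process and of the edges are given, so everything is read off an explicit
    formula in a window W of finite intensity measure m.  The number of points
    in the cells of partitions determines the law of the points in W: for
    nonnegative h,

      E [sum over the orderings t of the points in W of h(t); there are k points]
        = exp (- m) \int_(W^k) h dM^k

    ([factorial_formula]), and from it the Palm formula for sums over the j-tuples
    of points in W ([palm_formula]).  Given the points, the edges are independent,
    so that the probability of any event on the edges between finitely many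
    vertices is an explicit polynomial in the values of phi ([graph_law]).
    Together they express the probability that x and y are connected within W as
    a series ([tau_window]) which is the same for the graph on x, y and the
    process, for the graph on y, x and the process, and inside the expectation of
    the number of vertices connected to x.  All the statements follow in W and
    pass to the whole space by monotone convergence along an exhausting sequence
    of windows.  The series depends on W only through its intensity measure, and
    this gives the invariance of the two-point function under the reflections
    z |-> c - z of the positions ([two_point_preserving]), hence the symmetry of
    k. *)

Set Implicit Arguments.
Unset Strict Implicit.
Unset Printing Implicit Defensive.
Import Order.TTheory GRing.Theory Num.Theory.
Import numFieldNormedType.Exports.

Local Open Scope classical_set_scope.
Local Open Scope ring_scope.

(** * Counting the orderings of a finite set *)

Lemma count_permutations_cons (p : pred (seq nat)) (s : seq nat) :
  uniq s -> (0 < size s)%N ->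
  count p (permutations s) =
  (\sum_(x <- s) count (fun t => p (x :: t)) (permutations (rem x s)))%N.
Proof.
move=> us s0; rewrite (permP (permutationsE s0)) undup_id//.
rewrite count_flatten sumnE big_map; rewrite big_map.
by apply: eq_bigr => x _; rewrite count_map.
Qed.

(** Each element of s is the head of equally many orderings of s. *)
Lemma count_permutations_head (D : pred nat) (s : seq nat) :
  uniq s ->
  count (fun t => if t is x :: _ then D x else false) (permutations s) =
  ((size s).-1`! * count D s)%N.
Proof.
move=> us; have [/size0nil ->//|s0] := posnP (size s).
rewrite count_permutations_cons// -sum1_count big_distrr/= [RHS]big_mkcond/=.
rewrite !big_seq; apply: eq_bigr => x xs.
case: (D x); rewrite ?muln1/=; last by rewrite count_pred0.
by rewrite count_predT size_permutations ?rem_uniq// size_rem.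
Qed.

Lemma count_permutations_head2 (D : nat -> nat -> bool) (s : seq nat) :
  uniq s ->
  count (fun t => if t is [:: x, y & _] then D x y else false)
    (permutations s) =
  ((size s).-2`! * \sum_(x <- s) count (fun y => (y != x) && D x y) s)%N.
Proof.
move=> us; have [/size0nil ->|s0] := posnP (size s).
  by rewrite big_nil.
rewrite count_permutations_cons// big_distrr/= !big_seq; apply: eq_bigr => x xs.
rewrite [LHS](count_permutations_head (D x) (rem_uniq x us)) size_rem//.
congr muln.
by rewrite rem_filter// count_filter; apply: eq_count => y /=; rewrite andbC.
Qed.

(** The number of orderings of a set of coloured elements that spell the word u,
    when the colours of the set are those of u: the first letter can be placed
    in as many ways as it occurs, and so on. *)
Fixpoint word_orderings (J : eqType) (u : seq J) : nat :=
  if u is j :: u' then (count_mem j u * word_orderings u')%N else 1%N.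

Lemma count_permutations_map (J : eqType) (c : nat -> J) (s : seq nat)
    (u : seq J) :
  uniq s ->
  count (fun t => map c t == u) (permutations s) =
  (word_orderings u * perm_eq (map c s) u)%N.
Proof.
elim: u s => [|j u IH] s us.
  have [/size0nil ->//|s0] := posnP (size s).
  rewrite (_ : perm_eq _ _ = false) ?muln0; last first.
    by apply/negP => /perm_size; rewrite size_map/= => s1; rewrite s1 in s0.
  apply/eqP; rewrite -leqn0 leqNgt -has_count; apply/hasPn => t.
  by rewrite mem_permutations => /perm_size; case: t => //= e; rewrite -e in s0.
have [/size0nil ->|s0] := posnP (size s).
  by rewrite (_ : perm_eq _ _ = false) ?muln0//; apply/negP => /perm_size.
rewrite count_permutations_cons//.
transitivity (\sum_(x <- s) (c x == j) *
    (word_orderings u * perm_eq (map c s) (j :: u)))%N.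
  rewrite !big_seq; apply: eq_bigr => x xs.
  under eq_count do rewrite /= eqseq_cons.
  case: eqVneq => [cxj|_] /=; last by rewrite mul0n count_pred0.
  rewrite mul1n IH ?rem_uniq//; congr (_ * (nat_of_bool _))%N.
  rewrite -cxj -(perm_cons (c x)); apply/esym.
  by apply: (permPl _); exact: (perm_map c (perm_to_rem xs)).
rewrite -big_distrl -mulnA.
have [pe|] := boolP (perm_eq _ _); last by rewrite /= !muln0.
rewrite /= !muln1; congr muln.
rewrite -[RHS]/(count_mem j (j :: u)) -(permP pe) count_map.
by rewrite -sum1_count [RHS]big_mkcond; apply: eq_bigr => x _ /=; case: eqP.
Qed.

Lemma word_orderingsE (J : finType) (u : seq J) :
  word_orderings u = (\prod_j (count_mem j u)`!)%N.
Proof.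
elim: u => [|j u IH]; first by rewrite big1.
rewrite /= IH eqxx (bigD1 j)//= [in RHS](bigD1 j)//= eqxx factS mulnA.
congr (_ * _)%N; apply: eq_bigr => i ij.
by rewrite [j == i]eq_sym (negbTE ij).
Qed.

Section series.
Context {R : realType}.
Local Open Scope ereal_scope.

Lemma nneseries_finite_support (a : nat -> \bar R) (r : seq nat) :
  (forall i, 0 <= a i) -> uniq r -> (forall i, i \notin r -> a i = 0) ->
  \sum_(i <oo) a i = \sum_(i <- r) a i.
Proof.
move=> a0 ur ar; rewrite nneseries_esumT//.
transitivity (\esum_(i in [set` r]) a i).
  rewrite [RHS]esum_mkcond; apply: eq_esum => i _.
  by case: ifPn => // ir; apply: ar; apply: contra ir => ir; rewrite inE.
by rewrite fsbig_seq// esum_fset//; exact: finite_seq.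
Qed.

(** Countable sums over the finite lists of numbers are written as series
    through the bijection [CodeSeq.decode] of nat with seq nat, because the
    integral commutes with series. *)
Lemma nneseries_permutations (b : pred (seq nat)) (s : seq nat) :
  (forall t, b t -> perm_eq t s) ->
  \sum_(i <oo) (b (CodeSeq.decode i))%:R%:E =
  (count b (permutations s))%:R%:E :> \bar R.
Proof.
move=> bs.
rewrite (@nneseries_finite_support _ (map CodeSeq.code (permutations s))).
- rewrite big_map sumEFin -natr_sum; congr (_%:R%:E).
  rewrite -sum1_count [RHS]big_mkcond; apply: eq_bigr => t _.
  by rewrite CodeSeq.codeK; case: (b t).
- by move=> i; rewrite lee_fin.
- by rewrite map_inj_uniq ?permutations_uniq//; exact: can_inj CodeSeq.codeK.
- move=> i ni; case: (boolP (b _)) => // /bs; rewrite -mem_permutations => ip.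
  case/negP: ni; apply/mapP; exists (CodeSeq.decode i) => //.
  by rewrite CodeSeq.decodeK.
Qed.

End series.

(** * Powers of a finite measure *)

Section power_measure.
Context {R : realType} {dX : measure_display} {X : measurableType dX}.
Local Open Scope ereal_scope.

Definition tuple_cons k (p : X * k.-tuple X) : k.+1.-tuple X :=
  [tuple of p.1 :: p.2].

Lemma measurable_tuple_cons k : measurable_fun setT (@tuple_cons k).
Proof. exact: measurable_cons. Qed.

Section succ.
Variables (k : nat) (N : {finite_measure set X -> \bar R})
  (m : {finite_measure set (k.-tuple X) -> \bar R}).

Definition power_succ : set (k.+1.-tuple X) -> \bar R :=
  pushforward (N \x m)%E (@tuple_cons k).

Let mcons := @measurable_tuple_cons k.

HB.instance Definition _ := Measure.copy power_succ
  (measure_function_pushforward__canonical__measure_function_Measure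
     (N \x m)%E mcons).

Let power_succ_finite : fin_num_fun power_succ.
Proof.
apply: lty_fin_num_fun; rewrite (_ : _ setT = (N \x m) (setT `*` setT)); last first.
  by congr (product_measure1 _ _ _); apply/seteqP; split.
rewrite product_measure1E// lte_mul_pinfty//.
- exact: fin_num_measure.
- by rewrite -ge0_fin_numE// fin_num_measure.
Qed.

HB.instance Definition _ := Measure_isFinite.Build _ _ _
  power_succ power_succ_finite.

End succ.

Fixpoint power_measure (N : {finite_measure set X -> \bar R}) (k : nat) :
    {finite_measure set (k.-tuple X) -> \bar R} :=
  if k is l.+1 then power_succ N (power_measure N l) else \d_([tuple] : 0.-tuple X).

Variable N : {finite_measure set X -> \bar R}.

Lemma integral_power0 (h : 0.-tuple X -> \bar R) :
  measurable_fun setT h -> (forall t, 0 <= h t) ->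
  \int[power_measure N 0]_t h t = h [tuple].
Proof. by move=> mh h0; rewrite integral_dirac// diracT mul1e. Qed.

(** The first coordinate is singled out: it is the base point or the target
    in the integrals below. *)
Lemma integral_powerS k (h : k.+1.-tuple X -> \bar R) :
  measurable_fun setT h -> (forall t, 0 <= h t) ->
  \int[power_measure N k.+1]_t h t =
  \int[N]_x \int[power_measure N k]_t h (tuple_cons (x, t)).
Proof.
move=> mh h0 /=.
rewrite (ge0_integral_pushforward (@measurable_tuple_cons k))//.
have mhc : measurable_fun setT (h \o @tuple_cons k).
  exact: measurableT_comp mh (@measurable_tuple_cons k).
by rewrite preimage_setT fubini_tonelli1// => x; exact: h0.
Qed.

Lemma measurable_integral_power k d (T : measurableType d)
    (h : T * k.-tuple X -> \bar R) :
  measurable_fun setT h -> (forall t, 0 <= h t) ->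
  measurable_fun setT (fun y => \int[power_measure N k]_t h (y, t)).
Proof. by move=> mh h0; exact: measurable_fun_fubini_tonelli_F. Qed.

Lemma power_measure_rect k (A : 'I_k -> set X) :
  (forall i, measurable (A i)) ->
  power_measure N k [set t | forall i, A i (tnth t i)] = \prod_(i < k) N (A i).
Proof.
elim: k A => [|k IH] A mA.
  by rewrite big_ord0 /= diracE mem_set//= => -[].
rewrite /= /power_succ /pushforward.
rewrite (_ : _ @^-1` _ = A ord0 `*`
    [set t : k.-tuple X | forall i, A (lift ord0 i) (tnth t i)]).
  rewrite product_measure1E//; last first.
    rewrite (_ : [set _ | _] = \bigcap_(i in [set: 'I_k])
        ((@tnth _ X)^~ i @^-1` A (lift ord0 i))).
      apply: fin_bigcap_measurable => // i _.
      by rewrite -[X in measurable X]setTI; exact: measurable_tnth.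
    by apply/seteqP; split => [x H i _|x H i]; [exact: H|exact: (H i I)].
  rewrite big_ord_recl; congr (_ * _)%E.
  by apply: IH => i; exact: mA.
apply/seteqP; split => [[x t] /= H|[x t] /= [Hx H] i].
  by split=> [|i]; [exact: (H ord0)|have := H (lift ord0 i); rewrite tnthS].
by have [j ->|->] := unliftP ord0 i; rewrite ?tnthS.
Qed.

End power_measure.

Lemma ge0_integral_mrestr {R : realType} d (T : measurableType d)
    (mu : {measure set T -> \bar R}) (D : set T) (mD : measurable D)
    (f : T -> \bar R) :
  measurable_fun setT f -> (forall x, 0 <= f x)%E ->
  (\int[mrestr mu mD]_x f x = \int[mu]_(x in D) f x)%E.
Proof.
move=> mf f0; rewrite -(setUv D) ge0_integral_setU//.
- rewrite (@eq_measure_integral _ _ _ D (mrestr mu mD) mu); last first.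
    by move=> A mA AD; rewrite /= /mrestr setIidl.
  rewrite [X in (_ + X)%E]null_set_integral ?adde0//.
  + exact: measurableC.
  + exact: measurable_funTS.
  + by rewrite /= /mrestr setICl measure0.
- exact: measurableC.
- by rewrite setUv; exact: mf.
- exact/disj_setPCl.
Qed.

(** * The points of a Poisson process in a window *)

Section partition_rectangles.
Context {R : realType} {dX : measure_display} {X : measurableType dX}.
Variable k : nat.

(** The sides of the rectangles are cells of a single partition of X.  Whether
    the points in a window form such a rectangle then depends only on the number
    of points in each cell, and these are independent. *)
Definition partition_rectangle : set (set (k.-tuple X)) :=
  [set S | exists (J : finType) (C : J -> set X) (s : 'I_k -> J),
    [/\ forall j, measurable (C j), trivIset setT C, \bigcup_j C j = setT &
        S = [set t | forall i, C (s i) (tnth t i)]]].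

Lemma measurable_partition_rectangle S : partition_rectangle S -> measurable S.
Proof.
move=> [J [C [s [mC _ _ ->]]]].
rewrite (_ : [set _ | _] = \bigcap_(i in [set: 'I_k])
    ((@tnth _ X)^~ i @^-1` C (s i))).
  apply: fin_bigcap_measurable => // i _.
  by rewrite -[X in measurable X]setTI; exact: measurable_tnth.
by apply/seteqP; split => [x H i _|x H i]; [exact: H|exact: (H i I)].
Qed.

(** Two partitions have a common refinement. *)
Lemma setI_closed_partition_rectangle : setI_closed partition_rectangle.
Proof.
move=> _ _ [J1 [C1 [s1 [m1 t1 c1 ->]]]] [J2 [C2 [s2 [m2 t2 c2 ->]]]].
exists (J1 * J2)%type, (fun j => C1 j.1 `&` C2 j.2), (fun i => (s1 i, s2 i)).
split => [j|||].
- exact: measurableI.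
- move=> [i1 i2] [j1 j2] _ _ [x [/= [x1 x2] [y1 y2]]].
  by congr (_, _); [apply: t1|apply: t2] => //; exists x.
- apply/seteqP; split => // x _.
  have [j1 _ x1] : (\bigcup_j C1 j) x by rewrite c1.
  have [j2 _ x2] : (\bigcup_j C2 j) x by rewrite c2.
  by exists (j1, j2).
- apply/seteqP; split => [t /= [h1 h2] i|t /= h]; first by split.
  by split => i; have [] := h i.
Qed.

(** A cylinder is a finite union of rectangles on the partition of X into the
    base of the cylinder and its complement. *)
Lemma measurable_tupleE :
  @measurable _ (k.-tuple X) = <<s partition_rectangle >>.
Proof.
apply/seteqP; split; last first.
  apply: smallest_sub; first exact: sigma_algebra_measurable.
  exact: measurable_partition_rectangle.
apply: smallest_sub; first exact: smallest_sigma_algebra.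
move=> S; rewrite -bigcup_seq/= => -[i _ [B mB <-]]; rewrite setTI.
pose C (b : bool) := if b then B else ~` B.
rewrite (_ : _ @^-1` _ = \bigcup_(s in [set s : {ffun 'I_k -> bool} | s i])
    [set t : k.-tuple X | forall l, C (s l) (tnth t l)]); last first.
  apply/seteqP; split => [t /= Bt|t [s /= si h]]; last first.
    by have := h i; rewrite si.
  exists [ffun l => `[< B (tnth t l) >]] => /=; first by rewrite ffunE; apply/asboolP.
  by move=> l; rewrite ffunE; case: asboolP.
suff : measurable (\bigcup_(s in [set s : {ffun 'I_k -> bool} | s i])
    ([set t : k.-tuple X | forall l, C (s l) (tnth t l)]
      : set (g_sigma_algebraType partition_rectangle))) by [].
apply: fin_bigcup_measurable; first exact: finite_finset.
move=> s _; apply: sub_sigma_algebra; exists bool, C, s; split => //.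
- by case => //; exact: measurableC.
- by move=> [] [] _ _ [x []].
- by apply/seteqP; split => // x _; have [] := pselect (B x); [exists true|exists false].
Qed.

Lemma tuple_measure_unique (m1 m2 : {measure set (k.-tuple X) -> \bar R}) :
  (forall S, partition_rectangle S -> m1 S = m2 S) -> (m1 setT < +oo)%E ->
  forall S, measurable S -> m1 S = m2 S.
Proof.
move=> m12 m1oo; apply: (@measure_unique _ _ _ _ (fun=> setT) measurable_tupleE).
- exact: setI_closed_partition_rectangle.
- move=> _; exists unit, (fun=> setT), (fun=> tt); split => //.
  + by move=> [] [].
  + by apply/seteqP; split => // x _; exists tt.
  + by apply/seteqP; split.
- by apply/seteqP; split => // x _; exists 0%N.
- exact: m12.
- by move=> _.
Qed.

End partition_rectangles.

Lemma prod_count_mem {R : comPzSemiRingType} (J : finType) (m : J -> R) (u : seq J) :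
  \prod_j m j ^+ count_mem j u = \prod_(j <- u) m j.
Proof.
elim: u => [|j u IH]; first by rewrite big_nil big1.
rewrite big_cons -IH (bigD1 j)//= [in RHS](bigD1 j)//= eqxx exprS mulrA.
congr (_ * _); apply: eq_bigr => i ij.
by rewrite [j == i]eq_sym (negbTE ij).
Qed.

Section poisson.
Context {R : realType} {d : nat} {de : measure_display} {E : measurableType de}.
Context {dO : measure_display} {Om : measurableType dO}.
Notation X := (mspace R d E).
Variables (Q : probability Om R) (eta : @points R d de E Om)
  (M : {measure set X -> \bar R}).
Hypothesis etaP : poisson_process Q eta M.
Variables (W : set X) (mW : measurable W) (Woo : (M W < +oo)%E).

Definition window (w : Om) : set nat := [set n | live eta n w /\ W (pt eta n w)].

Definition window_is (t : seq nat) : set Om := [set w | window w = [set` t]].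

Lemma measurable_window n : measurable [set w | window w n].
Proof.
rewrite (_ : [set _ | _] = live eta n `&` pt eta n @^-1` W)//.
apply: measurableI; first exact: (live_measurable etaP).
by rewrite -[X in measurable X]setTI; exact: (pt_measurable etaP).
Qed.

Lemma window_isE (t : seq nat) : window_is t =
  \bigcap_n (if n \in t then [set w | window w n] else ~` [set w | window w n]).
Proof.
apply/seteqP; split => [w /= wt n _|w h].
  by case: ifPn => nt /=; rewrite wt//=; apply/negP.
apply/seteqP; split => n /=.
  by have := h n I; case: ifPn.
by move=> nt; have := h n I; rewrite nt.
Qed.

Lemma measurable_window_is t : measurable (window_is t).
Proof.
rewrite window_isE; apply: bigcap_measurable => // n _.
by case: ifPn => _; [|apply: measurableC]; exact: measurable_window.
Qed.

Definition points_tuple k (t : seq nat) (w : Om) : k.-tuple X :=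
  [tuple pt eta (nth 0%N t i) w | i < k].

Lemma measurable_points_tuple k t : measurable_fun setT (@points_tuple k t).
Proof.
apply/measurable_fun_tnthP => i.
rewrite (_ : _ \o _ = pt eta (nth 0%N t i)).
  exact: (pt_measurable etaP).
by apply/funext => w /=; rewrite tnth_mktuple.
Qed.

Let mpt k t := @measurable_points_tuple k t.

(** [window_law_at], [window_law_of] and [window_law] build, as a measure on the
    k-tuples, the expectation of the sum over all the orderings of the points in
    the window, on the event that there are k of them. *)
Definition window_law_at k (t : seq nat) : set (k.-tuple X) -> \bar R :=
  pushforward (mrestr Q (measurable_window_is t)) (@points_tuple k t).

HB.instance Definition _ k t := Measure.copy (@window_law_at k t)
  (measure_function_pushforward__canonical__measure_function_Measure
     (mrestr Q (measurable_window_is t)) (@mpt k t)).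

Definition window_law_of k (i : nat) : {measure set (k.-tuple X) -> \bar R} :=
  let t := CodeSeq.decode i in
  if uniq t && (size t == k) then [the measure _ _ of @window_law_at k t] else [the measure _ _ of mzero].

Definition window_law k := mseries (window_law_of k) 0.

HB.instance Definition _ k := Measure.on (@window_law k).

Definition window_event k (S : set (k.-tuple X)) (t : seq nat) : set Om :=
  [set w | [/\ uniq t, size t = k, window_is t w & S (points_tuple k t w)]].

Lemma measurable_window_event k (S : set (k.-tuple X)) t :
  measurable S -> measurable (window_event S t).
Proof.
move=> mS; rewrite (_ : window_event S t = (if uniq t && (size t == k) then
    window_is t `&` points_tuple k t @^-1` S else set0)).
  case: ifPn => // _; apply: measurableI; first exact: measurable_window_is.
  by rewrite -[X in measurable X]setTI; exact: measurable_points_tuple.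
apply/seteqP; split => [w [ut /eqP st wt Sw]|w]; first by rewrite ut st.
by case: ifPn => // /andP[ut /eqP st] [].
Qed.

Lemma window_lawE k (S : set (k.-tuple X)) : measurable S ->
  window_law S = (\sum_(i <oo) Q (window_event S (CodeSeq.decode i)))%E.
Proof.
move=> mS; apply: eq_eseriesr => i _ /=; rewrite /window_law_of /=.
case: ifPn => [/andP[ut /eqP st]|h] /=.
  rewrite /window_law_at /pushforward /mrestr setIC; congr (Q _).
  by apply/seteqP; split => [w []|w []].
rewrite /mzero (_ : window_event _ _ = set0) ?measure0//.
by rewrite -subset0 => w [ut st _ _]; rewrite ut st eqxx in h.
Qed.

Lemma integral_window_law k (h : k.-tuple X -> \bar R) :
  measurable_fun setT h -> (forall t, 0 <= h t)%E ->
  (\int[@window_law k]_t h t =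
   \sum_(i <oo) (let t := CodeSeq.decode i in
      if uniq t && (size t == k) then
        \int[Q]_(w in window_is t) h (points_tuple k t w) else 0))%E.
Proof.
move=> mh h0; rewrite ge0_integral_measure_series//.
apply: eq_eseriesr => i _; rewrite /window_law_of.
case: ifPn => _; last by rewrite /= integral_measure_zero.
rewrite (ge0_integral_pushforward (@mpt _ _))//.
rewrite preimage_setT ge0_integral_mrestr//; last by move=> w; exact: h0.
by apply: measurableT_comp mh (@mpt _ _).
Qed.

End poisson.

Lemma nneseries_probability {R : realType} d (T : measurableType d)
    (Q : {measure set T -> \bar R}) (B : nat -> set T) :
  (forall i, measurable (B i)) ->
  (\sum_(i <oo) Q (B i) = \int[Q]_w \sum_(i <oo) (\1_(B i) w)%:E)%E.
Proof.
move=> mB; rewrite integral_nneseries//.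
- by apply: eq_eseriesr => i _; rewrite integral_indic// setIT.
- by move=> i; apply/measurable_EFinP; exact: measurable_indic.
Qed.

(** * The law of the points in a window *)

Lemma counting_uniq {R : realType} (s : seq nat) : uniq s ->
  counting [set` s] = (size s)%:R%:E :> \bar R.
Proof.
move=> us; rewrite counting_dirac (@nneseries_finite_support _ _ s)//.
- rewrite -sum1_size natr_sum -sumEFin !big_seq; apply: eq_bigr => n ns.
  by rewrite diracE mem_set.
- by move=> n ns; rewrite diracE memNset//=; apply/negP.
Qed.

Section pointwise.
Context {R : realType} {d : nat} {de : measure_display} {E : measurableType de}.
Context {dO : measure_display} {Om : measurableType dO}.
Notation X := (mspace R d E).
Variables (eta : @points R d de E Om) (W : set X).
Variables (k : nat) (J : finType) (C : J -> set X) (s : 'I_k -> J).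
Hypotheses (tC : trivIset setT C) (cC : \bigcup_j C j = setT).

Let u : seq J := [seq s i | i <- enum 'I_k].
Let S : set (k.-tuple X) := [set t | forall i, C (s i) (tnth t i)].

(** If the window holds finitely many points, the orderings of these points
    that fall in the rectangle S are those whose cells spell the word u; their
    number is determined by the numbers of points in the cells.  If it holds
    infinitely many points, so does one of the finitely many cells, and both sides
    vanish. *)
Lemma series_window_event w :
  (\sum_(i <oo) (\1_(window_event eta W S (CodeSeq.decode i)) w)%:E =
  ((word_orderings u)%:R *
   \1_[set w | forall j, npoints eta (C j `&` W) w = (count_mem j u)%:R%:E] w)%:E
  :> \bar R)%E.
Proof.
have cex n : exists j, C j (pt eta n w).
  by have [j _ Cj] : (\bigcup_j C j) (pt eta n w) by [rewrite cC]; exists j.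
pose c n := sval (cid (cex n)).
have cP n : C (c n) (pt eta n w) by rewrite /c; case: cid.
have cE n j : C j (pt eta n w) <-> j = c n.
  split => [Cj|->//]; apply: tC => //; exists (pt eta n w).
  by split.
have szu : size u = k by rewrite size_map size_enum_ord.
have nthu i : nth (c 0%N) u (i : 'I_k) = s i.
  by rewrite (nth_map i) ?size_enum_ord// nth_ord_enum.
have eventP t : window_event eta W S t w <->
    [/\ uniq t, map c t = u & window eta W w = [set` t]].
  split => [[ut st wt h]|[ut ct wt]].
    split => //; apply: (@eq_from_nth _ (c 0%N)); rewrite size_map st ?szu//.
    move=> i ik; rewrite (nth_map 0%N) ?st// (nthu (Ordinal ik)).
    by apply/esym/cE; have := h (Ordinal ik); rewrite tnth_mktuple.
  have st : size t = k by rewrite -(size_map c) ct.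
  split => // i; rewrite tnth_mktuple; apply/cE.
  by rewrite -nthu -ct (nth_map 0%N) ?st.
under eq_eseriesr => i _ do rewrite indicE.
have [fw|iw] := pselect (finite_set (window eta W w)); last first.
  rewrite eseries0 => [|i _ _]; last first.
    rewrite memNset//= => /eventP[_ _ wt]; apply: iw; rewrite wt.
    exact: finite_seq.
  rewrite indicE memNset ?mulr0//= => h; apply: iw.
  rewrite (_ : window _ _ _ =
      \bigcup_j [set n | live eta n w /\ (C j `&` W) (pt eta n w)]).
    apply: bigcup_finite => [|j _]; first exact: finite_finset.
    by have := h j; rewrite /npoints /counting; case: asboolP.
  apply/seteqP; split => [n [ln Wn]|n [j _ [ln [_ Wn]]]] //.
  by exists (c n).
have [r ur rE] : exists2 r : seq nat, uniq r & window eta W w = [set` r].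
  have /finite_seqP[r rE] := fw; exists (undup r); first exact: undup_uniq.
  by rewrite rE; apply/seteqP; split => n /=; rewrite mem_undup.
rewrite (nneseries_permutations (b := fun t => w \in window_event eta W S t)
  (s := r)); last first.
  move=> t /set_mem/eventP[ut _ wt]; apply: uniq_perm => // n.
  have : [set` t] n <-> [set` r] n by rewrite -wt rE.
  by move=> /= h; apply/idP/idP => /h.
rewrite (_ : count _ _ = (word_orderings u * perm_eq (map c r) u)%N); last first.
  rewrite -count_permutations_map//; apply: eq_in_count => t.
  rewrite mem_permutations => tr.
  apply/idP/eqP => [/set_mem/eventP[]//|ct].
  apply/mem_set/eventP; split => //; first by rewrite (perm_uniq tr).
  by rewrite rE; apply/seteqP; split => n /=; rewrite (perm_mem tr).
rewrite natrM indicE; congr (_ * _%:R)%:E; congr nat_of_bool.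
have cnt j : npoints eta (C j `&` W) w = (count_mem j (map c r))%:R%:E :> \bar R.
  rewrite /npoints (_ : [set _ | _] = [set` [seq n <- r | c n == j]]).
    by rewrite counting_uniq ?filter_uniq// size_filter count_map.
  apply/seteqP; split => n /=; rewrite mem_filter.
    move=> [ln [/cE -> Wn]]; rewrite eqxx/=.
    by have : window eta W w n by []; rewrite rE.
  move=> /andP[/eqP <- nr].
  have [ln Wn] : window eta W w n by rewrite rE.
  by [].
apply/idP/idP => [/permP h|/set_mem h].
  by apply/mem_set => j; rewrite cnt h.
apply/allP => j _ /=; have := h j; rewrite cnt => -[/eqP].
by rewrite eqr_nat.
Qed.

End pointwise.

Section factorial_formula.
Context {R : realType} {d : nat} {de : measure_display} {E : measurableType de}.
Context {dO : measure_display} {Om : measurableType dO}.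
Notation X := (mspace R d E).
Variables (Q : probability Om R) (eta : @points R d de E Om)
  (M : {measure set X -> \bar R}).
Hypothesis etaP : poisson_process Q eta M.

Lemma measurable_npoints B : measurable B ->
  measurable_fun setT (npoints eta B : Om -> \bar R).
Proof.
move=> mB; rewrite (_ : npoints eta B = fun w => \sum_(n <oo)
   (\1_[set w | live eta n w /\ B (pt eta n w)] w)%:E)%E.
  apply: ge0_emeasurable_sum => [n w _ _|n _]; first by rewrite lee_fin.
  by apply/measurable_EFinP; apply: measurable_indic; exact: measurable_window etaP _ mB n.
apply/funext => w; rewrite /npoints counting_dirac; apply: eq_eseriesr => n _.
by rewrite diracE indicE; congr (nat_of_bool _)%:R%:E; apply/idP/idP => /set_mem h; apply/mem_set.
Qed.

Variables (W : set X) (mW : measurable W) (Woo : (M W < +oo)%E).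

Let N : {finite_measure set X -> \bar R} := mfrestr mW Woo.

Lemma measurable_counts (J : finType) (C : J -> set X) (kk : J -> nat) :
  (forall j, measurable (C j)) ->
  measurable [set w | forall j, npoints eta (C j) w = (kk j)%:R%:E :> \bar R].
Proof.
move=> mC; rewrite (_ : [set _ | _] = \bigcap_(j in [set: J])
    ((npoints eta (C j) : Om -> \bar R) @^-1` [set (kk j)%:R%:E])).
  apply: fin_bigcap_measurable; first exact: finite_finset.
  move=> j _; rewrite -[X in measurable X]setTI.
  by apply: measurable_npoints.
by apply/seteqP; split => [x H i _|x H i]; [exact: H|exact: (H i I)].
Qed.

Lemma probability_counts (J : finType) (C : J -> set X) (kk : J -> nat) :
  (forall j, measurable (C j)) -> trivIset setT C ->
  Q [set w | forall j, npoints eta (C j) w = (kk j)%:R%:E :> \bar R] =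
  (\prod_j poisson_mass (M (C j)) (kk j))%E.
Proof.
move=> mC tC.
transitivity (Q (\bigcap_i [set w | npoints eta (C (enum_val i)) w =
    (kk (enum_val (i : 'I_#|J|)))%:R%:E :> \bar R])).
  congr (Q _); apply/seteqP; split => [w h i _|w h j]; first exact: h.
  by have := h (enum_rank j) I; rewrite /= enum_rankK.
rewrite (npoints_indep etaP (fun i => kk (enum_val i))).
- rewrite [RHS](reindex (@enum_val J J)) /=; last first.
    exact: (onW_bij _ (@enum_val_bij J)).
  by apply: eq_bigr => i _; rewrite (npoints_poisson etaP).
- by move=> i; exact: mC.
- move=> i j _ _ h; apply: enum_val_inj; exact: tC.
Qed.

(** By independence of the numbers of points in the cells, both sides are
    products over the cells: the factorials of the Poisson masses cancel with
    the number of orderings, and the exponentials multiply to exp (- M W). *)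
Lemma window_law_partition_rectangle k (S : set (k.-tuple X)) :
  partition_rectangle S ->
  window_law etaP mW S =
  ((expR (- fine (M W)))%:E * power_measure N k S)%E.
Proof.
move=> PS; have mS := measurable_partition_rectangle PS.
case: PS mS => J [C [s [mC tC cC ->]]] mS.
rewrite window_lawE// nneseries_probability; last first.
  by move=> i; exact: (measurable_window_event etaP mW _ mS).
under eq_integral do rewrite series_window_event//.
set u := [seq s i | i <- _].
have mCW j : measurable (C j `&` W) by exact: measurableI.
have moo j : (M (C j `&` W) < +oo)%E.
  by apply: le_lt_trans Woo; apply: le_measure; rewrite ?inE.
under eq_integral do rewrite EFinM.
rewrite ge0_integralZl//; last first.
  apply/measurable_EFinP; apply: measurable_indic.
  exact: (measurable_counts (fun j => count_mem j u)).
rewrite integral_indic ?setIT; last exact: (measurable_counts (fun j => count_mem j u)).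
rewrite [X in (_ * X = _)%E](_ : _ =
    \prod_j poisson_mass (M (C j `&` W)) (count_mem j u))%E; last first.
  apply: (probability_counts (fun j => count_mem j u)) => //.
  by move=> i j _ _ [x [[Ci _] [Cj _]]]; apply: tC => //; exists x.
pose m j := fine (M (C j `&` W)).
have mE j : M (C j `&` W) = (m j)%:E.
  by rewrite fineK// ge0_fin_numE.
rewrite [X in (_ = _ * X)%E](_ : _ = (\prod_(i < k) N (C (s i)))%E); last first.
  by apply: power_measure_rect.
have -> : (\prod_(i < k) N (C (s i)) = (\prod_j m j ^+ count_mem j u)%:E)%E.
  rewrite prod_count_mem big_map big_enum -prodEFin.
  by apply: eq_bigr => i _; rewrite -mE.
rewrite (eq_bigr (fun j => ((m j) ^+ count_mem j u / (count_mem j u)`!%:R *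
    expR (- m j))%:E)) => [|j _]; last by rewrite mE.

rewrite prodEFin -!EFinM; congr (_%:E).
rewrite word_orderingsE natr_prod -big_split/=.
have -> : fine (M W) = \sum_j m j.
  rewrite {1}(_ : W = \bigcup_j (C j `&` W)) ?measure_fin_bigcup//.
  - rewrite (_ : setT = [set` enum J]); last first.
      by apply/seteqP; split => // j _ /=; rewrite mem_enum.
    rewrite -fsbig_seq ?enum_uniq// big_enum/=.
    by under eq_bigr => j _ do rewrite mE; rewrite sumEFin.
  - exact: finite_finset.
  - by move=> i j _ _ [x [[Ci _] [Cj _]]]; apply: tC => //; exists x.
  - by rewrite -setI_bigcupl cC setTI.
rewrite -sumrN expR_sum -big_split/=; apply: eq_bigr => j _.
by field; rewrite pnatr_eq0 -lt0n fact_gt0.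
exact: measurableT.
Qed.

Lemma window_law_power k (S : set (k.-tuple X)) : measurable S ->
  window_law etaP mW S =
  ((expR (- fine (M W)))%:E * power_measure N k S)%E.
Proof.
pose c : {nonneg R} := NngNum (expR_ge0 (- fine (M W))).
pose m1 := [the measure _ _ of @window_law _ _ _ _ _ _ _ _ _ etaP _ mW k].
pose m2 := [the measure _ _ of mscale c (power_measure N k)].
have m12 S' : partition_rectangle S' -> m1 S' = m2 S'.
  exact: window_law_partition_rectangle.
apply: (@tuple_measure_unique _ _ _ _ m1 m2) => //.
rewrite m12; last first.
  exists unit, (fun=> setT), (fun=> tt); split => //.
  + by move=> [] [].
  + by apply/seteqP; split => // x _; exists tt.
  + by apply/seteqP; split.
by rewrite /m2/= /mscale/= lte_mul_pinfty// ?lee_fin ?expR_ge0// -ge0_fin_numE// fin_num_measure.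
Qed.

(** The law of the points in W, weighted by their orderings: two finite measures
    that agree on the partition rectangles are equal, because these rectangles
    are stable under intersection and generate the sigma-algebra. *)
Lemma factorial_formula k (h : k.-tuple X -> \bar R) :
  measurable_fun setT h -> (forall t, 0 <= h t)%E ->
  (\sum_(i <oo) (let t := CodeSeq.decode i in
      if uniq t && (size t == k) then
        \int[Q]_(w in window_is eta W t) h (points_tuple eta k t w) else 0) =
  (expR (- fine (M W)))%:E * \int[power_measure N k]_t h t)%E.
Proof.
move=> mh h0; rewrite -(integral_window_law etaP mW)//.
pose c : {nonneg R} := NngNum (expR_ge0 (- fine (M W))).
rewrite -[in RHS](ge0_integral_mscale _ _ c)//.
by apply: eq_measure_integral => A mA _; exact: window_law_power.
Qed.

End factorial_formula.

(** * The law of finitely many edges *)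

(** The probability that H holds of the random sublist of L in which the pairs q
    are kept independently with probabilities p q. *)
Fixpoint bern {R : pzRingType} (p : nat * nat -> R) (L : seq (nat * nat))
    (H : pred (seq (nat * nat))) : R :=
  if L is q :: L' then
    p q * bern p L' (fun G => H (q :: G)) + (1 - p q) * bern p L' H
  else (H [::])%:R.

Lemma bern_itv {R : realDomainType} (p : nat * nat -> R) L H :
  (forall q, 0 <= p q <= 1) -> 0 <= bern p L H <= 1.
Proof.
move=> p01; elim: L H => [|q L IH] H /=; first by case: (H _); rewrite ?lexx ?ler01.
have /andP[a0 a1] := p01 q.
have /andP[b0 b1] := IH (fun G => H (q :: G)); have /andP[c0 c1] := IH H.
have a1' : 0 <= 1 - p q by rewrite subr_ge0.
apply/andP; split; first by rewrite addr_ge0// mulr_ge0.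
rewrite -[leRHS](subrKC (p q)) lerD//.
- by rewrite ler_piMr.
- by rewrite ler_piMr.
Qed.

Lemma eq_bern {R : pzRingType} (p p' : nat * nat -> R) L H :
  {in L, p =1 p'} -> bern p L H = bern p' L H.
Proof.
elim: L H => //= q L IH H pp'; rewrite pp' ?mem_head// !IH//.
- by move=> x xL; rewrite pp'// inE xL orbT.
- by move=> x xL; rewrite pp'// inE xL orbT.
Qed.

Lemma measurable_bern {R : realType} d (T : measurableType d)
    (p : T -> nat * nat -> R) L H :
  (forall q, measurable_fun setT (p ^~ q)) ->
  measurable_fun setT (fun w => bern (p w) L H).
Proof.
move=> mp; elim: L H => [|q L IH] H /=; first exact: measurable_cst.
apply: measurable_funD; apply: measurable_funM => //.
by apply: measurable_funB => //; exact: measurable_cst.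
Qed.

Section graph_law.
Context {R : realType} {d : nat} {de : measure_display} {E : measurableType de}.
Context {dO : measure_display} {Om : measurableType dO}.
Notation X := (mspace R d E).
Variables (phi : X -> X -> R) (phiP : connection_function phi).
Variables (Q : probability Om R) (v : @points R d de E Om).
Variables (e : nat -> nat -> set Om) (eP : random_connection phi Q v e).
Hypothesis mpt : forall n, measurable_fun setT (pt v n).

Lemma measurable_connection d' (T : measurableType d') (f g : T -> X) :
  measurable_fun setT f -> measurable_fun setT g ->
  measurable_fun setT (fun w => phi (f w) (g w)).
Proof.
move=> mf mg.
exact: (measurableT_comp (connection_measurable phiP) (measurable_fun_pair mf mg)).
Qed.

Variable t : seq nat.
Hypothesis ut : uniq t.

Local Notation ev q := (e (nth 0%N t q.1) (nth 0%N t q.2)).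
Local Notation pr w q :=
  (phi (pt v (nth 0%N t q.1) w) (pt v (nth 0%N t q.2) w)).
Local Notation position_pair :=
  [pred q : nat * nat | (q.1 < q.2)%N && (q.2 < size t)%N].

(** Edges are indexed by positions in the list t of vertices, so that events on
    edges are the same boolean functions for all lists t. *)
Definition selected (L : seq (nat * nat)) w := [seq q <- L | `[< ev q w >]].

Variable A : set Om.
Hypotheses (mA : measurable A) (sA : sigma_points v A).
Hypothesis liveA : forall n, n \in t -> A `<=` live v n.

Let mev q : measurable (ev q). Proof. exact: (edge_measurable eP). Qed.

Lemma measurable_selected L (H : pred (seq (nat * nat))) :
  measurable [set w | H (selected L w)].
Proof.
elim: L H => [|q L IH] H.
  rewrite (_ : [set _ | _] = if H [::] then setT else set0); first by case: ifP.
  by case: ifPn => h; apply/seteqP; split => w //=; rewrite (negbTE h).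
rewrite (_ : [set _ | _] = (ev q `&` [set w | H (q :: selected L w)]) `|`
    (~` ev q `&` [set w | H (selected L w)])).
  by apply: measurableU; apply: measurableI => //; [exact: (IH (fun G => H (q :: G)))|exact: measurableC].
apply/seteqP; split => w /=; rewrite /selected/=; first by case: asboolP => h; [left|right].
by case: asboolP => h [[]|[]].
Qed.

Let evs (F : seq (nat * nat)) : set Om := \bigcap_(q in [set` F]) ev q.

Let mevs F : measurable (evs F).
Proof. by apply: fin_bigcap_measurable => //; exact: finite_seq. Qed.

Let evs_cons q F : evs (q :: F) = ev q `&` evs F.
Proof.
rewrite /evs; apply/seteqP; split => [w h|w [hq h] q' /=].
  by split => [|q' q'F]; apply: h; rewrite /= inE ?eqxx// [q' \in F]q'F orbT.
by rewrite inE => /orP[/eqP ->//|]; exact: h.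
Qed.

Let pr_ge0 w q : 0 <= pr w q.
Proof. by have /andP[] := connection_itv phiP (pt v (nth 0%N t q.1) w) (pt v (nth 0%N t q.2) w). Qed.

Let mpr q : measurable_fun setT (fun w => pr w q).
Proof. exact: measurable_connection. Qed.

Let mprod (F : seq (nat * nat)) : measurable_fun setT (fun w => \prod_(q <- F) pr w q).
Proof. exact: measurable_prod. Qed.

(** The law of the edges is given for pairs of increasing indices, whereas t is
    an arbitrary list: the pairs are reordered by the map f, which is injective
    on pairs of increasing positions. *)
Lemma edges_law (F : seq (nat * nat)) : uniq F -> all position_pair F ->
  Q (A `&` evs F) = (\int[Q]_(w in A) (\prod_(q <- F) pr w q)%:E)%E.
Proof.
move=> uF /allP oF.
pose f (q : nat * nat) := let a := nth 0%N t q.1 in let b := nth 0%N t q.2 in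
  if (a < b)%N then (a, b) else (b, a).
have f_lt q : q \in F -> ((f q).1 < (f q).2)%N.
  move=> /oF/andP[q12 q2]; rewrite /f; case: (ltngtP (nth 0%N t q.1) (nth 0%N t q.2)) => //= /eqP.
  by rewrite nth_uniq// ?(ltn_trans q12)// => /eqP eq; rewrite eq ltnn in q12.
have f_inj : {in F &, injective f}.
  move=> [a b] [a' b'] /oF/= /andP[ab bt] /oF/= /andP[ab' bt'].
  have at_ := ltn_trans ab bt; have at' := ltn_trans ab' bt'.
  rewrite /f/=; case: ifP => _; case: ifP => _ [] /eqP + /eqP; rewrite !nth_uniq//.
  - by move=> /eqP -> /eqP ->.
  - by move=> /eqP h1 /eqP h2; subst; have := ltn_trans ab ab'; rewrite ltnn.
  - by move=> /eqP h1 /eqP h2; subst; have := ltn_trans ab ab'; rewrite ltnn.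
  - by move=> /eqP -> /eqP ->.
have := edge_law eP (F := map f F) (A := A).
rewrite map_inj_in_uniq// => /(_ uF) h.
have {}h := h _ sA.
transitivity (Q (A `&` \bigcap_(p in [set` map f F]) e p.1 p.2)).
  congr (Q (A `&` _)); rewrite /evs; apply/seteqP; split => w h' p /=.
    move=> /mapP[q qF ->]; have := h' q qF; rewrite /f.
    by case: ifP => // _; rewrite (edge_sym eP).
  move=> pF; have := h' (f p) (map_f f pF); rewrite /f.
  by case: ifP => // _; rewrite (edge_sym eP).
rewrite h; last by move=> p /mapP[q qF ->]; exact: f_lt.
rewrite (_ : A `&` _ = A); last first.
  apply/setIidl => w Aw p /= /mapP[q /oF/andP[q12 q2] ->].
  have l1 : live v (nth 0%N t q.1) w.
    by apply: liveA Aw; rewrite mem_nth// (ltn_trans q12).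
  have l2 : live v (nth 0%N t q.2) w by apply: liveA Aw; rewrite mem_nth.
  by rewrite /f; case: ifP.
apply: eq_integral => w _; congr (_%:E); rewrite big_map; apply: eq_bigr => q _.
by rewrite /f; case: ifP => //= _; rewrite (connection_sym phiP).
Qed.

(** Only events that require edges to be present have a prescribed probability.
    The others follow by induction on the list L of undecided edges: on the event
    that the edge q is absent, the probability is the one without condition on q
    minus the one with q present. *)
Lemma graph_law (F L : seq (nat * nat)) (H : pred (seq (nat * nat))) :
  uniq (F ++ L) -> all position_pair (F ++ L) ->
  Q (A `&` evs F `&` [set w | H (selected L w)]) =
  (\int[Q]_(w in A) (\prod_(q <- F) pr w q * bern (fun q => pr w q) L H)%:E)%E.
Proof.
elim: L F H => [|q L IH] F H.
  rewrite cats0 => uF oF /=; case: (H [::]).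
    rewrite (_ : [set _ | _] = setT) ?setIT ?edges_law//.
      by apply: eq_integral => w _; rewrite mulr1.
    by apply/seteqP; split.
  rewrite (_ : [set _ | _] = set0) ?setI0 ?measure0; last by apply/seteqP; split.
  by rewrite integral0_eq// => w _; rewrite mulr0.
move=> uF oF.
have uqF : uniq ((q :: F) ++ L) by rewrite (perm_uniq (permEl (perm_catCA [:: q] F L))).
have oqF : all position_pair ((q :: F) ++ L).
  by move: oF; rewrite !all_cat/= => /and3P[-> -> ->].
have uF' : uniq (F ++ L) by move: uqF => /= /andP[].
have oF' : all position_pair (F ++ L) by move: oqF => /= /andP[].
pose B := A `&` evs F.
have mB : measurable B by exact: measurableI.
have mS H' := @measurable_selected L H'.
(* The events where q is absent are eliminated between split1 and split2. *)
have split1 : Q (B `&` [set w | H (selected (q :: L) w)]) =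
    (Q (A `&` evs (q :: F) `&` [set w | H (q :: selected L w)]) +
     Q (B `&` [set w | H (selected L w)] `\` ev q))%E.
  rewrite -measureU.
  - congr (Q _); rewrite evs_cons; apply/seteqP; split => w /=; rewrite /selected/=.
      by case: asboolP => h [Bw ?]; [left; case: Bw|right].
    by case: asboolP => h [[[? []]]|[[]]].
  - by rewrite evs_cons; apply: measurableI; [apply: measurableI => //; exact: measurableI|exact: (mS (fun G => H (q :: G)))].
  - by apply: measurableD => //; exact: measurableI.
  - by rewrite evs_cons -subset0 => w [[[_ [eq _]] _] [_ neq]]; exact: neq.
have split2 : Q (B `&` [set w | H (selected L w)]) =
    (Q (A `&` evs (q :: F) `&` [set w | H (selected L w)]) +
     Q (B `&` [set w | H (selected L w)] `\` ev q))%E.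
  rewrite -measureU.
  - congr (Q _); rewrite evs_cons; apply/seteqP; split => w /=.
      by move=> [[? ?] ?]; have [?|?] := pselect (ev q w); [left|right].
    by move=> [[[? []]]|[]].
  - by rewrite evs_cons; apply: measurableI => //; apply: measurableI => //; exact: measurableI.
  - by apply: measurableD => //; exact: measurableI.
  - by rewrite evs_cons -subset0 => w [[[_ [eq _]] _] [_ neq]]; exact: neq.
have I1 := IH (q :: F) (fun G => H (q :: G)) uqF oqF.
have I2 := IH F H uF' oF'.
have I3 := IH (q :: F) H uqF oqF.
set b1 := fun w => bern (fun q => pr w q) L (fun G => H (q :: G)) in I1.
set b2 := fun w => bern (fun q => pr w q) L H in I2 I3.
have pF0 F' w : 0 <= \prod_(q <- F') pr w q by apply: prodr_ge0.
have p01 w q' : 0 <= pr w q' <= 1 by exact: connection_itv.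
have b10 w : 0 <= b1 w by have /andP[] := bern_itv L (fun G => H (q :: G)) (p01 w).
have b20 w : 0 <= b2 w by have /andP[] := bern_itv L H (p01 w).
have mb1 : measurable_fun setT b1 by apply: measurable_bern => q'; exact: mpr.
have mb2 : measurable_fun setT b2 by apply: measurable_bern => q'; exact: mpr.
have mI F' b : measurable_fun setT b ->
    measurable_fun A (fun w => (\prod_(q <- F') pr w q * b w)%:E).
  by move=> mb; apply/measurable_EFinP; apply: measurable_funTS; exact: measurable_funM.
have fin3 : Q (A `&` evs (q :: F) `&` [set w | H (selected L w)]) \is a fin_num.
  by apply: fin_num_measure; apply: measurableI => //; exact: measurableI.
rewrite -[LHS](addeK _ fin3) -[RHS](addeK _ fin3); congr (_ - _)%E.
rewrite -/B split1 -addeA [X in (_ + X)%E]addeC -split2 I1 I2 I3.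
pose bq w := pr w q * b1 w + (1 - pr w q) * b2 w.
have mbq : measurable_fun setT bq.
  apply: measurable_funD; apply: measurable_funM => //.
  by apply: measurable_funB => //; exact: measurable_cst.
have bq0 w : 0 <= bq w.
  have /andP[a0 a1] := p01 w q.
  by rewrite addr_ge0// mulr_ge0// subr_ge0.
rewrite [X in _ = (X + _)%E](_ : _ =
    \int[Q]_(w in A) (\prod_(q <- F) pr w q * bq w)%:E)%E//.
have D0 F' b w : (forall w, 0 <= b w) -> (0 <= (\prod_(q <- F') pr w q * b w)%:E)%E.
  by move=> b0; rewrite lee_fin mulr_ge0.
rewrite -ge0_integralD//; [|by move=> w _; exact: (D0 _ b1)|exact: (mI _ b1)
  |by move=> w _; exact: (D0 _ b2)|exact: (mI _ b2)].
rewrite -ge0_integralD//; [|by move=> w _; exact: (D0 _ bq)|exact: (mI _ bq)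
  |by move=> w _; exact: (D0 _ b2)|exact: (mI _ b2)].
apply: eq_integral => w _; rewrite -!EFinD; congr (_%:E).
rewrite !big_cons /bq /= -/(b1 w) -/(b2 w).
move: (b1 w) (b2 w) (pr w q) (\prod_(q0 <- F) pr w q0) => x y z s; ring.
Qed.

End graph_law.

(** * Connections between finitely many vertices *)

Section connectivity.
Import Relation_Operators.

Lemma clos_rt_map (A B : Type) (r : A -> A -> Prop) (r' : B -> B -> Prop)
    (f : A -> B) :
  (forall a b, r a b -> r' (f a) (f b)) ->
  forall a b, clos_refl_trans A r a b -> clos_refl_trans B r' (f a) (f b).
Proof.
move=> rr' a b; elim=> [x y /rr'|x|x y z _ h1 _ h2]; first exact: rt_step.
  exact: rt_refl.
exact: rt_trans h1 h2.
Qed.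

Definition pairs n : seq (nat * nat) :=
  [seq p <- [seq (i, j) | i <- iota 0 n, j <- iota 0 n] | (p.1 < p.2)%N].

Lemma mem_pairs n p : (p \in pairs n) = (p.1 < p.2 < n)%N.
Proof.
rewrite mem_filter; case: p => i j /=; case: ltnP => //= ij.
apply/allpairsP/idP => [[[a b] /= []]|jn].
  by rewrite !mem_iota/= add0n => _ bn [_ ->].
by exists (i, j); rewrite /= !mem_iota !add0n/= jn (ltn_trans ij jn).
Qed.

Lemma pairs_uniq n : uniq (pairs n).
Proof.
apply: filter_uniq; apply: allpairs_uniq => //; try exact: iota_uniq.
by move=> [a b] [c e].
Qed.

(** The vertices to be connected are at the positions 0 and 1 of a list of
    vertices; an edge of G is a pair of increasing positions. *)
Definition linked (G : seq (nat * nat)) : bool :=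
  `[< clos_refl_trans nat (fun i j => (i, j) \in G \/ (j, i) \in G) 0%N 1%N >].

Definition joined_in (Om : Type) (e : nat -> nat -> set Om) (I : set nat)
    (w : Om) : nat -> nat -> Prop :=
  clos_refl_trans nat (fun i j => [/\ e i j w, I i & I j]).

(** A path in a finite set of vertices is a path in the positions of a list that
    enumerates it: connectivity becomes a boolean function of the edges. *)
Lemma joined_in_positions d (Om : measurableType d) (e : nat -> nat -> set Om) (t : seq nat) w :
  (forall i, e i i = set0) -> (forall i j, e i j = e j i) ->
  uniq t -> (1 < size t)%N ->
  joined_in e [set` t] w (nth 0%N t 0%N) (nth 0%N t 1%N) <->
  linked (selected e t (pairs (size t)) w).
Proof.
move=> eirr esym ut st; split => [h|/asboolP h].
  apply/asboolP.
  rewrite -[X in clos_refl_trans _ _ X _](index_uniq 0%N (ltnW st) ut).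
  rewrite -[X in clos_refl_trans _ _ _ X](index_uniq 0%N st ut).
  apply: (@clos_rt_map _ _ _ _ (fun i => index i t) _ _ _ h) => a b [eab at_ bt_].
  have ha := nth_index 0%N at_; have hb := nth_index 0%N bt_.
  have : a != b by apply/eqP => ab; move: eab; rewrite ab eirr.
  rewrite -[X in X != _]ha -[X in _ != X]hb.
  rewrite nth_uniq ?index_mem// neq_ltn => /orP[ab|ab]; [left|right];
    rewrite mem_filter mem_pairs/= ab index_mem ?at_ ?bt_ !andbT/=;
    apply/asboolP; by rewrite ha hb// esym.
apply: (@clos_rt_map _ _ _ _ (fun i => nth 0%N t i) _ _ _ h) => a b.
case; rewrite mem_filter mem_pairs/= => /and3P[/asboolP ?] ab bt.
  by split => //=; apply: mem_nth => //; exact: ltn_trans bt.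
by split => /=; [rewrite esym|apply: mem_nth|apply: mem_nth => //; exact: ltn_trans bt].
Qed.

End connectivity.

(** The probability that the first two of the n points u are connected in the
    random graph on these points. *)
Definition conn_prob {R : pzRingType} (X : Type) (phi : X -> X -> R) (n : nat)
    (u : nat -> X) : R :=
  bern (fun q => phi (u q.1) (u q.2)) (pairs n) linked.

Lemma eq_conn_prob {R : pzRingType} (X : Type) (phi : X -> X -> R) n u u' :
  (forall i, (i < n)%N -> u i = u' i) -> conn_prob phi n u = conn_prob phi n u'.
Proof.
move=> uu'; apply: eq_bern => q; rewrite mem_pairs => /andP[q12 q2].
by rewrite !uu'// (ltn_trans q12).
Qed.

Section connection_law.
Context {R : realType} {d : nat} {de : measure_display} {E : measurableType de}.
Context {dO : measure_display} {Om : measurableType dO}.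
Notation X := (mspace R d E).
Variables (phi : X -> X -> R) (phiP : connection_function phi).
Variables (Q : probability Om R) (v : @points R d de E Om).
Variables (e : nat -> nat -> set Om) (eP : random_connection phi Q v e).
Hypothesis mpt : forall n, measurable_fun setT (pt v n).
Variable A : set Om.
Hypotheses (mA : measurable A) (sA : sigma_points v A).

Lemma conn_prob_itv n u : 0 <= conn_prob phi n u <= 1.
Proof. by apply: bern_itv => q; exact: connection_itv. Qed.

Lemma connection_law (t : seq nat) : uniq t -> (1 < size t)%N ->
  (forall n, n \in t -> A `<=` live v n) ->
  Q (A `&` [set w | joined_in e [set` t] w (nth 0%N t 0%N) (nth 0%N t 1%N)]) =
  (\int[Q]_(w in A)
     (conn_prob phi (size t) (fun i => pt v (nth 0%N t i) w))%:E)%E.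
Proof.
move=> ut st lA.
have := @graph_law _ _ _ _ _ _ _ phiP Q v e eP mpt t ut A mA sA lA [::]
  (pairs (size t)) linked (pairs_uniq _).
rewrite (_ : all _ _); last by apply/allP => q; rewrite mem_pairs.
move=> /(_ isT) h.
transitivity (Q (A `&` \bigcap_(q in [set` [::]])
     e (nth 0%N t q.1) (nth 0%N t q.2) `&`
     [set w | linked (selected e t (pairs (size t)) w)])).
  congr (Q _); apply/seteqP; split => w /=.
    move=> [Aw /joined_in_positions jw]; split; first by split => // q.
    by apply: jw => //; [exact: (edge_irr eP)|exact: (edge_sym eP)].
  move=> [[Aw _] lw]; split => //; apply/joined_in_positions => //.
  - exact: (edge_irr eP).
  - exact: (edge_sym eP).
rewrite h; apply: eq_integral => w _.
by rewrite big_nil mul1r.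
Qed.

(** The edge from z to the head of t is not among the pairs of vertices of t, so
    it is independent of the connections within t given the points. *)
Lemma edge_connection_law (t : seq nat) z : uniq (z :: t) -> (1 < size t)%N ->
  (forall n, n \in z :: t -> A `<=` live v n) ->
  Q (A `&` e z (nth 0%N t 0%N) `&`
     [set w | joined_in e [set` t] w (nth 0%N t 0%N) (nth 0%N t 1%N)]) =
  (\int[Q]_(w in A) (phi (pt v z w) (pt v (nth 0%N t 0%N) w) *
     conn_prob phi (size t) (fun i => pt v (nth 0%N t i) w))%:E)%E.
Proof.
move=> uzt st lA; have /andP[zt ut] := uzt.
pose t' := rcons t z.
have ut' : uniq t' by rewrite rcons_uniq zt.
have lA' n : n \in t' -> A `<=` live v n by rewrite mem_rcons; exact: lA.
have t'E i : (i < size t)%N -> nth 0%N t' i = nth 0%N t i by move=> it; rewrite nth_rcons it.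
have t'k : nth 0%N t' (size t) = z by rewrite nth_rcons ltnn eqxx.
have st0 : (0 < size t)%N by exact: ltnW.
have selE w : selected e t' (pairs (size t)) w = selected e t (pairs (size t)) w.
  apply: eq_in_filter => q; rewrite mem_pairs => /andP[q12 q2].
  by rewrite !t'E// (ltn_trans q12).
have := @graph_law _ _ _ _ _ _ _ phiP Q v e eP mpt t' ut' A mA sA lA'
  [:: (0%N, size t)] (pairs (size t)) linked.
rewrite /= mem_pairs/= ltnn andbF/= pairs_uniq => /(_ isT).
rewrite size_rcons ltnSn st0/=.
rewrite (_ : all _ _); last first.
  by apply/allP => q; rewrite mem_pairs/= => /andP[-> /= q2]; rewrite ltnS ltnW.
move=> /(_ isT) h.
transitivity (Q (A `&` \bigcap_(q in [set` [:: (0%N, size t)]])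
     e (nth 0%N t' q.1) (nth 0%N t' q.2) `&`
     [set w | linked (selected e t' (pairs (size t)) w)])).
  congr (Q _); apply/seteqP; split => w /=; rewrite selE.
    move=> [[Aw ew] /joined_in_positions jw]; split; last first.
      by apply: jw => //; [exact: (edge_irr eP)|exact: (edge_sym eP)].
    by split => // q /=; rewrite inE => /eqP -> /=; rewrite t'E// t'k (edge_sym eP).
  move=> [[Aw ew] lw]; split; last first.
    by apply/joined_in_positions => //; [exact: (edge_irr eP)|exact: (edge_sym eP)].
  split => //; have := ew (0%N, size t); rewrite /= t'E// t'k (edge_sym eP).
  by apply; rewrite mem_head.
rewrite h; apply: eq_integral => w _; congr (_%:E).
rewrite big_seq1/= t'E// t'k (connection_sym phiP); congr (_ * _).
apply: eq_bern => q; rewrite mem_pairs => /andP[q12 q2].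
by rewrite !t'E// (ltn_trans q12).
Qed.

Lemma single_edge_law y z : y != z -> A `<=` live v y -> A `<=` live v z ->
  Q (A `&` e z y) = (\int[Q]_(w in A) (phi (pt v z w) (pt v y w))%:E)%E.
Proof.
move=> yz ly lz.
have uzy : uniq [:: z; y] by rewrite cons_uniq mem_seq1 eq_sym yz.
have lzy n : n \in [:: z; y] -> A `<=` live v n.
  by rewrite !inE => /orP[/eqP ->|/eqP ->].
have := edges_law phiP eP uzy sA lzy (F := [:: (0%N, 1%N)]).
move=> /(_ isT isT) /=.
rewrite (_ : A `&` _ = A `&` e z y) => [->|].
  by apply: eq_integral => w _; rewrite big_seq1.
congr (_ `&` _); apply/seteqP; split => [w /(_ (0%N, 1%N)) /=|w ew q /=].
  by apply; rewrite mem_head.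
by rewrite inE => /eqP ->.
Qed.

End connection_law.

(** * The Palm formula in a window *)

Section palm.
Context {R : realType} {d : nat} {de : measure_display} {E : measurableType de}.
Context {dO : measure_display} {Om : measurableType dO}.
Notation X := (mspace R d E).
Variables (Q : probability Om R) (eta : @points R d de E Om)
  (M : {measure set X -> \bar R}).
Hypothesis etaP : poisson_process Q eta M.
Variables (W : set X) (mW : measurable W) (Woo : (M W < +oo)%E).

Let N : {finite_measure set X -> \bar R} := mfrestr mW Woo.
Let m : R := fine (M W).

Lemma sum_poisson_mass (r : R) : 0 <= r ->
  (\sum_(k <oo) poisson_mass r%:E k = 1)%E.
Proof.
move=> r0; rewrite /poisson_mass.
apply: cvg_lim => //.
rewrite (_ : (fun n => _) = EFin \o (fun n => series (exp_coeff r) n * expR (- r))).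
  apply/cvg_EFin => /=; first by near=> n.
  rewrite -(expRxMexpNx_1 r).
  apply: cvgMl; exact: is_cvg_series_exp_coeff.
apply/funext => n /=; rewrite /series/= mulr_suml -sumEFin.
by apply: eq_bigr => i _.
Unshelve. all: by end_near. Qed.

Lemma npointsP w k : npoints eta W w = k%:R%:E :> \bar R <->
  exists s : seq nat, [/\ uniq s, size s = k & window eta W w = [set` s]].
Proof.
rewrite /npoints -/(window eta W w); split => [|[s [us <- ->]]]; last first.
  exact: counting_uniq.
have [/finite_seqP[s sE]|iw] := pselect (finite_set (window eta W w)); last first.
  by rewrite /counting asboolF.
rewrite sE (_ : [set` s] = [set` undup s]); last first.
  by apply/seteqP; split => n /=; rewrite mem_undup.
rewrite counting_uniq ?undup_uniq// => -[/eqP]; rewrite eqr_nat => /eqP sk.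
by exists (undup s); split => //; exact: undup_uniq.
Qed.

(** The Poisson masses with a finite parameter sum to 1. *)
Lemma window_finite_ae : {ae Q, forall w, finite_set (window eta W w)}.
Proof.
pose B k := [set w | npoints eta W w = k%:R%:E :> \bar R].
have mB k : measurable (B k).
  rewrite /B -[X in measurable X]setTI.
  exact: (measurable_npoints etaP mW measurableT (emeasurable_set1 _)).
have tB : trivIset setT B.
  move=> i j _ _ [w []]; rewrite /B/= => -> [/eqP].
  by rewrite eqr_nat => /eqP.
exists (~` \bigcup_k B k); split.
- exact/measurableC/bigcupT_measurable.
- rewrite probability_setC; last exact: bigcupT_measurable.
  rewrite measure_semi_bigcup//; last exact: bigcupT_measurable.
  rewrite (eq_eseriesr (g := poisson_mass m%:E)); last first.
    move=> k _; transitivity (poisson_mass (M W) k).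
      exact: (npoints_poisson etaP k mW).
    by congr poisson_mass; rewrite fineK// ge0_fin_numE.
  rewrite sum_poisson_mass ?subee//.
  by rewrite fine_ge0.
- move=> w /= nf [k _ /npointsP[s [_ _ ws]]]; apply: nf.
  by rewrite ws; exact: finite_seq.
Qed.

(** Z w is the number of j-tuples of distinct points of the window that satisfy
    an event D, which may depend on all the other points.  The tuples are the
    first j entries of the orderings of the points, so that Z times the number
    of orderings of the remaining points counts orderings ([DZ]); [h k] is the
    conditional probability of D given the points in order, the last k of which
    are not distinguished ([Dh]). *)
Variables (j : nat) (D : seq nat -> set Om) (Z : Om -> \bar R).
Variable h : forall k, (j + k).-tuple X -> R.
Hypotheses (mD : forall t, measurable (D t))
  (mh : forall k, measurable_fun setT (@h k)) (h0 : forall k u, 0 <= @h k u).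
Hypotheses (mZ : measurable_fun setT Z) (Z0 : forall w, (0 <= Z w)%E).
Hypothesis Dh : forall k t, uniq t -> size t = (j + k)%N ->
  Q (window_is eta W t `&` D t) =
  (\int[Q]_(w in window_is eta W t) (@h k (points_tuple eta (j + k) t w))%:E)%E.
Hypothesis DZ : forall w s, uniq s -> window eta W w = [set` s] ->
  (if (j <= size s)%N
   then Z w * ((size s - j)`!)%:R%:E =
     (count (fun t => w \in D t) (permutations s))%:R%:E
   else Z w = 0)%E.

Let B k (t : seq nat) : set Om :=
  [set w | [/\ uniq t, size t = (j + k)%N, window_is eta W t w & D t w]].

Let mB k t : measurable (B k t).
Proof.
rewrite (_ : B k t = (if uniq t && (size t == j + k)%N then
    window_is eta W t `&` D t else set0)).
  case: ifPn => // _; apply: measurableI => //.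
  exact: (measurable_window_is etaP mW).
apply/seteqP; split => [w [ut /eqP st wt Sw]|w]; first by rewrite ut st.
by case: ifPn => // /andP[ut /eqP st] [].
Qed.

Let S k w : \bar R := (\sum_(i <oo) (\1_(B k (CodeSeq.decode i)) w)%:E)%E.

Let integral_S k : (\int[Q]_w S k w =
  (expR (- m))%:E * \int[power_measure N (j + k)]_u (@h k u)%:E)%E.
Proof.
rewrite /S -nneseries_probability//.
have mh' : measurable_fun setT (fun u => (@h k u)%:E).
  by apply/measurable_EFinP; exact: mh.
have h0' u : (0 <= (@h k u)%:E)%E by rewrite lee_fin.
rewrite -(factorial_formula etaP mW Woo mh' h0').
apply: eq_eseriesr => i _ /=; case: ifPn => [/andP[ut /eqP st]|nut].
  rewrite -Dh//; congr (Q _); apply/seteqP; split => w; first by case.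
  by case.
rewrite (_ : B _ _ = set0) ?measure0//; apply/seteqP; split => // w [ut st _ _].
by rewrite ut st eqxx in nut.
Qed.

Let SZ w : finite_set (window eta W w) ->
  Z w = (\sum_(k <oo) ((k`!%:R)^-1)%:E * S k w)%E.
Proof.
move=> fw; have [s us sE] : exists2 s : seq nat, uniq s & window eta W w = [set` s].
  have /finite_seqP[r rE] := fw; exists (undup r); first exact: undup_uniq.
  by rewrite rE; apply/seteqP; split => n /=; rewrite mem_undup.
have SE k : S k w = (if size s == (j + k)%N then
    (count (fun t => w \in D t) (permutations s))%:R%:E else 0)%E.
  rewrite /S; under eq_eseriesr do rewrite indicE.
  rewrite (nneseries_permutations (b := fun t => w \in B k t) (s := s)); last first.
    move=> t /set_mem[ut _ wt _]; apply: uniq_perm => // n.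
    have : [set` t] n <-> [set` s] n by rewrite -wt sE.
    by move=> /= hn; apply/idP/idP => /hn.
  case: ifPn => sz.
    congr (_%:R%:E); apply: eq_in_count => t; rewrite mem_permutations => ts.
    apply/idP/idP => [/set_mem[_ _ _ ?]|/set_mem Dt]; apply/mem_set => //.
    split => //; [by rewrite (perm_uniq ts)|by rewrite (perm_size ts) (eqP sz)|].
    by rewrite /window_is/= sE; apply/seteqP; split => n /=; rewrite (perm_mem ts).
  rewrite (@eq_in_count _ _ pred0) ?count_pred0// => t; rewrite mem_permutations => ts.
  by apply/negP => /set_mem[_ st _ _]; rewrite -(perm_size ts) st eqxx in sz.
have := DZ us sE; case: ifPn => js Zw.
  rewrite (@nneseries_finite_support _ _ [:: (size s - j)%N])//.
  - rewrite big_seq1 SE subnKC// eqxx -Zw muleCA -EFinM mulVf ?mule1//.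
  - by move=> k; rewrite mule_ge0 ?lee_fin ?invr_ge0// SE; case: ifP => //; rewrite lee_fin.
  - move=> k; rewrite inE => kn; rewrite SE ifN ?mule0//.
    by apply: contra kn => /eqP ->; rewrite addKn.
rewrite Zw eseries0// => k _ _; rewrite SE ifN ?mule0//.
by apply: contra js => /eqP ->; rewrite leq_addr.
Qed.

Lemma palm_formula : (\int[Q]_w Z w =
  \sum_(k <oo) (expR (- m) / k`!%:R)%:E *
    \int[power_measure N (j + k)]_u (@h k u)%:E)%E.
Proof.
have mS k : measurable_fun setT (S k).
  apply: ge0_emeasurable_sum => [n w _ _|n _]; first by rewrite lee_fin.
  by apply/measurable_EFinP; apply: measurable_indic.
have S0 k w : (0 <= S k w)%E by apply: nneseries_ge0 => n _ _; rewrite lee_fin.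
have mkS k : measurable_fun setT (fun w => ((k`!%:R)^-1)%:E * S k w)%E.
  by apply: emeasurable_funM => //; exact: measurable_cst.
have kS0 k w : (0 <= ((k`!%:R)^-1)%:E * S k w)%E.
  by rewrite mule_ge0// lee_fin invr_ge0.
rewrite (ge0_ae_eq_integral (g := fun w => \sum_(k <oo) ((k`!%:R)^-1)%:E * S k w)%E)//.
- rewrite integral_nneseries//; apply: eq_eseriesr => k _.
  rewrite ge0_integralZl// ?integral_S ?lee_fin ?invr_ge0//.
  by rewrite muleA -EFinM mulrC.
- by apply: ge0_emeasurable_sum => [n w _ _|n _].
- by move=> w _; apply: nneseries_ge0 => n _ _.
- by apply: filterS window_finite_ae => w fw _; exact: SZ.
Qed.

End palm.

(** * The two-point function of a window *)

Section clos_measurable.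
Context {d : measure_display} {Om : measurableType d}.
Variable r : Om -> nat -> nat -> Prop.
Hypothesis mr : forall i j, measurable [set w | r w i j].
Import Relation_Operators.

Fixpoint reach (n i j : nat) : set Om :=
  if n is n'.+1 then \bigcup_k ([set w | r w i k] `&` reach n' k j)
  else [set w | i = j].

(** There are countably many paths. *)
Lemma measurable_clos_rt i j :
  measurable [set w | clos_refl_trans nat (r w) i j].
Proof.
have mreach n : forall i, measurable (reach n i j).
  elim: n => [|n IH] l /=.
    have [->|lj] := eqVneq l j.
      by rewrite (_ : [set _ | _] = setT)//; apply/seteqP; split.
    rewrite (_ : [set _ | _] = set0)//; apply/seteqP; split => // w /= /eqP.
    by rewrite (negbTE lj).
  by apply: bigcupT_measurable => l'; exact: measurableI.
rewrite (_ : [set _ | _] = \bigcup_n reach n i j).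
  exact: bigcupT_measurable.
apply/seteqP; split => w /=.
  move=> /Operators_Properties.clos_rt_rt1n_iff; elim=> [l|a b c rab _ [n _ h]].
    by exists 0%N.
  by exists n.+1 => //; exists b.
move=> [n _]; elim: n i => [i /= ->|n IH i [l _ [rl /IH h]]]; first exact: rt_refl.
by apply: rt_trans h; exact: rt_step.
Qed.

End clos_measurable.

Section connection_functions.
Context {R : realType} {d : nat} {de : measure_display} {E : measurableType de}.
Notation X := (mspace R d E).
Variables (phi : X -> X -> R) (phiP : connection_function phi).

Definition list_conn (l : seq X) : R := conn_prob phi (size l) (nth point l).

Lemma list_conn_itv l : 0 <= list_conn l <= 1.
Proof. exact: conn_prob_itv. Qed.

Lemma measurable_list_conn dT (T : measurableType dT) (f : T -> seq X) n :
  (forall t, size (f t) = n) ->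
  (forall i, measurable_fun setT (fun t => nth point (f t) i)) ->
  measurable_fun setT (fun t => list_conn (f t)).
Proof.
move=> fn mf; rewrite /list_conn; under eq_fun do rewrite fn.
rewrite /conn_prob; apply: measurable_bern => q.
exact: measurable_connection.
Qed.

Lemma measurable_nth_tuple k i :
  measurable_fun setT (fun u : k.-tuple X => nth point u i).
Proof.
have [ik|ki] := ltnP i k.
  rewrite (_ : (fun u => _) = (fun u => tnth u (Ordinal ik))).
    exact: measurable_tnth.
  by apply/funext => u; rewrite (tnth_nth point).
rewrite (_ : (fun u => _) = cst point); first exact: measurable_cst.
by apply/funext => u; rewrite nth_default// size_tuple.
Qed.

Local Open Scope ereal_scope.

(** The probability that x and y are connected through points of a Poisson process
    with finite intensity measure N, expanded according to the number k of these
    points. *)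
Definition tau_window (N : {finite_measure set X -> \bar R}) (x y : X) : \bar R :=
  \sum_(k <oo) (expR (- fine (N setT)) / k`!%:R)%:E *
    \int[power_measure N k]_u (list_conn [:: x, y & u])%:E.

Variable N : {finite_measure set X -> \bar R}.

Lemma measurable_list_conn2 k : measurable_fun setT
  (fun p : (X * X) * k.-tuple X => (list_conn [:: p.1.1, p.1.2 & p.2])%:E).
Proof.
apply/measurable_EFinP; apply: (measurable_list_conn (n := k.+2)).
  by move=> p; rewrite /= size_tuple.
case=> [|[|i]] /=.
- exact: measurableT_comp measurable_fst measurable_fst.
- exact: measurableT_comp measurable_snd measurable_fst.
- exact: measurableT_comp (@measurable_nth_tuple k i) measurable_snd.
Qed.

Lemma list_conn_ge0 l : 0 <= (list_conn l)%:E.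
Proof. by have /andP[] := list_conn_itv l; rewrite lee_fin. Qed.

Lemma measurable_tau_window :
  measurable_fun setT (fun p : X * X => tau_window N p.1 p.2).
Proof.
apply: ge0_emeasurable_sum => [k p _ _|k _].
  rewrite mule_ge0 ?lee_fin ?divr_ge0 ?expR_ge0//.
  by apply: integral_ge0 => u _; exact: list_conn_ge0.
apply: emeasurable_funM; first exact: measurable_cst.
apply: (measurable_integral_power N (h := fun p : (X * X) * k.-tuple X =>
  (list_conn [:: p.1.1, p.1.2 & p.2])%:E)).
- exact: measurable_list_conn2.
- by move=> p; exact: list_conn_ge0.
Qed.

Lemma tau_window_ge0 x y : 0 <= tau_window N x y.
Proof.
apply: nneseries_ge0 => k _ _.
rewrite mule_ge0 ?lee_fin ?divr_ge0 ?expR_ge0//.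
by apply: integral_ge0 => u _; exact: list_conn_ge0.
Qed.

(** The left-hand side is what the Palm formula gives for the number of vertices
    connected to x: the target is one of the points of the process. *)
Lemma integral_tau_window x :
  \sum_(k <oo) (expR (- fine (N setT)) / k`!%:R)%:E *
    \int[power_measure N k.+1]_u (list_conn (x :: u))%:E =
  \int[N]_y tau_window N x y.
Proof.
have mc k : measurable_fun setT (fun p : X * k.-tuple X =>
    (list_conn [:: x, p.1 & p.2])%:E).
  have mp : measurable_fun setT (fun p : X * k.-tuple X => ((x, p.1), p.2)).
    by apply: measurable_fun_pair => //; apply: measurable_fun_pair => //; exact: measurable_cst.
  exact: measurableT_comp (@measurable_list_conn2 k) mp.
have mi k : measurable_fun setT (fun y : X =>
    \int[power_measure N k]_u (list_conn [:: x, y & u])%:E).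
  exact: (measurable_integral_power N (mc k) (fun p => list_conn_ge0 _)).
have i0 k y : 0 <= \int[power_measure N k]_u (list_conn [:: x, y & u])%:E.
  by apply: integral_ge0 => u _; exact: list_conn_ge0.
have c0 k : 0 <= (expR (- fine (N setT)) / k`!%:R)%:E.
  by rewrite lee_fin divr_ge0 ?expR_ge0.
rewrite /tau_window integral_nneseries//; last 2 first.
- by move=> k; apply: emeasurable_funM => //; exact: measurable_cst.
- by move=> k y _; rewrite mule_ge0.
apply: eq_eseriesr => k _; rewrite ge0_integralZl//.
congr (_ * _); rewrite integral_powerS//.
- apply/measurable_EFinP; apply: (measurable_list_conn (n := k.+2)).
    by move=> u; rewrite /= size_tuple.
  by case=> [|i] /=; [exact: measurable_cst|exact: measurable_nth_tuple].
- by move=> u; exact: list_conn_ge0.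
Qed.

End connection_functions.

(** * Connections within a window *)

Section window_formulas.
Context {R : realType} {d : nat} {de : measure_display} {E : measurableType de}.
Context {dO : measure_display} {Om : measurableType dO}.
Notation X := (mspace R d E).
Variables (phi : X -> X -> R) (phiP : connection_function phi).
Variables (Q : probability Om R) (eta : @points R d de E Om)
  (M : {measure set X -> \bar R}).
Hypothesis etaP : poisson_process Q eta M.
Variables (W : set X) (mW : measurable W) (Woo : (M W < +oo)%E).
Let N : {finite_measure set X -> \bar R} := mfrestr mW Woo.

Lemma fine_windowT : fine (N setT) = fine (M W).
Proof. by rewrite /N/= /mfrestr /mrestr setTI. Qed.

Section base.
Variables (xs : seq X) (e : nat -> nat -> set Om).
Let o := size xs.
Let v := add_points xs eta.
Hypothesis eP : random_connection phi Q v e.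

(** In the graph with o added points, the points of the process have their
    indices shifted by o. *)
Definition shifted_window (o : nat) (w : Om) : set nat := [set (o + l)%N | l in window eta W w].

Definition vertices (o : nat) (w : Om) : set nat :=
  [set n | (n < o)%N] `|` shifted_window o w.

Lemma measurable_pt_add n : measurable_fun setT (pt v n).
Proof.
rewrite /v/=; case: ifP => _; first exact: measurable_cst.
exact: (pt_measurable etaP).
Qed.

Lemma pt_addr n w : pt v (o + n) w = pt eta n w.
Proof. by rewrite /= ltnNge leq_addr/= addKn. Qed.

Lemma live_addr n w : live v (o + n) w = live eta n w.
Proof. by rewrite /= ltnNge leq_addr/= addKn. Qed.

Lemma sigma_points_window_is t : sigma_points v (window_is eta W t).
Proof.
rewrite window_isE.
pose G := [set A | exists n, A = live v n \/
   exists2 B, measurable B & A = live v n `&` pt v n @^-1` B].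
have sL n : @measurable _ (g_sigma_algebraType G) [set w | window eta W w n].
  apply: sub_sigma_algebra; exists (o + n)%N; right; exists W => //.
  apply/seteqP; split => w /=.
    by move=> [ln Wn]; rewrite ltnNge leq_addr/= addKn.
  by rewrite ltnNge leq_addr/= addKn.
suff : @measurable _ (g_sigma_algebraType G) (\bigcap_n (if n \in t then
  [set w | window eta W w n] else ~` [set w | window eta W w n])) by [].
apply: bigcapT_measurable => n; case: ifP => _; first exact: sL.
exact: measurableC.
Qed.

Lemma window_is_live t n : n \in map (addn o) t ->
  window_is eta W t `<=` live v n.
Proof.
move=> /mapP[l lt ->] w wt; rewrite live_addr.
have : [set` t] l by [].
by rewrite -wt => -[].
Qed.

Lemma shifted_window_is t w : window_is eta W t w ->
  shifted_window o w = [set` map (addn o) t].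
Proof.
move=> wt; rewrite /shifted_window wt; apply/seteqP; split => n /=.
  by move=> [l lt <-]; exact: map_f.
by move=> /mapP[l lt ->]; exists l.
Qed.

Lemma measurable_joined_vertices (I : Om -> set nat) i j :
  (forall n, measurable [set w | I w n]) ->
  measurable [set w | joined_in e (I w) w i j].
Proof.
move=> mI; apply: (measurable_clos_rt (r := fun w i j => [/\ e i j w, I w i & I w j])).
move=> a b; rewrite (_ : [set _ | _] = e a b `&` ([set w | I w a] `&` [set w | I w b])).
  by apply: measurableI; [exact: (edge_measurable eP)|exact: measurableI].
by apply/seteqP; split => w; [case|case=> ? []].
Qed.

Lemma measurable_shifted_window n : measurable [set w | shifted_window o w n].
Proof.
rewrite (_ : [set _ | _] = if (o <= n)%N then [set w | window eta W w (n - o)%N] else set0).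
  by case: ifP => // _; exact: (measurable_window etaP mW).
apply/seteqP; split => w /=.
  by move=> [l wl <-]; rewrite leq_addr addKn.
by case: ifPn => // on wn; exists (n - o)%N => //; rewrite subnKC.
Qed.

Lemma measurable_vertices n : measurable [set w | vertices o w n].
Proof.
rewrite (_ : [set _ | _] = [set w | (n < o)%N] `|` [set w | shifted_window o w n])//.
apply: measurableU; last exact: measurable_shifted_window.
have [no|no] := boolP (n < o)%N.
  by rewrite (_ : [set _ | _] = setT)//; apply/seteqP; split.
by rewrite (_ : [set _ | _] = set0)//; apply/seteqP; split.
Qed.

(** The list b orders the added points: the first two entries of s are the
    vertices to be connected, and any two vertices can be put there. *)
Lemma joined_vertices_law (b : seq nat) (t : seq nat) (s := b ++ map (addn o) t) :
  perm_eq b (iota 0 o) -> uniq t -> (1 < size s)%N ->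
  Q (window_is eta W t `&`
     [set w | joined_in e (vertices o w) w (nth 0%N s 0%N) (nth 0%N s 1%N)]) =
  (\int[Q]_(w in window_is eta W t)
     (list_conn phi (map (nth point xs) b ++ points_tuple eta (size t) t w))%:E)%E.
Proof.
move=> pb ut ss.
have us : uniq s.
  rewrite cat_uniq (perm_uniq pb) iota_uniq map_inj_uniq ?ut ?andbT/=; last exact: addnI.
  apply/hasPn => _ /mapP[l lt ->]; rewrite (perm_mem pb) mem_iota/= add0n.
  by rewrite ltnNge leq_addr.
have ls n : n \in s -> window_is eta W t `<=` live v n.
  rewrite mem_cat (perm_mem pb) mem_iota/= add0n => /orP[no|]; last exact: window_is_live.
  by rewrite /v /= no.
transitivity (Q (window_is eta W t `&`
     [set w | joined_in e [set` s] w (nth 0%N s 0%N) (nth 0%N s 1%N)])).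
  congr (Q _); rewrite ![window_is eta W t `&` _]setIC.
  have vs w : window_is eta W t w -> vertices o w = [set` s].
    move=> wt; rewrite /vertices (shifted_window_is wt); apply/seteqP; split => n /=.
      by rewrite mem_cat (perm_mem pb) mem_iota/= add0n => -[->//|->]; rewrite orbT.
    by rewrite mem_cat (perm_mem pb) mem_iota/= add0n => /orP[->|->]; [left|right].
  by apply/seteqP; split => w [/= + wt]; rewrite (vs w wt).
rewrite (connection_law phiP eP measurable_pt_add _ (sigma_points_window_is t) us ss ls);
  last exact: (measurable_window_is etaP mW).
apply: eq_integral => w _; congr (_%:E); rewrite /list_conn size_cat size_map.
rewrite size_cat size_map size_tuple; apply: eq_conn_prob => i.
rewrite !nth_cat size_map; case: ifP => ib ist.
  rewrite (nth_map 0%N)//= ifT//.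
  by have := mem_nth 0%N ib; rewrite (perm_mem pb) mem_iota.
have it : (i - size b < size t)%N by rewrite ltn_subLR// leqNgt ib.
rewrite (nth_map 0%N)// pt_addr -[(i - size b)%N]/(nat_of_ord (Ordinal it)).
by rewrite -tnth_nth tnth_mktuple.
Qed.

End base.

Local Open Scope ereal_scope.

Lemma indic_mem (A : set Om) w : (\1_A w)%:E = (w \in A)%:R%:E :> \bar R.
Proof. by rewrite indicE. Qed.

(** The boolean b selects the direction of the connection.  The two cases give
    the symmetry of the two-point function without any symmetry of the series. *)
Lemma tau_window_law (x y : X) (e : nat -> nat -> set Om) (b : bool) :
  random_connection phi Q (add_points [:: x; y] eta) e ->
  Q [set w | joined_in e (vertices 2 w) w b (~~ b)] =
  tau_window phi N (if b then y else x) (if b then x else y).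
Proof.
move=> eP.
set D := [set w | _].
have mD : measurable D.
  apply: (measurable_joined_vertices eP) => n.
  exact: (measurable_vertices [:: x; y]).
pose x0 := if b then y else x; pose x1 := if b then x else y.
transitivity (\int[Q]_w (\1_D w)%:E); first by rewrite integral_indic// setIT.
rewrite (palm_formula etaP mW Woo (j := 0%N) (D := fun=> D)
  (h := fun k (u : (0 + k).-tuple X) => list_conn phi [:: x0, x1 & u]))//.
- by rewrite /tau_window fine_windowT.
- move=> k; apply: (measurable_list_conn phiP (n := k.+2)).
    by move=> u; rewrite /= size_tuple.
  case=> [|[|i]] /=; [exact: measurable_cst|exact: measurable_cst|].
  exact: measurable_nth_tuple.
- by move=> k u; have /andP[] := list_conn_itv phiP [:: x0, x1 & u].
- by apply/measurable_EFinP; exact: measurable_indic.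
- move=> k t ut st; have := joined_vertices_law eP (b := [:: nat_of_bool b; nat_of_bool (~~ b)]) (t := t).
  rewrite /= => -> //; last by case: (b).
  apply: eq_integral => w _; rewrite /x0 /x1; move: st; rewrite add0n => <-.
  by case: (b).
- move=> w s us ws; rewrite leq0n subn0 indic_mem.
  case: (w \in D); last by rewrite mul0e count_pred0.
  by rewrite mul1e count_predT size_permutations.
Qed.

Lemma counting_sub_uniq (P : nat -> Prop) (s : seq nat) : uniq s ->
  counting [set n | n \in s /\ P n] = (count (fun n => `[< P n >]) s)%:R%:E :> \bar R.
Proof.
move=> us; rewrite (_ : [set _ | _] = [set` [seq n <- s | `[< P n >]]]).
  by rewrite counting_uniq ?filter_uniq// size_filter.
apply/seteqP; split => n /=; rewrite mem_filter.
  by move=> [-> /asboolT ->].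
by move=> /andP[/asboolP].
Qed.

Lemma measurable_counting (P : nat -> set Om) : (forall n, measurable (P n)) ->
  measurable_fun setT (fun w => counting [set n | P n w] : \bar R).
Proof.
move=> mP; rewrite (_ : (fun w => _) = fun w => \sum_(n <oo) (\1_(P n) w)%:E).
  apply: ge0_emeasurable_sum => [n w _ _|n _]; first by rewrite lee_fin.
  by apply/measurable_EFinP; apply: measurable_indic.
apply/funext => w; rewrite counting_dirac; apply: eq_eseriesr => n _.
by rewrite diracE indicE; congr (nat_of_bool _)%:R%:E; apply/idP/idP => /set_mem h; apply/mem_set.
Qed.

(** Cut the path at its last visit of a. *)
Lemma clos_rt_first_step (r : nat -> nat -> Prop) a b :
  Relation_Operators.clos_refl_trans nat r a b -> b != a ->
  exists i, [/\ i != a, r a i &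
    Relation_Operators.clos_refl_trans nat
      (fun i j => [/\ r i j, i != a & j != a]) i b].
Proof.
move=> /Operators_Properties.clos_rt_rtn1_iff.
elim=> [|y z ryz _ IH za]; first by rewrite eqxx.
have [ya|ya] := eqVneq y a.
  exists z; split => //; [by rewrite -ya|exact: Relation_Operators.rt_refl].
have [i [ia rai riy]] := IH ya; exists i; split => //.
by apply: Relation_Operators.rt_trans riy _; exact: Relation_Operators.rt_step.
Qed.

Section one_base_point.
Variables (x : X) (e : nat -> nat -> set Om).
Hypothesis eP : random_connection phi Q (add_points [:: x] eta) e.

Definition window_cluster w : set nat :=
  [set n | window eta W w n /\ joined_in e (vertices 1 w) w 0%N n.+1].

Lemma measurable_window_cluster :
  measurable_fun setT (fun w => counting (window_cluster w) : \bar R).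
Proof.
apply: measurable_counting => n.
apply: measurableI (measurable_window etaP mW n) _.
apply: (measurable_joined_vertices eP) => l.
exact: (measurable_vertices [:: x]).
Qed.

(** The Palm formula with j = 1, the distinguished point being the target. *)
Lemma integral_window_cluster :
  \int[Q]_w counting (window_cluster w) = \int[N]_y tau_window phi N x y.
Proof.
pose D n := [set w | joined_in e (vertices 1 w) w 0%N n.+1].
have mD n : measurable (D n).
  apply: (measurable_joined_vertices eP) => l.
  exact: (measurable_vertices [:: x]).
pose D' (t : seq nat) := if t is n :: _ then D n else set0.
rewrite (palm_formula etaP mW Woo (j := 1%N) (D := D')
  (h := fun k (u : (1 + k).-tuple X) => list_conn phi (x :: u)))//.
- by rewrite -integral_tau_window// fine_windowT.
- by case => [|n t]; [exact: measurable0|exact: mD].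
- move=> k; apply: (measurable_list_conn phiP (n := k.+2)).
    by move=> u; rewrite /= size_tuple.
  by case=> [|i] /=; [exact: measurable_cst|exact: measurable_nth_tuple].
- by move=> k u; have /andP[] := list_conn_itv phiP (x :: u).
- exact: measurable_window_cluster.
- move=> k [|n t] // ut st.
  have := joined_vertices_law eP (b := [:: 0%N]) (t := n :: t).
  have {}st : size t = k by move: st => -[].
  by subst k; rewrite /= => ->.
- move=> w s us ws; rewrite /window_cluster ws counting_sub_uniq//.
  case: ifPn => [s0|]; last by rewrite -eqn0Ngt => /eqP/size0nil ->.
  rewrite (eq_count (a2 := fun t => if t is n :: _ then `[< D n w >] else false)).
    by rewrite count_permutations_head// mulnC natrM EFinM subn1.
  move=> [|n t] /=; first by apply/negP => /set_mem.
  by apply/idP/asboolP => [/set_mem|] //; move=> h; apply/mem_set.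
Qed.

(** The connection within the window avoids x, hence is independent of the edges
    at x given the points. *)
Lemma edge_joined_law (t : seq nat) : uniq t -> (1 < size t)%N ->
  Q (window_is eta W t `&` (e 0%N (nth 0%N t 0%N).+1 `&`
     [set w | joined_in e (shifted_window 1 w) w (nth 0%N t 0%N).+1 (nth 0%N t 1%N).+1])) =
  \int[Q]_(w in window_is eta W t)
     (phi x (pt eta (nth 0%N t 0%N) w) * list_conn phi (points_tuple eta (size t) t w))%:E.
Proof.
move=> ut st; pose s := map (addn 1) t.
have us : uniq (0%N :: s).
  rewrite /= map_inj_uniq ?ut ?andbT; last exact: addnI.
  by apply/mapP => -[].
have ss : (1 < size s)%N by rewrite size_map.
have s0 : nth 0%N s 0%N = (nth 0%N t 0%N).+1 by rewrite (nth_map 0%N) ?(ltnW st)// add1n.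
have s1 : nth 0%N s 1%N = (nth 0%N t 1%N).+1 by rewrite (nth_map 0%N)// add1n.
have ls n : n \in 0%N :: s -> window_is eta W t `<=` live (add_points [:: x] eta) n.
  rewrite inE => /orP[/eqP -> w _ //|ns].
  by apply: (window_is_live (xs := [:: x])); exact: ns.
transitivity (Q (window_is eta W t `&` e 0%N (nth 0%N s 0%N) `&`
     [set w | joined_in e [set` s] w (nth 0%N s 0%N) (nth 0%N s 1%N)])).
  congr (Q _); rewrite setIA s0 s1; apply/seteqP; split => w [[wt ew]] /=;
    by rewrite -(shifted_window_is [:: x] wt).
rewrite (edge_connection_law phiP eP (measurable_pt_add [:: x]) _
  (sigma_points_window_is (xs := [:: x]) t) us ss ls); last exact: (measurable_window_is etaP mW).
apply: eq_integral => w _; congr (_%:E).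
rewrite s0 (_ : (nth 0%N t 0%N).+1 = (1 + nth 0%N t 0%N)%N)// (pt_addr [:: x]); congr (_ * _)%R.
rewrite /list_conn size_map size_tuple; apply: eq_conn_prob => i it.
rewrite (nth_map 0%N)// (pt_addr [:: x]).
have -> : i = nat_of_ord (Ordinal it) by [].
by rewrite -tnth_nth tnth_mktuple.
Qed.

Definition window_neighbours w : \bar R :=
  counting [set n | window eta W w n /\ e 0%N n.+1 w].

Let me n : measurable (e 0%N n.+1). Proof. exact: (edge_measurable eP). Qed.

Let mphi : measurable_fun setT (fun y => (phi x y)%:E).
Proof.
apply/measurable_EFinP; apply: (measurable_connection phiP) => //.
Qed.

Let phi0 y : 0 <= (phi x y)%:E.
Proof. by have /andP[] := connection_itv phiP x y; rewrite lee_fin. Qed.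

(** The Palm formula with j = 1; the k other points integrate to 1. *)
Lemma integral_window_neighbours :
  \int[Q]_w window_neighbours w = \int[N]_y (phi x y)%:E.
Proof.
pose D' (t : seq nat) := if t is n :: _ then e 0%N n.+1 else set0.
have mh k : measurable_fun setT (fun u : (1 + k).-tuple X => phi x (nth point u 0)).
  apply: (measurable_connection phiP) => //.
  exact: measurable_nth_tuple.
rewrite (palm_formula etaP mW Woo (j := 1%N) (D := D')
  (h := fun k (u : (1 + k).-tuple X) => phi x (nth point u 0)))//.
- transitivity (\sum_(k <oo) (\int[N]_y ((phi x y)%:E * poisson_mass (fine (M W))%:E k))).
    apply: eq_eseriesr => k _; rewrite integral_powerS; last 2 first.
    + by apply/measurable_EFinP; exact: (mh k).
    + by move=> u; exact: phi0.
    have pT : power_measure N k setT = ((fine (M W)) ^+ k)%:E.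
      transitivity (power_measure N k [set u | forall i, setT (tnth u i)]).
        by congr (power_measure N k _); apply/seteqP; split.
      rewrite (power_measure_rect N (A := fun=> setT))// -[k in RHS]card_ord.
      by rewrite -prodr_const -prodEFin; apply: eq_bigr => i _; rewrite -fine_windowT fineK// fin_num_measure.
    rewrite (eq_integral (fun y => (phi x y)%:E * (fine (M W) ^+ k)%:E)); last first.
      by move=> y _; rewrite /= integral_cst//; congr (_ * _); exact: pT.
    have m0 : (0 <= fine (M W))%R by rewrite fine_ge0.
    rewrite -ge0_integralZl//.
    + apply: eq_integral => y _; rewrite muleCA -!EFinM; congr (_%:E).
      by congr (_ * _)%R; rewrite mulrC mulrA mulrAC.
    + by apply: emeasurable_funM => //; exact: measurable_cst.
    + by move=> y _; rewrite mule_ge0// lee_fin exprn_ge0.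
  have pm0 k : 0 <= poisson_mass (fine (M W))%:E k.
    by rewrite lee_fin mulr_ge0 ?expR_ge0// divr_ge0// exprn_ge0// fine_ge0.
  rewrite -integral_nneseries//; last 2 first.
  + by move=> k; apply: emeasurable_funM => //; exact: measurable_cst.
  + by move=> k y _; rewrite mule_ge0.
  apply: eq_integral => y _; rewrite nneseriesZl//.
  by rewrite sum_poisson_mass ?mule1// fine_ge0.
- by case => [|n t]; [exact: measurable0|exact: me].
- by move=> k u; have := phi0 (nth point u 0); rewrite lee_fin.
- apply: measurable_counting => n.
  exact: measurableI (measurable_window etaP mW n) (me n).
- move=> k [|n t] // ut st.
  have {}st : size t = k by move: st => -[].
  subst k.
  rewrite (single_edge_law phiP eP (sigma_points_window_is (xs := [:: x]) _))//.
  + apply: eq_integral => w _; congr (_%:E).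
    rewrite (_ : n.+1 = (1 + n)%N)// (pt_addr [:: x]) -[in RHS](tnth_nth point _ ord0).
    by rewrite tnth_mktuple.
  + by apply: (window_is_live (xs := [:: x])); rewrite mem_head.
- move=> w s us ws; rewrite /window_neighbours ws counting_sub_uniq//.
  case: ifPn => [s0|]; last by rewrite -eqn0Ngt => /eqP/size0nil ->.
  rewrite (eq_count (a2 := fun t => if t is n :: _ then `[< e 0%N n.+1 w >] else false)).
    by rewrite count_permutations_head// mulnC natrM EFinM subn1.
  move=> [|n t] /=; first by apply/negP => /set_mem.
  by apply/idP/asboolP => [/set_mem|] //; move=> h; apply/mem_set.
Qed.

Let G m n : set Om := [set w | [/\ window eta W w m, window eta W w n, n != m,
  e 0%N m.+1 w & joined_in e (shifted_window 1 w) w m.+1 n.+1]].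

Let mjoin m n : measurable [set w | joined_in e (shifted_window 1 w) w m n].
Proof.
apply: (measurable_joined_vertices eP) => l.
exact: (measurable_shifted_window [:: x]).
Qed.

Let mG m n : measurable (G m n).
Proof.
have [nm|nm] := eqVneq n m.
  by rewrite (_ : G m n = set0)//; apply/seteqP; split => // w []; rewrite nm eqxx.
rewrite (_ : G m n = ([set w | window eta W w m] `&` [set w | window eta W w n]) `&`
   (e 0%N m.+1 `&` [set w | joined_in e (shifted_window 1 w) w m.+1 n.+1])).
  by apply: measurableI; apply: measurableI => //; exact: (measurable_window etaP mW).
apply/seteqP; split => w /=; first by case.
by move=> [[? ?] [? ?]].
Qed.

(** The vertices n that are connected to a neighbour m of x, counted once for
    each m: with this multiplicity the expectation is an integral over pairs of
    points. *)
Definition window_neighbour_pairs w : \bar R :=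
  \sum_(m <oo) \sum_(n <oo) (\1_(G m n) w)%:E.

(** The Palm formula with j = 2, the distinguished points being the neighbour
    of x and the target. *)
Lemma integral_window_neighbour_pairs :
  \int[Q]_w window_neighbour_pairs w =
  \int[N]_y ((phi x y)%:E * \int[N]_z tau_window phi N y z).
Proof.
pose D m n := e 0%N m.+1 `&` [set w | joined_in e (shifted_window 1 w) w m.+1 n.+1].
pose D' (t : seq nat) := if t is [:: m, n & _] then D m n else set0.
have mD m n : measurable (D m n) by exact: measurableI.
have mlc k : measurable_fun setT (fun u : k.-tuple X => list_conn phi u).
  apply: (measurable_list_conn phiP (n := k)) => [u|i]; first by rewrite size_tuple.
  exact: measurable_nth_tuple.
have mh k : measurable_fun setT
    (fun u : (2 + k).-tuple X => (phi x (nth point u 0) * list_conn phi u)%R).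
  apply: measurable_funM; last exact: mlc.
  apply: (measurable_connection phiP) => //; exact: measurable_nth_tuple.
have h0 k (u : (2 + k).-tuple X) : (0 <= phi x (nth point u 0) * list_conn phi u)%R.
  rewrite mulr_ge0//; first by have := phi0 (nth point u 0); rewrite lee_fin.
  by have /andP[] := list_conn_itv phiP u.
rewrite (palm_formula etaP mW Woo (j := 2%N) (D := D')
  (h := fun k (u : (2 + k).-tuple X) => (phi x (nth point u 0) * list_conn phi u)%R))//.
- have I0 k y : 0 <= \int[power_measure N k]_u (list_conn phi (y :: u))%:E.
    by apply: integral_ge0 => u _; exact: list_conn_ge0.
  have mI k : measurable_fun setT
      (fun y => \int[power_measure N k]_u (list_conn phi (y :: u))%:E).
    apply: (measurable_integral_power N (h := fun p => (list_conn phi (p.1 :: p.2))%:E)).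
      apply/measurable_EFinP; apply: (measurable_list_conn phiP (n := k.+1)).
        by move=> p; rewrite /= size_tuple.
      case=> [|i] /=; first exact: measurable_fst.
      exact: measurableT_comp (@measurable_nth_tuple _ _ _ _ k i) measurable_snd.
    by move=> p; exact: list_conn_ge0.
  transitivity (\sum_(k <oo) \int[N]_y ((phi x y)%:E *
     ((expR (- fine (M W)) / k`!%:R)%:E *
      \int[power_measure N k.+1]_u (list_conn phi (y :: u))%:E))).
    apply: eq_eseriesr => k _; rewrite integral_powerS; last 2 first.
    + by apply/measurable_EFinP; exact: (mh k).
    + by move=> u; rewrite lee_fin; exact: (h0 k).
    rewrite -ge0_integralZl//.
    + apply: eq_integral => y _; rewrite muleCA; congr (_ * _).
      rewrite -ge0_integralZl//.
      * apply/measurable_EFinP; apply: (measurable_list_conn phiP (n := k.+2)).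
          by move=> u; rewrite /= size_tuple.
        case=> [|i] /=; first exact: measurable_cst.
        exact: measurable_nth_tuple.
      * by move=> u _; exact: list_conn_ge0.
    + apply: (measurable_integral_power N (h := fun p => (phi x p.1 * list_conn phi (p.1 :: p.2))%:E)).
        apply/measurable_EFinP; apply: measurable_funM.
          by apply: (measurable_connection phiP) => //; exact: measurable_fst.
        apply: (measurable_list_conn phiP (n := k.+2)).
          by move=> p; rewrite /= size_tuple.
        case=> [|i] /=; first exact: measurable_fst.
        exact: measurableT_comp (@measurable_nth_tuple _ _ _ _ k.+1 i) measurable_snd.
      by move=> p; rewrite EFinM mule_ge0//; exact: list_conn_ge0.
    + by move=> y _; apply: integral_ge0 => u _; rewrite EFinM mule_ge0//; exact: list_conn_ge0.
  rewrite -integral_nneseries//; last 2 first.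
  + move=> k; apply: emeasurable_funM => //; apply: emeasurable_funM => //; exact: measurable_cst.
  + by move=> k y _; rewrite mule_ge0// mule_ge0// lee_fin divr_ge0 ?expR_ge0.
  apply: eq_integral => y _; rewrite nneseriesZl//; last first.
    by move=> k _; rewrite mule_ge0// lee_fin divr_ge0 ?expR_ge0.
  by rewrite -integral_tau_window// fine_windowT.
- by case => [|m [|n t]]; [exact: measurable0|exact: measurable0|exact: mD].
- apply: ge0_emeasurable_sum => [m w _ _|m _].
    by apply: nneseries_ge0 => n _ _; rewrite lee_fin.
  apply: ge0_emeasurable_sum => [n w _ _|n _]; first by rewrite lee_fin.
  by apply/measurable_EFinP; apply: measurable_indic.
- move=> w; apply: nneseries_ge0 => m _ _; apply: nneseries_ge0 => n _ _.
  by rewrite lee_fin.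
- move=> k [|m [|n t]] // ut st.
  have {}st : size t = k by move: st => -[].
  subst k; apply: etrans (edge_joined_law ut isT) _.
  apply: eq_integral => w _; congr (_%:E); congr (phi x _ * _)%R.
  by rewrite -(tnth_nth point _ ord0) tnth_mktuple.
- move=> w s us ws.
  have GE m n : (\1_(G m n) w)%:E =
      ([&& m \in s, n \in s, n != m & `[< D m n w >]])%:R%:E :> \bar R.
    rewrite indicE; congr (nat_of_bool _)%:R%:E; apply/idP/idP => [/set_mem[]|].
      rewrite ws/= => -> -> -> e0 jn; rewrite /= ?andbT; apply/asboolP; split => //.
    move=> /and4P[ms ns nm /asboolP[e0 jn]]; apply/mem_set; split => //; by rewrite ws.
  have ZE : window_neighbour_pairs w =
      (\sum_(m <- s) count (fun n => (n != m) && `[< D m n w >]) s)%:R%:E.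
    rewrite /window_neighbour_pairs (@nneseries_finite_support _ _ s)//.
    + rewrite natr_sum -sumEFin !big_seq; apply: eq_bigr => m ms.
      rewrite (@nneseries_finite_support _ _ s)//.
      * rewrite -sum1_count natr_sum -sumEFin big_mkcond [RHS]big_mkcond/=.
        rewrite !big_seq; apply: eq_bigr => n ns; rewrite GE ms ns/=.
        by case: ifP.
      * by move=> n ns; rewrite GE (negbTE ns) andbF.
    + by move=> m; apply: nneseries_ge0 => n _ _; rewrite lee_fin.
    + by move=> m ms; rewrite eseries0// => n _ _; rewrite GE (negbTE ms).
  rewrite (eq_count (a2 := fun t => if t is [:: m, n & _] then `[< D m n w >] else false)); last first.
    move=> [|m [|n t]] /=; [by apply/negP => /set_mem|by apply/negP => /set_mem|].
    by apply/idP/asboolP => [/set_mem|] //; move=> h; apply/mem_set.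
  rewrite ZE; case: ifPn => s2.
    by rewrite count_permutations_head2// mulnC natrM EFinM subn2.
  case: s us ws GE ZE s2 => [|m [|n s]]//= _ _ _ _ _; first by rewrite big_nil.
  by rewrite big_seq1/= eqxx.
Qed.

(** A path from x to another vertex leaves x for the last time along an edge to a
    neighbour, which is the target or is connected to the target without x. *)
Lemma window_cluster_le w : counting (window_cluster w) <=
  window_neighbours w + window_neighbour_pairs w.
Proof.
rewrite /window_neighbour_pairs nneseries_interchange; last first.
  by move=> m n; rewrite lee_fin.
have cE (A : set nat) : counting A = \sum_(n <oo) (`[< A n >])%:R%:E :> \bar R.
  rewrite counting_dirac; apply: eq_eseriesr => n _; rewrite diracE.
  by congr (nat_of_bool _)%:R%:E; apply/idP/asboolP => [/set_mem//|h]; apply/mem_set.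
rewrite cE /window_neighbours cE -nneseriesD; last 2 first.
- by move=> n _ _; rewrite lee_fin.
- by move=> n _ _; apply: nneseries_ge0 => m _ _; rewrite lee_fin.
apply: lee_nneseries => n; first by move=> _ _; rewrite lee_fin.
move=> _.
case: asboolP => [[Wn jn]|_]; last first.
  by rewrite adde_ge0 ?lee_fin//; apply: nneseries_ge0 => m _ _; rewrite lee_fin.
have [m [v0 e0 jm]] := clos_rt_first_step jn isT.
case: e0 => e0 _ [|Wm]; first by rewrite /= ltnS leqn0 (negbTE v0).
case: Wm e0 jm {v0} => m' Wm' <- e0 jm.
have {}jm : joined_in e (shifted_window 1 w) w m'.+1 n.+1.
  apply: (@clos_rt_map _ _ _ _ id _ _ _ jm) => a b [[eab va vb] a0 b0].
  have sh c : c != 0%N -> vertices 1 w c -> shifted_window 1 w c.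
    by move=> c0 [] //; case: c c0.
  by split => //; exact: sh.
have [nm|nm] := eqVneq n m'.
  rewrite asboolT; last by split => //; rewrite nm.
  by rewrite leeDl//; apply: nneseries_ge0 => i _ _; rewrite lee_fin.
apply: (@le_trans _ _ (\sum_(m <oo) (\1_(G m n) w)%:E)); last by rewrite leeDr ?lee_fin.
apply: le_trans (nneseries_lim_ge m'.+1 _) => [|//].
rewrite big_nat_recr//= indicE mem_set//.
by rewrite leeDr// sume_ge0.
Qed.

(** The expectation of [window_cluster_le]. *)
Lemma tau_window_le :
  \int[N]_y tau_window phi N x y <=
  \int[N]_y ((phi x y)%:E * (1 + \int[N]_z tau_window phi N y z)).
Proof.
have mt : measurable_fun setT (fun y => \int[N]_z tau_window phi N y z).
  apply: (@measurable_fun_fubini_tonelli_F _ _ _ _ _ N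
    (fun p => tau_window phi N p.1 p.2)); first exact: measurable_tau_window.
  by move=> p; exact: tau_window_ge0.
have t0 y : 0 <= \int[N]_z tau_window phi N y z.
  by apply: integral_ge0 => z _; exact: tau_window_ge0.
under [leRHS]eq_integral do rewrite ge0_muleDr// mule1.
rewrite ge0_integralD//; last 2 first.
- by move=> y _; rewrite mule_ge0.
- exact: emeasurable_funM.
rewrite -integral_window_cluster -integral_window_neighbours -integral_window_neighbour_pairs.
have mn : measurable_fun setT window_neighbours.
  apply: measurable_counting => n.
  exact: measurableI (measurable_window etaP mW n) (me n).
have mp : measurable_fun setT window_neighbour_pairs.
  apply: ge0_emeasurable_sum => [m w _ _|m _].
    by apply: nneseries_ge0 => n _ _; rewrite lee_fin.
  apply: ge0_emeasurable_sum => [n w _ _|n _]; first by rewrite lee_fin.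
  by apply/measurable_EFinP; apply: measurable_indic.
have p0 w : 0 <= window_neighbour_pairs w.
  apply: nneseries_ge0 => m _ _; apply: nneseries_ge0 => n _ _.
  by rewrite lee_fin.
rewrite -ge0_integralD//; apply: ge0_le_integral => //.
- exact: measurable_window_cluster.
- exact: emeasurable_funD.
- by move=> w _; exact: window_cluster_le.
Qed.

End one_base_point.

End window_formulas.

(** * From windows to the whole space *)

Lemma clos_rt_last_step (r : nat -> nat -> Prop) a b :
  Relation_Operators.clos_refl_trans nat r a b -> b = a \/ exists i, r i b.
Proof.
by move=> /Operators_Properties.clos_rt_rtn1_iff; case=> [|i c ric _]; [left|right; exists i].
Qed.

Section exhaustion.
Context {R : realType} {d : nat} {de : measure_display} {E : measurableType de}.
Context {dO : measure_display} {Om : measurableType dO}.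
Notation X := (mspace R d E).
Variables (phi : X -> X -> R) (phiP : connection_function phi).
Variables (Q : probability Om R) (eta : @points R d de E Om)
  (M : {sigma_finite_measure set X -> \bar R}).
Hypothesis etaP : poisson_process Q eta M.
Variable e : seq X -> nat -> nat -> set Om.
Hypothesis eP : forall xs, random_connection phi Q (add_points xs eta) (e xs).

Variable F : (set X)^nat.
Hypotheses (mF : forall m, measurable (F m)) (Foo : forall m, (M (F m) < +oo)%E)
  (ndF : nondecreasing_seq F) (cF : \bigcup_m F m = setT).

Let N m : {finite_measure set X -> \bar R} := mfrestr (mF m) (Foo m).

Let subF m n : (m <= n)%N -> F m `<=` F n.
Proof. by move=> mn; apply/subsetPset; exact: ndF. Qed.

Lemma subset_vertices m n o w : (m <= n)%N ->
  vertices eta (F m) o w `<=` vertices eta (F n) o w.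
Proof.
move=> mn i [io|[l [ll Fl] <-]]; [by left|right].
by exists l => //; split => //; exact: subF Fl.
Qed.

Lemma joined_in_subset (f : nat -> nat -> set Om) (I J : set nat) w i j :
  I `<=` J -> joined_in f I w i j -> joined_in f J w i j.
Proof.
move=> IJ; apply: (@clos_rt_map _ _ _ _ id) => a b [fab Ia Ib].
by split => //; exact: IJ.
Qed.

(** A path has finitely many vertices, hence lies in one of the windows. *)
Lemma joined_exhaustion xs w i j : joined (e xs) w i j <->
  exists m, joined_in (e xs) (vertices eta (F m) (size xs) w) w i j.
Proof.
split; last first.
  move=> [m]; apply: (@clos_rt_map _ _ _ _ id) => a b [] //.
have vx a : live (add_points xs eta) a w ->
    exists m, vertices eta (F m) (size xs) w a.
  rewrite /=; case: ltnP => [ax _|xa la]; first by exists 0%N; left.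
  have [m _ Fm] : (\bigcup_m F m) (pt eta (a - size xs)%N w) by rewrite cF.
  by exists m; right; exists (a - size xs)%N => //; rewrite subnKC.
elim=> [a b ab|a|a b c _ [m ab] _ [n bc]].
- have [la lb] := edge_live (eP xs) ab.
  have [m am] := vx _ la; have [n bn] := vx _ lb.
  exists (maxn m n); apply: Relation_Operators.rt_step; split => //.
    by apply: subset_vertices am; rewrite leq_maxl.
  by apply: subset_vertices bn; rewrite leq_maxr.
- by exists 0%N; exact: Relation_Operators.rt_refl.
- exists (maxn m n); apply: (@Relation_Operators.rt_trans _ _ _ b).
    by apply: joined_in_subset ab; apply: subset_vertices; rewrite leq_maxl.
  by apply: joined_in_subset bc; apply: subset_vertices; rewrite leq_maxr.
Qed.

Local Open Scope ereal_scope.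

Let D xs i j m := [set w | joined_in (e xs) (vertices eta (F m) (size xs) w) w i j].

Let mD xs i j m : measurable (D xs i j m).
Proof.
apply: (measurable_joined_vertices (eP xs)) => n.
exact: (measurable_vertices etaP (mF m) xs).
Qed.

Let ndD xs i j : nondecreasing_seq (D xs i j).
Proof.
move=> m n mn; apply/subsetPset => w; apply: joined_in_subset.
exact: subset_vertices.
Qed.

Let DE xs i j : \bigcup_m D xs i j m = [set w | joined (e xs) w i j].
Proof.
apply/seteqP; split => w /=; first by move=> [m _ h]; apply/joined_exhaustion; exists m.
by move=> /joined_exhaustion[m h]; exists m.
Qed.

Lemma measurable_joined xs i j : measurable [set w | joined (e xs) w i j].
Proof. by rewrite -DE; exact: bigcupT_measurable. Qed.

(** When x = y, the indices 0 and 1 denote two copies of x, and the connection is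
    not automatic as it is in [tau]: this keeps the formulas uniform, and the
    integrals over positions do not see the difference. *)
Definition two_point (x y : X) : \bar R :=
  Q [set w | joined (e [:: x; y]) w 0%N 1%N].

Lemma two_point_itv x y : 0 <= two_point x y <= 1.
Proof. by rewrite measure_ge0 probability_le1//; exact: measurable_joined. Qed.

Let tauE m x y (b : bool) :
  tau_window phi (N m) (if b then y else x) (if b then x else y) = Q (D [:: x; y] b (~~ b) m).
Proof. by rewrite -(tau_window_law phiP etaP (mF m) (Foo m) b (eP [:: x; y])). Qed.

Lemma nondecreasing_tau_window x y :
  nondecreasing_seq (fun m => tau_window phi (N m) x y).
Proof.
move=> m n mn; rewrite (tauE m x y false) (tauE n x y false).
by apply: le_measure; rewrite ?inE//; apply/subsetPset; exact: ndD.
Qed.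

Lemma cvg_tau_window x y : tau_window phi (N m) x y @[m --> \oo] --> two_point x y.
Proof.
rewrite /two_point -DE.
rewrite (_ : (fun m => _) = Q \o D [:: x; y] 0%N 1%N); last first.
  by apply/funext => m; exact: (tauE m x y false).
by apply: nondecreasing_cvg_mu => //; exact: bigcupT_measurable.
Qed.

Lemma tau_window_le_two_point m x y : tau_window phi (N m) x y <= two_point x y.
Proof.
rewrite (tauE m x y false) /two_point -DE; apply: le_measure; rewrite ?inE//.
- exact: bigcupT_measurable.
- by move=> w h; exists m.
Qed.

Lemma joinedC xs w i j : joined (e xs) w i j -> joined (e xs) w j i.
Proof.
elim=> [a b ab|a|a b c _ ba _ cb].
- by apply: Relation_Operators.rt_step; rewrite (edge_sym (eP _)).
- exact: Relation_Operators.rt_refl.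
- exact: Relation_Operators.rt_trans cb ba.
Qed.

(** The graphs on x, y and on y, x are unrelated random variables; their laws are
    compared through the series for the windows. *)
Lemma two_pointC x y : two_point x y = two_point y x.
Proof.
have h : tau_window phi (N m) y x @[m --> \oo] --> two_point x y.
  rewrite (_ : two_point x y = Q (\bigcup_m D [:: x; y] 1%N 0%N m)).
    rewrite (_ : (fun m => _) = Q \o D [:: x; y] 1%N 0%N); last first.
      by apply/funext => m; exact: (tauE m x y true).
    by apply: nondecreasing_cvg_mu => //; exact: bigcupT_measurable.
  by rewrite DE; congr (Q _); apply/seteqP; split => w; exact: joinedC.
exact: cvg_unique h (cvg_tau_window (x := y) (y := x)).
Qed.

Lemma measurable_two_point : measurable_fun setT (fun p : X * X => two_point p.1 p.2).
Proof.
apply: (emeasurable_fun_cvg (fun m p => tau_window phi (N m) p.1 p.2)).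
- by move=> m; exact: measurable_tau_window.
- by move=> p _; exact: cvg_tau_window.
Qed.

Let mpair (x : X) : measurable_fun setT (fun y : X => (x, y)).
Proof. by apply: measurable_fun_pair => //; exact: measurable_cst. Qed.

Lemma measurable_two_pointr x : measurable_fun setT (two_point x).
Proof.
exact: measurableT_comp measurable_two_point (mpair x).
Qed.

Let tau_windowE m x : \int[N m]_y tau_window phi (N m) x y =
  \int[M]_y ((tau_window phi (N m) x) \_ (F m)) y.
Proof.
have mt : measurable_fun setT (tau_window phi (N m) x).
  exact: measurableT_comp (measurable_tau_window phiP (N m)) (mpair x).
rewrite -integral_mkcond; apply: (ge0_integral_mrestr M (mF m) mt).
by move=> y; exact: tau_window_ge0.
Qed.

Lemma cvg_integral_tau_window x :
  \int[N m]_y tau_window phi (N m) x y @[m --> \oo] --> \int[M]_y two_point x y.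
Proof.
under eq_fun do rewrite tau_windowE.
have mt m : measurable_fun setT (tau_window phi (N m) x).
  exact: measurableT_comp (measurable_tau_window phiP (N m)) (mpair x).
have c : \int[M]_y ((tau_window phi (N m) x) \_ (F m)) y @[m --> \oo] -->
    \int[M]_y (fun y => limn (fun m => ((tau_window phi (N m) x) \_ (F m)) y)) y.
  apply: cvg_monotone_convergence => //.
  - by move=> m; apply/(measurable_restrictT _ (mF m)); exact: measurable_funTS.
  - by move=> m y _; apply: erestrict_ge0 => z _; exact: tau_window_ge0.
  - move=> y _ m n mn; rewrite !patchE; case: ifPn => [ym|_].
      rewrite ifT; first exact: nondecreasing_tau_window.
      by apply/mem_set; apply: subF mn _ _; apply/set_mem.
    by case: ifP => // _; exact: tau_window_ge0.
suff -> : \int[M]_y two_point x y =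
  \int[M]_y (fun y => limn (fun m => ((tau_window phi (N m) x) \_ (F m)) y)) y by [].
apply: eq_integral => y _; apply/esym/cvg_lim => //.
apply: cvg_trans (cvg_tau_window (x := x) (y := y)); apply: near_eq_cvg.
have [k _ Fk] : (\bigcup_m F m) y by rewrite cF.
near=> m; rewrite patchE ifT//; apply/mem_set; apply: subF Fk.
by near: m; exists k.
Unshelve. all: by end_near. Qed.

Lemma integral_mfrestr_le m (f : X -> \bar R) : measurable_fun setT f ->
  (forall y, 0 <= f y) -> \int[N m]_y f y <= \int[M]_y f y.
Proof.
move=> mf f0; apply: (@le_trans _ _ (\int[M]_(y in F m) f y)).
  by rewrite (ge0_integral_mrestr M (mF m) mf f0).
by apply: ge0_subset_integral.
Qed.

Lemma measurable_integral_two_point :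
  measurable_fun setT (fun y => \int[M]_z two_point y z).
Proof.
apply: (@measurable_fun_fubini_tonelli_F _ _ _ _ _ M
    (fun p => two_point p.1 p.2)); first exact: measurable_two_point.
by move=> p; have /andP[] := two_point_itv p.1 p.2.
Qed.

(** The limit of [tau_window_le] along the windows. *)
Lemma integral_two_point_le x :
  \int[M]_y two_point x y <=
  \int[M]_y ((phi x y)%:E * (1 + \int[M]_z two_point y z)).
Proof.
have mI := measurable_integral_two_point.
have phi0 y : 0 <= (phi x y)%:E.
  by have /andP[] := connection_itv phiP x y; rewrite lee_fin.
have mphi : measurable_fun setT (fun y => (phi x y)%:E).
  by apply/measurable_EFinP; apply: (measurable_connection phiP).
have t0 y z : 0 <= two_point y z by have /andP[] := two_point_itv y z.
have I0 y : 0 <= 1 + \int[M]_z two_point y z.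
  by rewrite adde_ge0// integral_ge0.
have mt m y : measurable_fun setT (tau_window phi (N m) y).
  exact: measurableT_comp (measurable_tau_window phiP (N m)) (mpair y).
have mtI m : measurable_fun setT (fun y => \int[N m]_z tau_window phi (N m) y z).
  apply: (@measurable_fun_fubini_tonelli_F _ _ _ _ _ (N m)
    (fun p => tau_window phi (N m) p.1 p.2)); first exact: measurable_tau_window.
  by move=> p; exact: tau_window_ge0.
apply: (cvge_to_le (cvg_integral_tau_window (x := x))).
apply: nearW => m.
apply: le_trans (tau_window_le phiP etaP (mF m) (Foo m) (eP [:: x])) _.
apply: le_trans (integral_mfrestr_le m _ _) _.
- apply: emeasurable_funM => //; apply: emeasurable_funD; first exact: measurable_cst.
  exact: mtI.
- move=> y; rewrite mule_ge0// adde_ge0// integral_ge0// => z _.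
  exact: tau_window_ge0.
apply: ge0_le_integral => //.
- move=> y _; rewrite mule_ge0// adde_ge0// integral_ge0// => z _.
  exact: tau_window_ge0.
- apply: emeasurable_funM => //; apply: emeasurable_funD; first exact: measurable_cst.
  exact: mtI.
- by apply: emeasurable_funM => //; apply: emeasurable_funD; first exact: measurable_cst.
move=> y _; apply: lee_wpmul2l => //; rewrite leeD2l//.
apply: le_trans (integral_mfrestr_le m (mt m y) _) _ => [z|].
  exact: tau_window_ge0.
apply: ge0_le_integral => //.
- by move=> z _; exact: tau_window_ge0.
- exact: measurable_two_pointr.
- by move=> z _; exact: tau_window_le_two_point.
Qed.

(** The limit of [integral_window_cluster] along the windows; x itself contributes
    1. *)
Lemma integral_cluster x :
  \int[Q]_w counting (joined (e [:: x]) w 0%N : set nat) =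
  1 + \int[M]_y two_point x y.
Proof.
pose A n : set Om := [set w | joined (e [:: x]) w 0%N n].
have cE w : counting (joined (e [:: x]) w 0%N : set nat) =
    1 + counting [set n | A n.+1 w] :> \bar R.
  rewrite !counting_dirac nneseries_recl//; congr (_ + _).
    by rewrite diracE mem_set//; exact: Relation_Operators.rt_refl.
  rewrite -nneseries_addn//; apply: eq_eseriesr => n _; rewrite addn1 !diracE.
  by congr (nat_of_bool _)%:R%:E; apply/idP/idP => /set_mem h; apply/mem_set.
under eq_integral do rewrite cE.
have mA n : measurable (A n) by exact: measurable_joined.
rewrite ge0_integralD//; last exact: measurable_counting.
congr (_ + _); first by rewrite integral_cst// mul1e; exact: probability_setT.
pose C m w := window_cluster eta (F m) (e [:: x]) w.
have ndC w : nondecreasing_seq (C ^~ w).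
  move=> m n mn; apply/subsetPset => i [[li Fi] ji]; split.
    by split => //; exact: subF Fi.
  by apply: joined_in_subset ji; exact: subset_vertices.
have CE w : \bigcup_m C m w = [set n | A n.+1 w].
  apply/seteqP; split => n /=.
    by move=> [m _ [_ ?]]; apply/joined_exhaustion; exists m.
  move=> An; have [m jm] := (joined_exhaustion [:: x] w 0%N n.+1).1 An.
  have [//|[k [_ _ [//|[l wl [ln]]]]]] := clos_rt_last_step jm.
  by exists m => //; split => //; rewrite -ln.
have mC m : measurable_fun setT (fun w => counting (C m w) : \bar R).
  exact: (measurable_window_cluster etaP (mF m) (eP [:: x])).
have cC w : counting (C m w) @[m --> \oo] --> (counting [set n | A n.+1 w] : \bar R).
  by rewrite -CE; apply: nondecreasing_cvg_mu.
have h : \int[Q]_w counting (C m w) @[m --> \oo] -->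
   \int[Q]_w counting [set n | A n.+1 w].
  rewrite [X in _ --> X](_ : _ = \int[Q]_w limn (fun m => counting (C m w))).
    apply: cvg_monotone_convergence => // w _ m n mn.
    by apply: le_measure; rewrite ?inE//; apply/subsetPset; exact: ndC.
  by apply: eq_integral => w _; apply/esym/cvg_lim => //; exact: cC.
apply/esym; apply: cvg_unique (cvg_integral_tau_window (x := x)) _ => //.
rewrite (_ : (fun m => _) = fun m => \int[Q]_w counting (C m w))//.
by apply/funext => m; rewrite (integral_window_cluster phiP etaP (mF m) (Foo m) (eP [:: x])).
Qed.

End exhaustion.

(** * Invariance of the two-point function *)

Section preservation.
Context {R : realType} {d : measure_display} {X : measurableType d}.
Variables (g : X -> X) (mg : measurable_fun setT g).
Local Open Scope ereal_scope.

Lemma ge0_integral_preserving (m1 m2 : {measure set X -> \bar R}) (f : X -> \bar R) :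
  (forall B, measurable B -> m1 (g @^-1` B) = m2 B) ->
  measurable_fun setT f -> (forall x, 0 <= f x) ->
  \int[m1]_x f (g x) = \int[m2]_x f x.
Proof.
move=> m12 mf f0.
transitivity (\int[pushforward m1 g]_x f x).
  by rewrite ge0_integral_pushforward// preimage_setT.
by apply: eq_measure_integral => A mA _; exact: m12.
Qed.

Variables N1 N2 : {finite_measure set X -> \bar R}.
Hypothesis N12 : forall B, measurable B -> N1 (g @^-1` B) = N2 B.

Lemma integral_power_preserving k (h : k.-tuple X -> \bar R) :
  measurable_fun setT h -> (forall u, 0 <= h u) ->
  \int[power_measure N1 k]_u h (map_tuple g u) = \int[power_measure N2 k]_u h u.
Proof.
have mgk n : measurable_fun setT (fun u : n.-tuple X => map_tuple g u).
  apply/measurable_fun_tnthP => i.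
  rewrite (_ : _ \o _ = g \o (@tnth _ X ^~ i)); last first.
    by apply/funext => u /=; rewrite tnth_map.
  exact: measurableT_comp mg (measurable_tnth i).
elim: k h => [|k IH] h mh h0.
  rewrite !integral_power0//; first by congr h; apply: val_inj.
  exact: measurableT_comp mh (mgk _).
rewrite !integral_powerS//; last exact: measurableT_comp mh (mgk _).
have mhc : measurable_fun setT (h \o @tuple_cons _ X k).
  exact: measurableT_comp mh (@measurable_tuple_cons _ X k).
rewrite -(ge0_integral_preserving N12 (f := fun x => \int[power_measure N2 k]_t h (tuple_cons (x, t)))).
- apply: eq_integral => x _; rewrite -IH.
  + by apply: eq_integral => u _; congr h; exact: val_inj.
  + have mp : measurable_fun setT (fun t : k.-tuple X => (g x, t)).
      by apply: measurable_fun_pair => //; exact: measurable_cst.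
    exact: measurableT_comp mhc mp.
  + by move=> u.
- exact: (measurable_integral_power N2 mhc (fun p => h0 _)).
- by move=> x; exact: integral_ge0.
Qed.

End preservation.

Section two_point_preserving.
Context {R : realType} {d : nat} {de : measure_display} {E : measurableType de}.
Notation X := (mspace R d E).
Variables (phi : X -> X -> R) (phiP : connection_function phi).
Variables (g : X -> X) (mg : measurable_fun setT g).
Hypothesis phig : forall x y, phi (g x) (g y) = phi x y.

Lemma list_conn_map l : list_conn phi (map g l) = list_conn phi l.
Proof.
rewrite /list_conn size_map; apply: eq_bern => q.
rewrite mem_pairs => /andP[q12 q2].
by rewrite !(nth_map point)// (ltn_trans q12).
Qed.

Lemma tau_window_preserving (N1 N2 : {finite_measure set X -> \bar R}) x y :
  (forall B, measurable B -> N1 (g @^-1` B) = N2 B) ->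
  tau_window phi N1 x y = tau_window phi N2 (g x) (g y).
Proof.
move=> N12; apply: eq_eseriesr => k _; congr (_ * _)%E.
  by rewrite -N12// preimage_setT.
rewrite -(integral_power_preserving mg N12).
- by apply: eq_integral => u _; rewrite -list_conn_map.
- apply/measurable_EFinP; apply: (measurable_list_conn phiP (n := k.+2)).
    by move=> u; rewrite /= size_tuple.
  case=> [|[|i]] /=; [exact: measurable_cst|exact: measurable_cst|].
  exact: measurable_nth_tuple.
- by move=> u; exact: list_conn_ge0.
Qed.

Context {dO : measure_display} {Om : measurableType dO}.
Variables (Q : probability Om R) (eta : @points R d de E Om)
  (M : {sigma_finite_measure set X -> \bar R}).
Hypothesis etaP : poisson_process Q eta M.
Variable e : seq X -> nat -> nat -> set Om.
Hypothesis eP : forall xs, random_connection phi Q (add_points xs eta) (e xs).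
Hypothesis Mg : forall B, measurable B -> M (g @^-1` B) = M B.

(** The two-point function is a limit along any exhausting sequence of windows,
    so the windows for x and y can be chosen as the preimages under g of those
    for g x and g y. *)
Lemma two_point_preserving x y : two_point Q e (g x) (g y) = two_point Q e x y.
Proof.
have /sigma_finiteP[F [TF ndF Foo]] := sigma_finiteT M.
have mF m : measurable (F m) by have [] := Foo m.
have {}Foo m : (M (F m) < +oo)%E by have [] := Foo m.
pose G m := g @^-1` (F m).
have mG m : measurable (G m) by rewrite /G -[X in measurable X]setTI; exact: mg.
have Goo m : (M (G m) < +oo)%E by rewrite /G Mg.
have ndG : nondecreasing_seq G.
  by move=> m n mn; apply/subsetPset => z; apply: (subsetPset _ _ (ndF _ _ mn)).
have cG : \bigcup_m G m = setT.
  by rewrite /G -preimage_bigcup -TF preimage_setT.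
have c1 := cvg_tau_window phiP etaP eP mF Foo ndF (esym TF) (x := g x) (y := g y).
have c2 := cvg_tau_window phiP etaP eP mG Goo ndG cG (x := x) (y := y).
apply: (cvg_unique _ c1) => //.
rewrite (_ : (fun m => _) = fun m => tau_window phi (mfrestr (mG m) (Goo m)) x y)//.
apply/funext => m; rewrite -(@tau_window_preserving (mfrestr (mG m) (Goo m)))//.
move=> B mB; by rewrite /= /mfrestr /mrestr -[RHS]Mg//; exact: measurableI.
Qed.

End two_point_preserving.

Section lebesgue_reflection.
Context {R : realType}.

Lemma measurable_reflection (c : R) : measurable_fun setT (fun r : R => c - r).
Proof. by apply: measurable_funB => //; exact: measurable_cst. Qed.

(** It suffices to compare the lengths of intervals. *)
Lemma lebesgue_measure_reflection (c : R) (B : set R) : measurable B ->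
  lebesgue_measure ((fun r => c - r) @^-1` B) = lebesgue_measure B.
Proof.
move=> mB; pose g : measurableTypeR R -> measurableTypeR R := fun r => c - r.
have mg : measurable_fun setT g := measurable_reflection c.
pose mu : {measure set (measurableTypeR R) -> \bar R} :=
  measure_function_pushforward__canonical__measure_function_Measure
  (@lebesgue_measure R) mg.
suff h Y : ocitv Y -> lebesgue_measure Y = mu Y.
  exact: (esym (lebesgue_measure_unique h mB)).
move=> [[a b] /= _ <-]; rewrite /mu/= /pushforward.
rewrite (_ : _ @^-1` _ = `[c - b, c - a[%classic); last first.
  by apply/seteqP; split => r /=; rewrite !in_itv/= /g => /andP[? ?]; apply/andP; split; lra.
rewrite !lebesgue_measure_itv/= !lte_fin (_ : (c - b < c - a) = (a < b)); last first.
  by apply/idP/idP; lra.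
by case: ifP => // _; rewrite -!EFinB; congr (_%:E); lra.
Qed.

(** By induction on the dimension, slice by slice. *)
Lemma lebesgue_rV_reflection n (c : 'rV[R]_n) (B : set 'rV[R]_n) : measurable B ->
  lebesgue_rV R n ((fun z => c - z) @^-1` B) = lebesgue_rV R n B.
Proof.
elim: n c B => [|n IH] c B mB.
  rewrite /= !diracE; congr (nat_of_bool _)%:R%:E.
  by apply/idP/idP => /set_mem h; apply/mem_set; move: h; rewrite /= [c - 0]thinmx0.
pose A := @rV_cons R n @^-1` B.
have mA : measurable A.
  by rewrite /A -[X in measurable X]setTI; exact: measurable_rV_cons.
pose c0 := (rV_uncons c).1; pose c1 := (rV_uncons c).2.
transitivity ((lebesgue_measure \x lebesgue_rV R n)%E (@rV_cons R n @^-1` ((fun z => c - z) @^-1` B))).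
  by [].
transitivity ((lebesgue_measure \x lebesgue_rV R n)%E A); last by [].
rewrite /product_measure1.
have cE r z : c - rV_cons (r, z) = rV_cons (c0 - r, c1 - z).
  apply/rowP => j; rewrite !mxE.
  by have [j' ->|->] := unliftP ord0 j; rewrite ?liftK ?unlift_none/= ?mxE.
have step := @ge0_integral_preserving R _ (measurableTypeR R) (fun r => c0 - r)
  (measurable_reflection c0) (@lebesgue_measure R) (@lebesgue_measure R)
  (fun r => lebesgue_rV R n (xsection A r)) (@lebesgue_measure_reflection c0).
apply: etrans (step _ _).
- apply: eq_integral => r _ /=.
  rewrite -[RHS](IH c1); last exact: measurable_xsection.
  congr (lebesgue_rV R n _); apply/seteqP; split => z;
    by rewrite /xsection/= !inE /A/= cE.
- exact: measurable_fun_xsection.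
- by move=> r; exact: measure_ge0.
Qed.

End lebesgue_reflection.

(** * The expected cluster size as a row integral *)

Section scaled_intensity.
Context {R : realType} {d : nat} {de : measure_display} {E : measurableType de}.
Notation X := (mspace R d E).
Variables (lam : {nonneg R}) (P : probability E R).
Local Open Scope ereal_scope.

Definition scaled_intensity : set X -> \bar R :=
  mscale lam (lebesgue_rV R d \x P).

HB.instance Definition _ := Measure.on scaled_intensity.

Let scaled_intensity_sigma_finite : sigma_finite setT scaled_intensity.
Proof.
have /sigma_finiteP[F [TF ndF Foo]] := sigma_finiteT (lebesgue_rV R d).
exists (fun n => F n `*` setT).
  apply/seteqP; split => // -[z a] _.
  by have [n _ Fz] : (\bigcup_i F i) z by [rewrite -TF]; exists n.
move=> n; have [mFn Fn] := Foo n; split; first exact: measurableX.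
have -> : scaled_intensity (F n `*` setT) =
    lam%:num%:E * lebesgue_rV R d (F n).
  congr (_ * _); apply: etrans (product_measure1E _ _ _ _) _ => //.
  by rewrite -[RHS]mule1; congr (_ * _); exact: probability_setT.
by rewrite lte_mul_pinfty ?lee_fin.
Qed.

HB.instance Definition _ := Measure_isSigmaFinite.Build _ _ _
  scaled_intensity scaled_intensity_sigma_finite.

Lemma integral_scaled_intensity (f : X -> \bar R) :
  measurable_fun setT f -> (forall x, 0 <= f x) ->
  \int[scaled_intensity]_x f x =
  lam%:num%:E * \int[P]_b \int[lebesgue_rV R d]_z f (z, b).
Proof.
move=> mf f0; rewrite ge0_integral_mscale//; congr (_ * _).
by rewrite fubini_tonelli2.
Qed.

Definition reflect (c : 'rV[R]_d) (x : X) : X := ((c - x.1)%R, x.2).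

Lemma measurable_reflect c : measurable_fun setT (reflect c).
Proof.
apply: measurable_fun_pair => //; apply/measurable_fun_rVP => i.
rewrite (_ : _ \o _ = fun x : X => (c ord0 i - rV_coord i x.1)%R).
  apply: measurable_funB; first exact: measurable_cst.
  exact: measurableT_comp (measurable_rV_coord i) measurable_fst.
by apply/funext => x; rewrite /rV_coord/= !mxE.
Qed.

Lemma scaled_intensity_reflect c B : measurable B ->
  scaled_intensity (reflect c @^-1` B) = scaled_intensity B.
Proof.
move=> mB.
have mB' : measurable (reflect c @^-1` B).
  by rewrite -[X in measurable X]setTI; exact: measurable_reflect.
have h (D : set X) : measurable D ->
    scaled_intensity D = lam%:num%:E * \int[P]_b \int[lebesgue_rV R d]_z (\1_D (z, b))%:E.
  move=> mD; transitivity (\int[scaled_intensity]_x (\1_D x)%:E).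
    by rewrite integral_indic// setIT.
  rewrite integral_scaled_intensity//.
  exact/measurable_EFinP/measurable_indic.
rewrite !h//; congr (_ * _); apply: eq_integral => b _.
have mc : measurable_fun setT (fun z : 'rV[R]_d => (c - z)%R).
  apply/measurable_fun_rVP => i.
  rewrite (_ : _ \o _ = fun z => (c ord0 i - rV_coord i z)%R).
    by apply: measurable_funB; [exact: measurable_cst|exact: measurable_rV_coord].
  by apply/funext => x; rewrite /rV_coord/= !mxE.
rewrite -(ge0_integral_preserving mc (lebesgue_rV_reflection c)
  (f := fun z => (\1_B (z, b))%:E)).
- by apply: eq_integral => z _; rewrite !indicE; congr (nat_of_bool _)%:R%:E; apply/idP/idP => /set_mem hz; apply/mem_set.
- have mi : measurable_fun setT (fun y : X => (\1_B y)%:E : \bar R).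
    exact/measurable_EFinP/measurable_indic.
  have mz : measurable_fun setT (fun z : 'rV[R]_d => ((z, b) : X)).
    by apply: measurable_fun_pair => //; exact: measurable_cst.
  exact: measurableT_comp mi mz.
- by move=> z; rewrite lee_fin.
Qed.

End scaled_intensity.

Section kernel.
Context {R : realType} {d : nat} {de : measure_display} {E : measurableType de}.
Notation X := (mspace R d E).
Context {P : probability E R} {phi : X -> X -> R}.
Hypothesis phiP : connection_function phi.
Context {lam : {nonneg R}}.
Variable xi : rcm P phi lam.
Local Open Scope ereal_scope.

Let M : {sigma_finite_measure set X -> \bar R} := scaled_intensity lam P.
Let Q := rcm_law xi.
Let etaP : poisson_process Q (rcm_points xi) M := rcm_poisson xi.
Let eP := rcm_connection xi.

Definition rcm_two_point : X -> X -> \bar R := two_point (rcm_law xi) (rcm_edges (r:=xi)).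
Notation T := rcm_two_point.

Lemma exhausting_windows : exists F : (set X)^nat,
  [/\ forall m, measurable (F m), forall m, M (F m) < +oo,
   nondecreasing_seq F & \bigcup_m F m = setT].
Proof.
have /sigma_finiteP[F [TF ndF Foo]] := sigma_finiteT M.
by exists F; split => // m; have [] := Foo m.
Qed.

Lemma rcm_two_point_itv x y : 0 <= T x y <= 1.
Proof.
have [F [mF Foo ndF cF]] := exhausting_windows.
exact: (two_point_itv etaP eP mF ndF cF).
Qed.

Lemma rcm_two_pointC x y : T x y = T y x.
Proof.
have [F [mF Foo ndF cF]] := exhausting_windows.
exact: (two_pointC phiP etaP eP mF Foo ndF cF).
Qed.

Lemma measurable_rcm_two_point : measurable_fun setT (fun p : X * X => T p.1 p.2).
Proof.
have [F [mF Foo ndF cF]] := exhausting_windows.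
exact: (measurable_two_point phiP etaP eP mF Foo ndF cF).
Qed.

Lemma rcm_two_point_reflect c x y : T (reflect c x) (reflect c y) = T x y.
Proof.
apply: (two_point_preserving phiP (measurable_reflect c) _ etaP eP).
  move=> [z a] [z' b]; rewrite /reflect/=.
  rewrite (connection_diff phiP _ _ _ _).2 (connection_diff phiP _ _ _ _).1.
  by congr (diff_form phi _ a b); rewrite opprB addrC subrKA.
by move=> B mB; exact: scaled_intensity_reflect.
Qed.

(** Reflect by z, which exchanges the positions, and use the symmetry. *)
Lemma rcm_two_point_swap z a b : T (z, a) (0%R, b) = T (z, b) (0%R, a).
Proof.
by rewrite -(rcm_two_point_reflect z) rcm_two_pointC /reflect/= subrr subr0.
Qed.

Definition kernel (a b : E) : \bar R := \int[lebesgue_rV R d]_z T (z, a) (0%R, b).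

Lemma kernelC a b : kernel a b = kernel b a.
Proof. by apply: eq_integral => z _; exact: rcm_two_point_swap. Qed.

Lemma kernel_ge0 a b : 0 <= kernel a b.
Proof. by apply: integral_ge0. Qed.

Lemma measurable_kernel : measurable_fun setT (fun p : E * E => kernel p.1 p.2).
Proof.
apply: (@measurable_fun_fubini_tonelli_F _ _ (E * E)%type 'rV[R]_d R (lebesgue_rV R d)
   (fun p : (E * E) * 'rV[R]_d => T (p.2, p.1.1) (0%R, p.1.2))) => //.
have mp : measurable_fun setT (fun p : (E * E) * 'rV[R]_d =>
    (((p.2, p.1.1) : X), ((0%R, p.1.2) : X))).
  apply: measurable_fun_pair; apply: measurable_fun_pair.
  - exact: measurable_snd.
  - exact: measurableT_comp measurable_fst measurable_fst.
  - exact: measurable_cst.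
  - exact: measurableT_comp measurable_snd measurable_fst.
exact: measurableT_comp measurable_rcm_two_point mp.
Qed.

(** Equation (1): the cluster size is integrated by [integral_cluster]. *)
Lemma chi_kernel a : chi xi a = 1 + lam%:num%:E * \int[P]_b kernel a b.
Proof.
have [F [mF Foo ndF cF]] := exhausting_windows.
rewrite /chi /cluster (integral_cluster phiP etaP eP mF Foo ndF cF).
congr (_ + _); rewrite integral_scaled_intensity//; last first.
  exact: (measurable_two_pointr phiP etaP eP mF Foo ndF cF).
congr (_ * _); apply: eq_integral => b _; apply: eq_integral => z _.
by rewrite -/(T _ _) rcm_two_pointC rcm_two_point_swap.
Qed.

Lemma measurable_chi : measurable_fun setT (chi xi).
Proof.
rewrite (_ : chi xi = fun a => 1 + lam%:num%:E * \int[P]_b kernel a b).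
  apply: emeasurable_funD; first exact: measurable_cst.
  apply: emeasurable_funM; first exact: measurable_cst.
  apply: (@measurable_fun_fubini_tonelli_F _ _ E E R P (fun p => kernel p.1 p.2)).
    exact: measurable_kernel.
  by move=> p; exact: kernel_ge0.
by apply/funext => a; exact: chi_kernel.
Qed.

Lemma chi_ge1 a : 1 <= chi xi a.
Proof.
rewrite chi_kernel leeDl// mule_ge0 ?lee_fin//.
by apply: integral_ge0 => b _; exact: kernel_ge0.
Qed.

(** Equation (2): the mean cluster size of the neighbour (z, b) is that of (0, b)
    by the invariance of the two-point function. *)
Lemma chi_le a : chi xi a <= 1 + lam%:num%:E *
  \int[P]_b ((\int[lebesgue_rV R d]_z (diff_form phi z a b)%:E) * chi xi b).
Proof.
have [F [mF Foo ndF cF]] := exhausting_windows.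
have chiE z c : 1 + \int[M]_y T (z, c) y = chi xi c.
  rewrite /chi /cluster (integral_cluster phiP etaP eP mF Foo ndF cF); congr (_ + _).
  rewrite -[RHS](ge0_integral_preserving (measurable_reflect z) (m1 := M)).
  - apply: eq_integral => y _; rewrite -/(T _ _) -[LHS](rcm_two_point_reflect z).
    by rewrite /reflect/= subrr.
  - by move=> B mB; exact: scaled_intensity_reflect.
  - exact: (measurable_two_pointr phiP etaP eP mF Foo ndF cF).
  - by move=> y.
rewrite -(chiE 0%R) leeD2l//.
apply: le_trans (integral_two_point_le phiP etaP eP mF Foo ndF cF _) _.
have phi0 x y : 0 <= (phi x y)%:E.
  by have /andP[] := connection_itv phiP x y; rewrite lee_fin.
have chi0 b : 0 <= chi xi b by apply: le_trans (chi_ge1 b).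
rewrite (eq_integral (fun y : X => (diff_form phi y.1 a y.2)%:E * chi xi y.2)); last first.
  move=> [z c] _; rewrite -(chiE z c); congr (_%:E * _).
  by rewrite (connection_diff phiP _ _ _ _).2 subr0.
have mdf : measurable_fun setT (fun y : X => (diff_form phi y.1 a y.2)%:E).
  apply/measurable_EFinP; apply: (measurable_connection phiP).
    by apply: measurable_fun_pair; [exact: measurable_fst|exact: measurable_cst].
  by apply: measurable_fun_pair; [exact: measurable_cst|exact: measurable_snd].
rewrite integral_scaled_intensity//; last 2 first.
- by apply: emeasurable_funM => //; exact: measurableT_comp measurable_chi measurable_snd.
- by move=> y; rewrite mule_ge0//; exact: phi0.
rewrite le_eqVlt; apply/orP; left; apply/eqP; congr (_ * _).
apply: eq_integral => b _; rewrite -ge0_integralZr//.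
- have mz : measurable_fun setT (fun z : 'rV[R]_d => (z, b)).
    by apply: measurable_fun_pair => //; exact: measurable_cst.
  exact: measurableT_comp mdf mz.
- by move=> z _; exact: phi0.
Qed.

End kernel.

(** * The two-point operator at frequency zero *)

Lemma measurable_rV_point {R : realType} n (c : 'rV[R]_n) : measurable [set c].
Proof.
rewrite (_ : [set c] = \bigcap_(i in [set: 'I_n]) (rV_coord i @^-1` [set c ord0 i])).
  apply: fin_bigcap_measurable => // i _.
  by rewrite -[X in measurable X]setTI; exact: measurable_rV_coord.
apply/seteqP; split => [z -> i _ //|z h]; apply/rowP => i; exact: (h i I).
Qed.

Lemma lebesgue_rV_point {R : realType} n (c : 'rV[R]_n) : (1 <= n)%N ->
  lebesgue_rV R n [set c] = 0%E.
Proof.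
case: n c => // n c _.
have mB : measurable ([set c ord0 ord0] `*` [set: 'rV[R]_n]).
  by apply: measurableX => //; exact: measurable_set1.
have h : (lebesgue_rV R n.+1 [set c] <=
    (lebesgue_measure \x lebesgue_rV R n) ([set (c ord0 ord0 : measurableTypeR R)] `*` [set: 'rV[R]_n]))%E.
  apply: (@le_measure _ _ _ (lebesgue_measure \x lebesgue_rV R n)%E); rewrite ?inE//.
    rewrite -[X in measurable X]setTI; apply: measurable_rV_cons => //.
    exact: measurable_rV_point.
  by move=> [r z] /= <-; split => //; rewrite mxE unlift_none.
apply/eqP; rewrite eq_le measure_ge0 andbT; apply: le_trans h _.
have l0 : (lebesgue_measure : set (measurableTypeR R) -> \bar R) [set c ord0 ord0] = 0%E.
  exact: lebesgue_measure_set1.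
by rewrite product_measure1E//= [X in (X * _)%E]l0 mul0e.
Qed.

Section tau_hat.
Context {R : realType} {d : nat} {de : measure_display} {E : measurableType de}.
Hypothesis d_ge1 : (1 <= d)%N.
Notation X := (mspace R d E).
Context {P : probability E R} {phi : X -> X -> R}.
Hypothesis phiP : connection_function phi.
Context {lam : {nonneg R}}.
Variable xi : rcm P phi lam.
Notation T := (rcm_two_point xi).
Notation leb := (lebesgue_rV R d).

Let mT a b : measurable_fun setT (fun z : 'rV[R]_d => T (z, a) (0, b)).
Proof.
have mp : measurable_fun setT (fun z : 'rV[R]_d => (((z, a) : X), ((0, b) : X))).
  by apply: measurable_fun_pair; [apply: measurable_fun_pair => //|]; exact: measurable_cst.
exact: measurableT_comp (measurable_rcm_two_point phiP xi) mp.
Qed.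

Lemma tau_diff_ge0 z a b : 0 <= tau_diff xi z a b.
Proof. by rewrite fine_ge0// measure_ge0. Qed.

(** Away from the origin the two vertices are different points.  The origin is
    negligible because the dimension is positive. *)
Lemma tau_diffE z a b : z != 0 -> tau_diff xi z a b = fine (T (z, a) (0, b)).
Proof.
move=> z0; rewrite /tau_diff /tau; congr (fine (rcm_law xi _)).
by apply/seteqP; split => w /=; [case=> // -[z00]; rewrite z00 eqxx in z0|right].
Qed.

Lemma measurable_tau_diff a b :
  measurable_fun setT (fun z => tau_diff xi z a b).
Proof.
pose f z : R := fine (T (z, a) (0, b)) * \1_(~` [set 0 : 'rV[R]_d]) z +
   tau_diff xi 0 a b * \1_[set 0 : 'rV[R]_d] z.
rewrite (_ : (fun z => _) = f).
  apply: measurable_funD; apply: measurable_funM.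
  - exact: measurableT_comp (fine_measurable measurableT) (mT a b).
  - by apply: measurable_indic; apply: measurableC; exact: measurable_rV_point.
  - exact: measurable_cst.
  - by apply: measurable_indic; exact: measurable_rV_point.
apply/funext => z; rewrite /f !indicE in_setC.
have [->|z0] := eqVneq z 0.
  by rewrite mem_set//= mulr0 add0r mulr1.
rewrite memNset/= ?mulr1 ?mulr0 ?addr0 ?tau_diffE// => z00.
by rewrite z00 eqxx in z0.
Qed.

Lemma integral_tau_diff a b :
  (\int[leb]_z (tau_diff xi z a b)%:E = kernel xi a b)%E.
Proof.
apply: ge0_ae_eq_integral => //.
- by apply/measurable_EFinP; exact: measurable_tau_diff.
- by move=> z _; rewrite lee_fin tau_diff_ge0.
exists [set 0]; split; first exact: measurable_rV_point.
  exact: lebesgue_rV_point.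
move=> z /= h; have [//|z0] := eqVneq z 0; exfalso; apply: h => _.
rewrite tau_diffE// fineK// ge0_fin_numE.
  by have /andP[_ h1] := rcm_two_point_itv xi (z, a) (0, b); apply: le_lt_trans h1 (ltry _).
by have /andP[] := rcm_two_point_itv xi (z, a) (0, b).
Qed.

Lemma fourier_integrand0 a b z :
  fourier_integrand xi 0 a b z = Complex (tau_diff xi z a b) 0.
Proof.
have u0 : \sum_(i < d) (0 : 'rV[R]_d) ord0 i * z ord0 i = 0.
  by rewrite big1// => i _; rewrite mxE mul0r.
by rewrite /fourier_integrand u0 cos0 sin0 /GRing.mul/= !(mul0r, mulr0) mul1r subr0 addr0.
Qed.

(** At k = 0 the integrand is real and nonnegative. *)
Lemma cintegrable_fourier_integrand0 a b :
  cintegrable leb (fourier_integrand xi 0 a b) <-> (kernel xi a b < +oo)%E.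
Proof.
rewrite /cintegrable.
rewrite (_ : (fun z => (complex.Re _)%:E) = fun z => (tau_diff xi z a b)%:E); last first.
  by apply/funext => z; rewrite fourier_integrand0.
rewrite (_ : (fun z => (complex.Im _)%:E) = fun=> 0%E); last first.
  by apply/funext => z; rewrite fourier_integrand0.
have absE : (\int[leb]_z `|(tau_diff xi z a b)%:E| = kernel xi a b)%E.
  rewrite -integral_tau_diff; apply: eq_integral => z _.
  by rewrite gee0_abs// lee_fin tau_diff_ge0.
split => [[/integrableP[_]]|k]; first by rewrite absE.
split; last exact: integrable0.
apply/integrableP; split; last by rewrite absE.
by apply/measurable_EFinP; exact: measurable_tau_diff.
Qed.

Lemma tau_hat0 a b : tau_hat xi 0 a b = Complex (fine (kernel xi a b)) 0.
Proof.
rewrite /tau_hat /cintegral /Rintegral; congr Complex.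
  congr fine; rewrite -integral_tau_diff; apply: eq_integral => z _.
  by rewrite fourier_integrand0.
rewrite (eq_integral (cst 0%E)) ?integral0// => z _.
by rewrite fourier_integrand0.
Qed.

Lemma T_hat0 f a : T_hat xi 0 f a =
  Complex (Rintegral P setT (fun b => fine (kernel xi a b) * complex.Re (f b)))
          (Rintegral P setT (fun b => fine (kernel xi a b) * complex.Im (f b))).
Proof.
rewrite /T_hat /cintegral; congr Complex; apply: eq_Rintegral => b _;
  rewrite tau_hat0; case: (f b) => x y; rewrite /GRing.mul/=.
  by rewrite mul0r subr0.
by rewrite mul0r addr0.
Qed.

Lemma cintegrable_T_hat0 f a : cintegrable P (fun b => tau_hat xi 0 a b * f b) <->
  P.-integrable setT (fun b => (fine (kernel xi a b) * complex.Re (f b))%:E) /\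
  P.-integrable setT (fun b => (fine (kernel xi a b) * complex.Im (f b))%:E).
Proof.
rewrite /cintegrable.
rewrite (_ : (fun b => (complex.Re _)%:E) =
    fun b => (fine (kernel xi a b) * complex.Re (f b))%:E); last first.
  apply/funext => b; rewrite tau_hat0; case: (f b) => x y.
  by rewrite /GRing.mul/= mul0r subr0.
rewrite (_ : (fun b => (complex.Im _)%:E) =
    fun b => (fine (kernel xi a b) * complex.Im (f b))%:E)//.
apply/funext => b; rewrite tau_hat0; case: (f b) => x y.
by rewrite /GRing.mul/= mul0r addr0.
Qed.

End tau_hat.

(** * Norms on a probability space *)

Section lp.
Context {R : realType} {d : measure_display} {E : measurableType d}.
Variable P : probability E R.
Local Open Scope ereal_scope.

Let PT : 0 < P [set: E]. Proof. by rewrite probability_setT. Qed.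

Lemma Lnorm_ess_sup f : Lnorm P +oo f = ess_sup P (abse \o f).
Proof. by rewrite unlock PT. Qed.

(** The integral of a nonnegative function is the supremum of the integrals of
    the simple functions below it, whether it is measurable or not.  It is
    applied to theta and to T f. *)
Lemma ge0_integral_le_nonmeasurable (f g : E -> \bar R) :
  (forall x, 0 <= f x) -> (forall x, f x <= g x) ->
  \int[P]_x f x <= \int[P]_x g x.
Proof.
move=> f0 fg; rewrite !ge0_integralTE//; last by move=> x; exact: le_trans (fg x).
by apply: le_ereal_sup => _ [h hf <-]; exists h => // x; exact: le_trans (fg x).
Qed.

Lemma Lnorm_ae0 (f : E -> \bar R) p : 1 <= p ->
  {ae P, forall x, f x = 0} -> Lnorm P p f = 0.
Proof.
move=> p1 [N [mN PN fN]].
have f0 x : ~ N x -> f x = 0.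
  by move=> nN; have [//|nf] := pselect (f x = 0); exfalso; apply: nN; exact: fN.
case: p p1 => [p p1| _|//].
- rewrite unlock; have p0 : p != 0%R by rewrite gt_eqF// (lt_le_trans ltr01).
  rewrite (_ : \int[P]_x _ = 0).
    by rewrite poweR0r// invr_eq0.
  apply/eqP; rewrite eq_le; apply/andP; split; last first.
    by apply: integral_ge0 => x _; exact: poweR_ge0.
  apply: (@le_trans _ _ (\int[P]_x (cst +oo \_ N) x)).
    apply: ge0_integral_le_nonmeasurable => x; first exact: poweR_ge0.
    rewrite patchE; case: ifPn => [_|/negP nN]; first exact: leey.
    by rewrite f0 ?abse0 ?poweR0r// => Nx; apply: nN; exact/mem_set.
  rewrite -integral_mkcond null_set_integral//.
- rewrite Lnorm_ess_sup; apply/eqP; rewrite eq_le; apply/andP; split.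
    apply/ess_supP; exists N; split => // x /= nf; apply: contrapT => nN.
    by apply: nf; rewrite /= f0// abse0.
  apply: (@ess_sup_gee _ _ _ _ _ _ PT); apply: nearW => x; exact: abse_ge0.
Qed.

Variable f : E -> \bar R.
Hypotheses (mf : measurable_fun setT f) (f1 : forall x, 1 <= f x).

Let f0 x : 0 <= f x. Proof. exact: le_trans (f1 x). Qed.
Let absf : abse \o f = f. Proof. by apply/funext => x /=; rewrite gee0_abs. Qed.

Let mfp (p : R) : measurable_fun setT (fun x => `|f x| `^ p).
Proof.
apply: (measurableT_comp (measurable_poweR p)).
exact: measurableT_comp.
Qed.

Lemma Lnorm1_ge1 : Lnorm P 1 f = \int[P]_x f x.
Proof. by rewrite Lnorm1; apply: eq_integral => x _; rewrite gee0_abs. Qed.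

Lemma integral_lty_ess_bounded (g : E -> \bar R) (c : \bar R) :
  measurable_fun setT g -> (forall x, 0 <= g x) -> c < +oo ->
  {ae P, forall x, g x <= c} -> \int[P]_x g x < +oo.
Proof.
move=> mg g0 coo gc.
apply: (@le_lt_trans _ _ (\int[P]_x (maxe c 0))).
  apply: ae_ge0_le_integral => //.
    by move=> x _; rewrite le_max lexx orbT.
  by apply: filterS gc => x gx _; rewrite le_max gx.
rewrite integral_cst//; apply: (@le_lt_trans _ _ (maxe c 0 * 1)).
  by apply: lee_wpmul2l; [rewrite le_max lexx orbT|exact: probability_le1].
by rewrite mule1 gt_max coo ltry.
Qed.

(** Since f >= 1, f <= f^p. *)
Lemma Lnorm1_Lnorm p : 1 <= p -> Lnorm P 1 f = +oo -> Lnorm P p f = +oo.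
Proof.
rewrite Lnorm1_ge1; case: p => [p p1|_|//] foo.
- have p1' : (1 <= p)%R by rewrite -lee_fin.
  rewrite unlock; apply: eqy_poweR; first by rewrite invr_gt0 (lt_le_trans ltr01).
  apply/eqP; rewrite -leye_eq -foo; apply: ge0_le_integral => //.
  move=> x _; rewrite gee0_abs//; have := f1 x; case: (f x) => [r| |//].
      rewrite !lee_fin => r1; rewrite -[leLHS]powRr1 ?(le_trans ler01)//.
      by apply: ler_powR.
    by rewrite eqy_poweR// (lt_le_trans ltr01).
- rewrite Lnorm_ess_sup absf; apply/eqP; rewrite -leye_eq leNgt; apply/negP => h.
  have : \int[P]_x f x < +oo.
    apply: integral_lty_ess_bounded mf f0 h _; exact: ess_sup_ge.
  by rewrite foo.
Qed.

(** The total mass is 1. *)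
Lemma Lnorm_Lnormy p : 1 <= p -> Lnorm P p f = +oo -> Lnorm P +oo f = +oo.
Proof.
case: p => [p p1|_ //|//].
have p1' : (1 <= p)%R by rewrite -lee_fin.
have p0 : (0 < p)%R by rewrite (lt_le_trans ltr01).
rewrite Lnorm_ess_sup absf => h; apply/eqP; rewrite -leye_eq leNgt; apply/negP => eoo.
suff : Lnorm P p%:E f < +oo by rewrite h.
rewrite unlock; apply: poweR_lty.
apply: (@integral_lty_ess_bounded _ (ess_sup P f `^ p)).
- exact: mfp.
- by move=> x; exact: poweR_ge0.
- exact: poweR_lty.
- apply: filterS (ess_sup_ge P f) => x fx; rewrite gee0_abs//.
  by apply: gt0_ler_poweR => //; [exact: ltW|rewrite in_itv/= f0 leey|
     rewrite in_itv/= (le_trans (f0 x) fx) leey].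
Qed.

End lp.

(** * The Schur test *)

Section schur.
Context {R : realType} {d : measure_display} {E : measurableType d}.
Variable P : probability E R.
Variable k : E -> E -> \bar R.
Local Open Scope ereal_scope.
Hypotheses (mk : measurable_fun setT (fun p : E * E => k p.1 p.2))
  (k0 : forall a b, 0 <= k a b) (kC : forall a b, k a b = k b a).

Let mpair (a : E) : measurable_fun setT (fun b : E => (a, b)).
Proof. by apply: measurable_fun_pair => //; exact: measurable_cst. Qed.

Let mka a : measurable_fun setT (k a).
Proof. exact: measurableT_comp mk (mpair a). Qed.

Definition kernel_apply (f : E -> R) (a : E) : \bar R :=
  \int[P]_b (k a b * (f b)%:E).

Variable f : E -> R.
Hypotheses (mf : measurable_fun setT f) (f0 : forall b, (0 <= f b)%R).

Let mEf : measurable_fun setT (fun b => (f b)%:E).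
Proof. exact/measurable_EFinP. Qed.

Let mf2 : measurable_fun setT (fun b => (f b * f b)%:E).
Proof. by apply/measurable_EFinP; exact: measurable_funM. Qed.

Let row a := \int[P]_b k a b.
Let u := kernel_apply f.
Let v a := \int[P]_b (k a b * (f b * f b)%:E).

Let ku0 a b : 0 <= k a b * (f b)%:E. Proof. by rewrite mule_ge0 ?lee_fin. Qed.
Let kv0 a b : 0 <= k a b * (f b * f b)%:E.
Proof. by rewrite mule_ge0 ?lee_fin ?mulr_ge0. Qed.
Let row0 a : 0 <= row a. Proof. exact: integral_ge0. Qed.
Let u0 a : 0 <= u a. Proof. exact: integral_ge0. Qed.
Let v0 a : 0 <= v a. Proof. exact: integral_ge0. Qed.
Let mku a : measurable_fun setT (fun b => k a b * (f b)%:E).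
Proof. exact: emeasurable_funM. Qed.
Let mkv a : measurable_fun setT (fun b => k a b * (f b * f b)%:E).
Proof. exact: emeasurable_funM. Qed.

Lemma measurable_row : measurable_fun setT row.
Proof. exact: (@measurable_fun_fubini_tonelli_F _ _ E E R P (fun p => k p.1 p.2)). Qed.

Lemma measurable_kernel_apply : measurable_fun setT (kernel_apply f).
Proof.
apply: (@measurable_fun_fubini_tonelli_F _ _ E E R P (fun p => k p.1 p.2 * (f p.2)%:E)) => [|p]//.
by apply: emeasurable_funM => //; exact: measurableT_comp mEf measurable_snd.
Qed.

Let mv : measurable_fun setT v.
Proof.
apply: (@measurable_fun_fubini_tonelli_F _ _ E E R P (fun p => k p.1 p.2 * (f p.2 * f p.2)%:E)) => [|p]//.
by apply: emeasurable_funM => //; exact: measurableT_comp mf2 measurable_snd.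
Qed.

(** Cauchy-Schwarz for the measure with density k a: the square of an integral is
    a double integral, to which 2 f(b) f(c) <= f(b)^2 + f(c)^2 applies. *)
Let cauchy_schwarz a : u a * u a <= row a * v a.
Proof.
have uu : u a * u a =
    \int[P]_b \int[P]_c ((k a b * k a c) * (f b * f c)%:E).
  rewrite {1}/u /kernel_apply.
  rewrite -(ge0_integralZr P measurableT (mku a) (fun b _ => ku0 a b) (u0 a)).
  apply: eq_integral => b _; rewrite /u /kernel_apply.
  rewrite -(ge0_integralZl P measurableT (mku a) (fun c _ => ku0 a c) (ku0 a b)).
  by apply: eq_integral => c _; rewrite EFinM muleACA.
have rv : row a * v a =
    \int[P]_b \int[P]_c ((k a b * k a c) * (f c * f c)%:E).
  rewrite /row -(ge0_integralZr P measurableT (mka a) (fun b _ => k0 a b) (v0 a)).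
  apply: eq_integral => b _; rewrite /v.
  rewrite -(ge0_integralZl P measurableT (mkv a) (fun c _ => kv0 a c) (k0 a b)).
  by apply: eq_integral => c _; rewrite muleA.
have vr : row a * v a =
    \int[P]_b \int[P]_c ((k a b * k a c) * (f b * f b)%:E).
  rewrite muleC /v.
  rewrite -(ge0_integralZr P measurableT (mkv a) (fun b _ => kv0 a b) (row0 a)).
  apply: eq_integral => b _; rewrite /row.
  rewrite -(ge0_integralZl P measurableT (mka a) (fun c _ => k0 a c) (kv0 a b)).
  by apply: eq_integral => c _; rewrite muleAC.
have mG (h : E * E -> R) : measurable_fun setT h ->
    measurable_fun setT (fun p : E * E => (k a p.1 * k a p.2) * (h p)%:E).
  move=> mh; apply: emeasurable_funM; last exact/measurable_EFinP.
  apply: emeasurable_funM; first exact: measurableT_comp (mka a) measurable_fst.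
  exact: measurableT_comp (mka a) measurable_snd.
have mf1 : measurable_fun setT (fun p : E * E => f p.1).
  exact: measurableT_comp mf measurable_fst.
have mf2' : measurable_fun setT (fun p : E * E => f p.2).
  exact: measurableT_comp mf measurable_snd.
have G0 (h : E * E -> R) : (forall p, (0 <= h p)%R) ->
    forall p, 0 <= (k a p.1 * k a p.2) * (h p)%:E.
  by move=> h0 p; rewrite mule_ge0 ?mule_ge0 ?lee_fin.
have fub (h : E * E -> R) : measurable_fun setT h -> (forall p, (0 <= h p)%R) ->
    \int[P]_b \int[P]_c ((k a b * k a c) * (h (b, c))%:E) =
    \int[P \x P]_p ((k a p.1 * k a p.2) * (h p)%:E).
  move=> mh h0; apply/esym.
  exact: (@fubini_tonelli1 _ _ E E R P P _ (mG h mh) (G0 h h0)).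
pose h12 (p : E * E) := (f p.1 * f p.2)%R.
pose h11 (p : E * E) := (f p.1 * f p.1)%R.
pose h22 (p : E * E) := (f p.2 * f p.2)%R.
have m12 : measurable_fun setT h12 by exact: (measurable_funM mf1 mf2').
have m11 : measurable_fun setT h11 by exact: (measurable_funM mf1 mf1).
have m22 : measurable_fun setT h22 by exact: (measurable_funM mf2' mf2').
have p12 p : (0 <= h12 p)%R by exact: mulr_ge0.
have p11 p : (0 <= h11 p)%R by exact: mulr_ge0.
have p22 p : (0 <= h22 p)%R by exact: mulr_ge0.
have twice : u a * u a + u a * u a <= row a * v a + row a * v a.
  rewrite {1}rv vr uu (fub h12 m12 p12) (fub h22 m22 p22) (fub h11 m11 p11).
  rewrite -(ge0_integralD _ measurableT (fun p _ => G0 _ p12 p) (mG _ m12)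
    (fun p _ => G0 _ p12 p) (mG _ m12)).
  rewrite -(ge0_integralD _ measurableT (fun p _ => G0 _ p22 p) (mG _ m22)
    (fun p _ => G0 _ p11 p) (mG _ m11)).
  apply: (ge0_le_integral _ measurableT).
  - by move=> p _; apply: adde_ge0; exact: G0.
  - by apply: emeasurable_funD; exact: mG.
  - by apply: emeasurable_funD; exact: mG.
  move=> [b c] _; rewrite -!ge0_muleDr ?lee_fin; last 4 first.
  - exact: p22.
  - exact: p11.
  - exact: p12.
  - exact: p12.
  apply: lee_wpmul2l; first exact: mule_ge0.
  rewrite -!EFinD lee_fin /h12 /h11 /h22 -subr_ge0/=.
  by rewrite (_ : _ - _ = (f b - f c) ^+ 2)%R ?sqr_ge0//; ring.
rewrite leNgt; apply/negP => h; move: twice; rewrite leNgt => /negP; apply.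
exact: lteD.
Qed.

(** After Cauchy-Schwarz, the integration over a is a column integral of k, which
    is a row integral by symmetry. *)
Lemma schur_test (C : R) : (0 <= C)%R -> {ae P, forall a, row a <= C%:E} ->
  \int[P]_a (u a * u a) <= (C * C)%:E * \int[P]_b (f b * f b)%:E.
Proof.
move=> C0 rC.
have muu : measurable_fun setT (fun a => u a * u a).
  by apply: emeasurable_funM; exact: measurable_kernel_apply.
apply: (@le_trans _ _ (\int[P]_a (C%:E * v a))).
  apply: ae_ge0_le_integral => //.
  - by move=> a _; rewrite mule_ge0.
  - by move=> a _; rewrite mule_ge0 ?lee_fin.
  - by apply: emeasurable_funM => //; exact: measurable_cst.
  apply: filterS rC => a ra _; apply: le_trans (cauchy_schwarz a) _.
  exact: lee_wpmul2r.
rewrite ge0_integralZl// ?lee_fin// EFinM -muleA; apply: lee_wpmul2l; rewrite ?lee_fin//.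
have -> : \int[P]_a v a = \int[P]_b (row b * (f b * f b)%:E).
  rewrite /v (@fubini_tonelli _ _ E E R P P (fun p => k p.1 p.2 * (f p.2 * f p.2)%:E)) /=; last 2 first.
  - by apply: emeasurable_funM => //; exact: measurableT_comp mf2 measurable_snd.
  - by move=> p; exact: kv0.
  apply: eq_integral => b _; rewrite ge0_integralZr// ?lee_fin ?mulr_ge0//.
  - by congr (_ * _); apply: eq_integral => a _; rewrite kC.
  - rewrite (_ : (fun a => k a b) = k b); first exact: mka.
    by apply/funext => a; rewrite kC.
have ff0 b : 0 <= (f b * f b)%:E by rewrite lee_fin mulr_ge0.
have CE0 : 0 <= C%:E by rewrite lee_fin.
rewrite -(ge0_integralZl P measurableT mf2 (fun b _ => ff0 b) CE0).
apply: ae_ge0_le_integral; first exact: measurableT.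
- by move=> b _; rewrite mule_ge0.
- by apply: emeasurable_funM => //; exact: measurable_row.
- by move=> b _; rewrite mule_ge0.
- by apply: emeasurable_funM => //; exact: measurable_cst.
by apply: filterS rC => b rb _; exact: lee_wpmul2r.
Qed.

End schur.

(** * The operator norm and the expected cluster size *)

Section complex_norm.
Context {R : realType}.

Lemma normc_ge0 (z : R[i]) : 0 <= Normc.normc z.
Proof. by case: z => x y; exact: sqrtr_ge0. Qed.

Lemma le_Re_normc (z : R[i]) : `|complex.Re z| <= Normc.normc z.
Proof.
case: z => x y /=; rewrite -sqrtr_sqr ler_sqrt ?lerDl ?sqr_ge0//.
by rewrite addr_ge0 ?sqr_ge0.
Qed.

Lemma le_Im_normc (z : R[i]) : `|complex.Im z| <= Normc.normc z.
Proof.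
case: z => x y /=; rewrite -sqrtr_sqr ler_sqrt ?lerDr ?sqr_ge0//.
by rewrite addr_ge0 ?sqr_ge0.
Qed.

Lemma normc_le (x y : R) : Normc.normc (Complex x y) <= `|x| + `|y|.
Proof.
rewrite /= -[leRHS]ger0_norm ?addr_ge0// -sqrtr_sqr ler_sqrt ?sqr_ge0//.
rewrite sqrrD !real_normK ?num_real// lerD2r lerDl.
by rewrite mulrn_wge0// mulr_ge0.
Qed.

Context {d : measure_display} {E : measurableType d} (P : probability E R).

Lemma measurable_normc (f : E -> R[i]) :
  measurable_fun setT (fun b => complex.Re (f b)) ->
  measurable_fun setT (fun b => complex.Im (f b)) ->
  measurable_fun setT (fun b => Normc.normc (f b)).
Proof.
move=> mr mi.
rewrite (_ : (fun b => _) =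
    (fun b => Num.sqrt (complex.Re (f b) ^+ 2 + complex.Im (f b) ^+ 2))); last first.
  by apply/funext => b; case: (f b).
apply: (measurableT_comp (continuous_measurable_fun (@sqrt_continuous R))).
by apply: measurable_funD; exact: measurable_funX.
Qed.

Lemma cnorm2E (f : E -> R[i]) : cnorm2 P f =
  ((\int[P]_b (Normc.normc (f b) * Normc.normc (f b))%:E) `^ 2^-1)%E.
Proof.
rewrite /cnorm2 unlock; congr (_ `^ _)%E; apply: eq_integral => b _.
by rewrite gee0_abs ?lee_fin ?normc_ge0// poweR_EFin powR_mulrn ?normc_ge0//.
Qed.

Lemma sqr_integral_ge0 (f : E -> R[i]) :
  (0 <= \int[P]_b (Normc.normc (f b) * Normc.normc (f b))%:E)%E.
Proof. by apply: integral_ge0 => b _; rewrite lee_fin mulr_ge0 ?normc_ge0. Qed.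

Lemma cnorm2_lty (f : E -> R[i]) : (cnorm2 P f < +oo)%E <->
  (\int[P]_b (Normc.normc (f b) * Normc.normc (f b))%:E < +oo)%E.
Proof.
rewrite cnorm2E; split; last exact: poweR_lty.
by apply: lty_poweRy; rewrite invr_eq0.
Qed.

Lemma cnorm2_le1 (f : E -> R[i]) : (cnorm2 P f <= 1)%E ->
  (\int[P]_b (Normc.normc (f b) * Normc.normc (f b))%:E <= 1)%E.
Proof.
rewrite cnorm2E => h; have I0 := sqr_integral_ge0 f.
set I := (\int[P]_b _)%E in h I0 *.
have -> : I = ((I `^ 2^-1) `^ 2)%E.
  by rewrite -poweRrM mulVf// poweRe1.
rewrite -[leRHS](@poweR1r R 2); apply: gt0_ler_poweR => //.
- by rewrite in_itv/= poweR_ge0 leey.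
- by rewrite in_itv/= lee01 leey.
Qed.

Lemma ae_lty (f : E -> \bar R) : measurable_fun setT f -> (forall a, 0 <= f a)%E ->
  (\int[P]_a f a < +oo)%E -> {ae P, forall a, (f a < +oo)%E}.
Proof.
move=> mf f0 foo.
have : P.-integrable setT f.
  apply/integrableP; split => //.
  by under eq_integral do rewrite gee0_abs//.
move=> /(integrable_ae measurableT); apply: filterS => a /(_ I).
by rewrite ge0_fin_numE.
Qed.

(** The measures of the sections of a null set integrate to zero. *)
Lemma ae_xsection_null (D : set (E * E)) : measurable D ->
  ((P \x P)%E D = 0)%E -> {ae P, forall a, {ae P, forall b, ~ D (a, b)}}.
Proof.
move=> mD D0.
have h : {ae P, forall a, P (xsection D a) = 0%E}.
  have := @ae_eq_integral_abs _ _ _ P _ measurableT (P \o xsection D).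
  move=> /(_ (measurable_fun_xsection P mD)) [+ _].
  rewrite (_ : \int[P]_x _ = (P \x P)%E D)%E; last first.
    by apply: eq_integral => a _; rewrite gee0_abs.
  by move=> /(_ D0); apply: filterS => a /(_ I).
apply: filterS h => a Da.
exists (xsection D a); split => //; first exact: measurable_xsection.
move=> b /= /contrapT nD; rewrite /xsection/=; exact/mem_set.
Qed.

End complex_norm.

Section fixed_intensity.
Context {R : realType} {d : nat} {de : measure_display} {E : measurableType de}.
Hypothesis d_ge1 : (1 <= d)%N.
Notation X := (mspace R d E).
Context {P : probability E R} {phi : X -> X -> R}.
Hypothesis phiP : connection_function phi.
Context {lam : {nonneg R}}.
Variable xi : rcm P phi lam.
Local Open Scope ereal_scope.

Notation k := (kernel xi).
Let row a := \int[P]_b k a b.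

Let mk : measurable_fun setT (fun p : E * E => k p.1 p.2).
Proof. exact: measurable_kernel. Qed.

Let mka a : measurable_fun setT (k a).
Proof.
have mp : measurable_fun setT (fun b : E => (a, b)).
  by apply: measurable_fun_pair => //; exact: measurable_cst.
exact: measurableT_comp mk mp.
Qed.

Let k0 a b : 0 <= k a b. Proof. exact: kernel_ge0. Qed.
Let kC a b : k a b = k b a. Proof. exact: kernelC. Qed.
Let mrow : measurable_fun setT row. Proof. exact: measurable_row. Qed.
Let row0 a : 0 <= row a. Proof. exact: integral_ge0. Qed.

Let mfk a : measurable_fun setT (fun b => fine (k a b)).
Proof. exact: measurableT_comp (fine_measurable measurableT) (mka a). Qed.

Let fine_le a b : (fine (k a b))%:E <= k a b.
Proof. by have := k0 a b; case: (k a b) => //= _; rewrite leey. Qed.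

Section bounded_rows.
Variable C : R.
Hypotheses (C0 : (0 <= C)%R) (rowC : {ae P, forall a, row a <= C%:E}).
Variable f : E -> R[i].
Hypothesis f2 : cL2 P f.
Let nf b := Normc.normc (f b).

Let mnf : measurable_fun setT nf.
Proof. by have [mr mi _] := f2; exact: measurable_normc. Qed.

Let nf0 b : (0 <= nf b)%R. Proof. exact: normc_ge0. Qed.

Let u := kernel_apply P k nf.

Let u0 a : 0 <= u a.
Proof. by apply: integral_ge0 => b _; rewrite mule_ge0 ?lee_fin. Qed.

Let mu_ : measurable_fun setT u.
Proof. exact: measurable_kernel_apply. Qed.

Let schur : \int[P]_a (u a * u a) <= (C * C)%:E * \int[P]_b (nf b * nf b)%:E.
Proof. exact: schur_test. Qed.

(** g is the real or the imaginary part of f. *)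
Let int_le a (g : E -> R) : measurable_fun setT g -> (forall b, `|g b| <= nf b)%R ->
  \int[P]_b `|(fine (k a b) * g b)%:E| <= u a.
Proof.
move=> mg gn; apply: ge0_le_integral => //.
- by apply: measurableT_comp => //; apply/measurable_EFinP; exact: measurable_funM.
- by apply: emeasurable_funM => //; exact/measurable_EFinP.
move=> b _; rewrite abse_EFin normrM EFinM; apply: lee_pmul; rewrite ?lee_fin//.
by rewrite ger0_norm ?fine_ge0//; exact: fine_le.
Qed.

Let Rint_le a (g : E -> R) : measurable_fun setT g -> (forall b, `|g b| <= nf b)%R ->
  (`|Rintegral P setT (fun b => fine (k a b) * g b)|%R)%:E <= u a.
Proof.
move=> mg gn; apply: le_trans (int_le a mg gn).
apply: le_trans (le_abse_integral P measurableT _); last first.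
  by apply/measurable_EFinP; exact: measurable_funM.
rewrite /Rintegral; case: (\int[P]_b _) => [r| |]; first by rewrite abse_EFin.
  by rewrite /= normr0 leey.
by rewrite /= normr0 leey.
Qed.

Lemma T_hat_defined_of_bounded_rows : T_hat_defined xi 0%R f.
Proof.
have [mr mi foo] := f2.
have u2 : \int[P]_a (u a * u a) < +oo.
  apply: le_lt_trans schur _; apply: lte_mul_pinfty; rewrite ?lee_fin ?mulr_ge0//.
  exact/cnorm2_lty.
have uoo : {ae P, forall a, u a * u a < +oo}.
  apply: ae_lty => //; first exact: emeasurable_funM.
  by move=> a; rewrite mule_ge0.
apply: filterS2 rowC uoo => a ra ua; split.
  have : {ae P, forall b, k a b < +oo}.
    by apply: ae_lty => //; apply: le_lt_trans ra (ltry _).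
  by apply: filterS => b kb; apply/cintegrable_fourier_integrand0.
have {}ua : u a < +oo.
  rewrite ltey; apply/eqP => uE; move: ua; rewrite uE mulyy ltxx//.
apply/cintegrable_T_hat0 => //; split; apply/integrableP; split.
- by apply/measurable_EFinP; exact: measurable_funM.
- by apply: le_lt_trans ua; apply: int_le => // b; exact: le_Re_normc.
- by apply/measurable_EFinP; exact: measurable_funM.
- by apply: le_lt_trans ua; apply: int_le => // b; exact: le_Im_normc.
Qed.

(** The real and the imaginary parts of T f are both bounded by u, whence the
    factor 4 = 2 * 2. *)
Lemma cnorm2_T_hat_le : cnorm2 P f <= 1 ->
  cnorm2 P (T_hat xi 0%R f) <= (4 * (C * C))%:E `^ 2^-1.
Proof.
move=> f1; have [mr mi _] := f2.
rewrite cnorm2E; apply: gt0_ler_poweR.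
- by rewrite invr_ge0.
- by rewrite in_itv/= leey andbT; apply: integral_ge0 => b _; rewrite lee_fin mulr_ge0 ?normc_ge0.
- by rewrite in_itv/= leey andbT lee_fin mulr_ge0// mulr_ge0.
have Tu a : (Normc.normc (T_hat xi 0%R f a))%:E <= 2%:E * u a.
  rewrite T_hat0//; apply: le_trans (_ : _ <= (`|_| + `|_|)%:E) _.
    by rewrite lee_fin; exact: normc_le.
  rewrite EFinD (_ : 2%:E = 1 + 1)// ge0_muleDl// mul1e; apply: leeD; apply: Rint_le => // b.
    exact: le_Re_normc.
  exact: le_Im_normc.
apply: (@le_trans _ _ (\int[P]_a (4%:E * (u a * u a)))).
  apply: ge0_integral_le_nonmeasurable => a; first by rewrite lee_fin mulr_ge0 ?normc_ge0.
  rewrite (_ : 4%:E = 2%:E * 2%:E); last by rewrite -EFinM -natrM.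
  by rewrite muleACA EFinM; apply: lee_pmul => //; rewrite lee_fin normc_ge0.
have muu : measurable_fun setT (fun a => u a * u a) by exact: emeasurable_funM.
have u20 a : 0 <= u a * u a by rewrite mule_ge0.
have e40 : 0 <= (4%:E : \bar R) by rewrite lee_fin.
rewrite (ge0_integralZl P measurableT muu (fun a _ => u20 a) e40) EFinM.
apply: lee_wpmul2l => //; apply: le_trans schur _.
rewrite -[leRHS]mule1; apply: lee_wpmul2l; first by rewrite lee_fin mulr_ge0.
exact: cnorm2_le1.
Qed.

End bounded_rows.

(** By (1), a bound on chi is a bound on the row integrals when lam > 0. *)
Lemma T_hat_norm_lty : (0 < lam%:num)%R -> Lnorm P +oo (chi xi) < +oo ->
  T_hat_norm xi 0%R < +oo.
Proof.
move=> lam0; rewrite Lnorm_ess_sup => s.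
pose c := ess_sup P (abse \o chi xi).
have [C C0 rowC] : exists2 C : R, (0 <= C)%R & {ae P, forall a, row a <= C%:E}.
  exists (`|fine c| / lam%:num)%R; first by rewrite divr_ge0.
  apply: filterS (ess_sup_ge P (abse \o chi xi)) => a; rewrite -/c /= => ca.
  have ca' : chi xi a <= c by apply: le_trans ca; exact: lee_abs.
  have c_fin : c \is a fin_num.
    rewrite ge0_fin_numE//; apply: le_trans ca'; apply: le_trans (chi_ge1 phiP xi a).
    exact: lee01.
  have lr : lam%:num%:E * row a <= (`|fine c|)%:E.
    apply: (@le_trans _ _ c); last by rewrite -{1}(fineK c_fin) lee_fin ler_norm.
    by apply: le_trans ca'; rewrite chi_kernel// leeDr.
  by rewrite EFinM muleC -lee_pdivrMl// ?invr_gt0// invrK.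
rewrite /T_hat_norm asboolT; last by move=> f f2; exact: T_hat_defined_of_bounded_rows rowC f f2.
apply: (@le_lt_trans _ _ ((4 * (C * C))%:E `^ 2^-1)); last exact: poweR_lty (ltry _).
apply: ge_ereal_sup => _ [f [f2 f1] <-]; exact: cnorm2_T_hat_le.
Qed.

Lemma integral_chi : \int[P]_a chi xi a = 1 + lam%:num%:E * \int[P]_a row a.
Proof.
rewrite (eq_integral (fun a => 1 + lam%:num%:E * row a)); last first.
  by move=> a _; exact: chi_kernel.
rewrite ge0_integralD//; last 2 first.
- by move=> a _; rewrite mule_ge0// lee_fin.
- by apply: emeasurable_funM => //; exact: measurable_cst.
rewrite ge0_integralZl//; congr (_ + _).
by rewrite integral_cst// mul1e; exact: probability_setT.
Qed.

(** The image of the constant function 1 is the function of the row integrals; it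
    is square-integrable, hence integrable. *)
Lemma integral_chi_lty : T_hat_norm xi 0%R < +oo -> \int[P]_a chi xi a < +oo.
Proof.
rewrite /T_hat_norm; case: asboolP => [Td|//] Tn.
pose one : E -> R[i] := fun=> Complex 1%R 0%R.
have normc1 b : Normc.normc (one b) = 1%R.
  by rewrite /one/= expr1n expr0n addr0 sqrtr1.
have one1 : \int[P]_b (Normc.normc (one b) * Normc.normc (one b))%:E = 1.
  rewrite (eq_integral (cst 1)) => [|b _]; last by rewrite normc1 mulr1.
  by rewrite integral_cst// mul1e; exact: probability_setT.
have one2 : cL2 P one.
  by split; [exact: measurable_cst|exact: measurable_cst|apply/cnorm2_lty; rewrite one1 ltry].
have onele : cnorm2 P one <= 1 by rewrite cnorm2E one1 poweR1r.
have T1 : cnorm2 P (T_hat xi 0%R one) < +oo.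
  by apply: le_lt_trans Tn; apply: ereal_sup_ubound; exists one.
have {}T1 := (cnorm2_lty _ _).1 T1.
have row2 : {ae P, forall a, row a * row a <=
    (Normc.normc (T_hat xi 0%R one a) * Normc.normc (T_hat xi 0%R one a))%:E}.
  apply: filterS (Td one one2) => a [ka] /(cintegrable_T_hat0 d_ge1 phiP)[ir _].
  have rE : row a = \int[P]_b (fine (k a b) * complex.Re (one b))%:E.
    apply: ge0_ae_eq_integral => //.
    - by apply/measurable_EFinP; apply: measurable_funM => //; exact: measurable_cst.
    - by move=> b _; rewrite lee_fin mulr1 fine_ge0.
    apply: filterS ka => b /(cintegrable_fourier_integrand0 d_ge1 phiP) kb _.
    by rewrite mulr1 fineK// ge0_fin_numE.
  have rfin : row a = (Rintegral P setT (fun b => (fine (k a b) * complex.Re (one b))%R))%:E.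
    by rewrite rE /Rintegral fineK//; exact: integrable_fin_num.
  rewrite T_hat0//.
  set r := Rintegral _ _ _ in rfin *; set s := Rintegral _ _ _.
  have rs : (`|r| <= Normc.normc (Complex r s))%R := le_Re_normc (Complex r s).
  have r0 : (0 <= r)%R by rewrite -lee_fin -rfin.
  by rewrite rfin lee_fin; apply: ler_pM => //; exact: le_trans (ler_norm r) rs.
have [N [mN N0 Nrow]] := row2.
have mrr : measurable_fun setT (fun a => row a * row a) by exact: emeasurable_funM.
(* The bound holds outside the measurable null set N; cutting off on N makes it
   hold everywhere without appealing to the measurability of T_hat one. *)
pose g a := row a * row a * (\1_(~` N) a)%:E.
have mg : measurable_fun setT g.
  apply: emeasurable_funM => //; apply/measurable_EFinP.
  by apply: measurable_indic; exact: measurableC.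
have g0 a : 0 <= g a by rewrite !mule_ge0.
have gE : \int[P]_a (row a * row a) = \int[P]_a g a.
  apply: ge0_ae_eq_integral => //; first by move=> a _; rewrite mule_ge0.
  exists N; split => // a /= ng; apply: contrapT => Na; apply: ng => _.
  by rewrite /g indicE mem_set// mule1.
have rr_lty : \int[P]_a (row a * row a) < +oo.
  rewrite gE; apply: le_lt_trans T1; apply: ge0_integral_le_nonmeasurable => // a.
  rewrite /g indicE; case: (pselect (N a)) => Na.
    by rewrite memNset ?mule0 ?lee_fin ?mulr_ge0 ?normc_ge0//; exact.
  rewrite mem_set// mule1; apply: contrapT => h; exact/Na/Nrow.
rewrite integral_chi; apply: lte_add_pinfty; first exact: ltry.
apply: lte_mul_pinfty; rewrite ?lee_fin//.
apply: (@le_lt_trans _ _ (\int[P]_a (1 + row a * row a))).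
  apply: ge0_le_integral => //.
    by apply: emeasurable_funD => //; exact: measurable_cst.
  move=> a _; have := row0 a; case: (row a) => [r||]//= r0.
  rewrite -EFinM -EFinD lee_fin; nra.
rewrite ge0_integralD//; last by move=> a _; rewrite mule_ge0.
rewrite integral_cst// mul1e; apply: lte_add_pinfty => //.
by apply: (@le_lt_trans _ _ 1); [exact: probability_le1|exact: ltry].
Qed.

End fixed_intensity.

(** * Percolation and critical intensities *)

Section percolation.
Context {R : realType} {d : nat} {de : measure_display} {E : measurableType de}.
Notation X := (mspace R d E).
Context {P : probability E R} {phi : X -> X -> R}.
Hypothesis phiP : connection_function phi.
Context {lam : {nonneg R}}.
Variable xi : rcm P phi lam.
Local Open Scope ereal_scope.

Let chi0 a : 0 <= chi xi a.
Proof. by apply: le_trans (chi_ge1 phiP xi a); exact: lee01. Qed.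

Lemma theta_eq0 a : chi xi a < +oo -> theta xi a = 0.
Proof.
have [F [mF Foo ndF cF]] := exhausting_windows (d := d) (lam := lam) (P := P).
pose c (w : rcm_space xi) : \bar R := counting (Defs.cluster (0%R, a) w).
have mc : measurable_fun setT c.
  apply: (measurable_counting
    (P := fun n => [set w | joined (rcm_edges (r:=xi) [:: (0%R, a)]) w 0%N n])) => n.
  exact: (@measurable_joined _ _ _ _ _ _ _ _ _ (scaled_intensity lam P)
    (rcm_poisson xi) _ (rcm_connection xi) _ mF ndF cF).
have c0 w : 0 <= c w by exact: (measure_ge0 (@counting nat R)).
have thetaE : [set w : rcm_space xi | infinite_set (Defs.cluster (0%R, a) w)] =
    c @^-1` [set +oo].
  by apply/seteqP; split => w /=; rewrite /c /counting; case: asboolP.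
move=> choo; rewrite /theta thetaE.
have mcoo : measurable (c @^-1` [set +oo]).
  by rewrite -[X in measurable X]setTI; exact: mc.
apply/(negligibleP (rcm_law xi) mcoo).
by apply: negligibleS (ae_lty mc c0 choo) => w /= ->; rewrite ltxx.
Qed.

(** Where chi is finite the cluster is almost surely finite; if chi is integrable,
    this is the case for almost every mark. *)
Lemma Lnorm1_chi_percolation p : 1 <= p -> 0 < Lnorm P p (theta xi) ->
  Lnorm P 1 (chi xi) = +oo.
Proof.
move=> p1 th; apply/eqP; rewrite -leye_eq leNgt; apply/negP.
rewrite (Lnorm1_ge1 P (chi_ge1 phiP xi)) => choo.
suff : Lnorm P p (theta xi) = 0 by move=> t0; rewrite t0 ltxx in th.
apply: Lnorm_ae0 => //.
by apply: filterS (ae_lty (measurable_chi phiP xi) chi0 choo) => a; exact: theta_eq0.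
Qed.

Let phihat a b := \int[lebesgue_rV R d]_z (diff_form phi z a b)%:E.

Let diff0 z a b : 0 <= (diff_form phi z a b)%:E.
Proof. by have /andP[] := connection_itv phiP (z, a) (0%R, b); rewrite lee_fin. Qed.

Let measurable_phihat a : measurable_fun setT (phihat a).
Proof.
apply: (@measurable_fun_fubini_tonelli_F _ _ E 'rV[R]_d R (lebesgue_rV R d)
   (fun p : E * 'rV[R]_d => (diff_form phi p.2 a p.1)%:E)) => //.
apply/measurable_EFinP; apply: (measurable_connection phiP).
  by apply: measurable_fun_pair; [exact: measurable_snd|exact: measurable_cst].
by apply: measurable_fun_pair; [exact: measurable_cst|exact: measurable_fst].
Qed.

(** Insert the essential bound on D in (2). *)
Lemma Lnormy_chi_lty :
  ess_sup (P \x P) (fun ab => \int[lebesgue_rV R d]_z (diff_form phi z ab.1 ab.2)%:E)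
    < +oo ->
  Lnorm P 1 (chi xi) < +oo -> Lnorm P +oo (chi xi) < +oo.
Proof.
rewrite (Lnorm1_ge1 P (chi_ge1 phiP xi)); set D := ess_sup _ _ => Doo choo.
have [C C0 DC] : exists2 C : R, (0 <= C)%R & D <= C%:E.
  exists `|fine D|%R => //; move: Doo; case: (D) => [r| |]//= _; last exact: leNye.
  by rewrite lee_fin ler_norm.
have [N [mN N0 NC]] := ess_sup_ge (P \x P)%E (fun ab => phihat ab.1 ab.2).
have rows : {ae P, forall a, {ae P, forall b, phihat a b <= C%:E}}.
  apply: filterS (ae_xsection_null mN N0) => a; apply: filterS => b Nab.
  by apply: contrapT => h; apply/Nab/NC => /= h'; apply/h/(le_trans h').
pose B := 1 + lam%:num%:E * (C%:E * \int[P]_b chi xi b).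
rewrite Lnorm_ess_sup; apply: (@le_lt_trans _ _ B); last first.
  apply: lte_add_pinfty; first exact: ltry.
  by do 2 (apply: lte_mul_pinfty; rewrite ?lee_fin//).
apply/ess_supP; apply: filterS rows => a rowa /=; rewrite gee0_abs//.
apply: le_trans (chi_le phiP xi a) _; rewrite /B leeD2l// lee_wpmul2l ?lee_fin//.
rewrite -ge0_integralZl ?lee_fin//; last exact: measurable_chi.
apply: ae_ge0_le_integral => //.
- by move=> b _; rewrite mule_ge0//; exact: integral_ge0.
- by apply: emeasurable_funM; [exact: measurable_phihat|exact: measurable_chi].
- by move=> b _; rewrite mule_ge0// lee_fin.
- by apply: emeasurable_funM; [exact: measurable_cst|exact: measurable_chi].
by apply: filterS rowa => b hb _; exact: lee_wpmul2r.
Qed.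

End percolation.

Section critical_intensities.
Context {R : realType} {d : nat} {de : measure_display} {E : measurableType de}.
Local Open Scope ereal_scope.

Lemma intensity_inf_le (S S' : set {nonneg R}) : S `<=` S' ->
  intensity_inf S' <= intensity_inf S.
Proof. by move=> SS'; apply: ereal_inf_le_tmp; exact: image_subset. Qed.

Hypothesis d_ge1 : (1 <= d)%N.
Notation X := (mspace R d E).
Context {P : probability E R} {phi : X -> X -> R}.
Hypothesis phiP : connection_function phi.
Variable xi : forall lam : {nonneg R}, rcm P phi lam.

Lemma lambda_T_infty_le_O : lambda_T xi +oo <= lambda_O xi.
Proof.
apply: intensity_inf_le => lam /= [lam0 Toh].
apply/eqP; rewrite -leye_eq leNgt; apply/negP => choo.
by have := T_hat_norm_lty d_ge1 phiP lam0 choo; rewrite Toh ltxx.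
Qed.

Lemma lambda_O_le_T1 : lambda_O xi <= lambda_T xi 1.
Proof.
apply: intensity_inf_le => lam /=.
rewrite (Lnorm1_ge1 P (chi_ge1 phiP (xi lam))) => choo; split.
  rewrite lt_neqAle [(0 <= _)%R]ge0 andbT; apply/eqP => lam0.
  suff : \int[P]_a chi (xi lam) a = 1 by rewrite choo.
  rewrite (eq_integral (cst 1)) => [|a _].
    by rewrite integral_cst// mul1e; exact: probability_setT.
  by rewrite chi_kernel// -lam0 mul0e adde0.
apply/eqP; rewrite -leye_eq leNgt; apply/negP => Too.
by have := integral_chi_lty d_ge1 phiP Too; rewrite choo ltxx.
Qed.

Lemma lambda_T1_le_c p : 1 <= p -> lambda_T xi 1 <= lambda_c xi p.
Proof.
by move=> p1; apply: intensity_inf_le => lam /=; exact: Lnorm1_chi_percolation.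
Qed.

Lemma lambda_T_le p : 1 <= p -> lambda_T xi p <= lambda_T xi 1.
Proof.
move=> p1; apply: intensity_inf_le => lam /=.
by apply: Lnorm1_Lnorm => //; [exact: measurable_chi|exact: chi_ge1].
Qed.

Lemma lambda_T_infty_le p : 1 <= p -> lambda_T xi +oo <= lambda_T xi p.
Proof.
move=> p1; apply: intensity_inf_le => lam /=.
by apply: Lnorm_Lnormy => //; [exact: measurable_chi|exact: chi_ge1].
Qed.

Lemma lambda_T1_le_infty :
  ess_sup (P \x P) (fun ab => \int[lebesgue_rV R d]_z (diff_form phi z ab.1 ab.2)%:E)
    < +oo ->
  lambda_T xi 1 <= lambda_T xi +oo.
Proof.
move=> D; apply: intensity_inf_le => lam /= choo.
apply/eqP; rewrite -leye_eq leNgt; apply/negP => ch1.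
by have := Lnormy_chi_lty phiP D ch1; rewrite choo.
Qed.

End critical_intensities.

Local Open Scope ereal_scope.

Theorem proposition2p1 (R : realType) (d : nat) (d_ge1 : (1 <= d)%N)
    (de : measure_display) (E : measurableType de) (P : probability E R)
    (P_separable : separable_probability P)
    (phi : mspace R d E -> mspace R d E -> R) (phiP : connection_function phi)
    (xi : forall lam : {nonneg R}, rcm P phi lam) :
  [/\ lambda_T xi +oo <= lambda_O xi,
      lambda_O xi <= lambda_T xi 1,
      (forall p : \bar R, 1 <= p -> lambda_T xi 1 <= lambda_c xi p) &
      ess_sup (P \x P)
        (fun ab => \int[lebesgue_rV R d]_z (diff_form phi z ab.1 ab.2)%:E)
        < +oo ->
      forall p : \bar R, 1 <= p -> lambda_T xi p = lambda_O xi].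
Proof.
split.
- exact: lambda_T_infty_le_O.
- exact: lambda_O_le_T1.
- by move=> p; exact: lambda_T1_le_c.
move=> D p p1; apply/eqP; rewrite eq_le; apply/andP; split.
- apply: le_trans (lambda_T_le phiP xi p1) _.
  exact: le_trans (lambda_T1_le_infty phiP xi D) (lambda_T_infty_le_O d_ge1 phiP xi).
- apply: le_trans (lambda_O_le_T1 d_ge1 phiP xi) _.
  exact: le_trans (lambda_T1_le_infty phiP xi D) (lambda_T_infty_le phiP xi p1).
Qed.
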